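(* Let $n>4$ be an integer and let $s\ge 0$ be a real number. Suppose that for every $f\in H^s(\mathbb R^n)$ one has $$\lim_{t\to 0} e^{it\Delta}f(x)=f(x)\quad\text{for almost every } x\in\mathbb R^n .$$ Then $s\ge \frac{n-2}{2n}$.
   Context: For real $s\ge 0$, $H^s(\mathbb R^n)$ is the inhomogeneous $L^2$-based Sobolev space of complex-valued $f\in L^2(\mathbb R^n)$ with $\int_{\mathbb R^n}(1+|\xi|^2)^s|\widehat f(\xi)|^2\,d\xi<\infty$, where $\widehat f(\xi)=\int_{\mathbb R^n} f(x)e^{-ix\cdot\xi}\,dx$ (extended to $L^2$ as usual). The Schr\''odinger group $e^{it\Delta}$, which gives the solution $u(x,t)=e^{it\Delta}f(x)$ of $iu_t-\Delta u=0$, $u(x,0)=f(x)$, $(x,t)\in\mathbb R^n\times\mathbb R$, is given by $$e^{it\Delta}f(x)=(2\pi)^{-n}\int_{\mathbb R^n} e^{i(x\cdot\xi+t|\xi|^2)}\,\widehat f(\xi)\,d\xi .$$ When $\widehat f$ is not integrable, the pointwise value $e^{it\Delta}f(x)$ is understood as the limit, as $k\to\infty$ through the positive integers, of the same integral restricted to $|\xi|\le 2^k$; the almost everywhere convergence statement includes that, for almost every $x$, these limits exist for all sufficiently small $|t|$, $t\neq0$. *)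

(* Defs.v *)
From HB Require Import structures.
From mathcomp Require Import all_boot all_order all_algebra.
From mathcomp Require Import complex.
From mathcomp Require Import all_classical all_reals all_analysis.

Set Implicit Arguments.
Unset Strict Implicit.
Unset Printing Implicit Defensive.

Import Order.TTheory GRing.Theory Num.Theory.
Import numFieldNormedType.Exports.

Local Open Scope classical_set_scope.
Local Open Scope ring_scope.
Local Open Scope complex_scope.

(* R^n; [measurableTypeR R] is R with its Borel sigma-algebra, so that the
   n-tuples carry the product, i.e. Borel, sigma-algebra. *)
Notation euclid R n := (n.-tuple (measurableTypeR R)).

(* The topology given by the modulus, as for any [numFieldType]. *)
HB.instance Definition _ (R : realType) :=
  NormedModule.copy R[i] (R[i] : numFieldType)^o.

Section euclidean_measure.
Variable R : realType.

Definition euclid_cons n (p : measurableTypeR R * euclid R n) :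
  euclid R n.+1 := [tuple of p.1 :: p.2].

Definition euclid_uncons n (v : euclid R n.+1) :
  measurableTypeR R * euclid R n := (thead v, [tuple of behead v]).

(* The n-fold product of the one-dimensional Lebesgue measure on Borel sets.
   Its null sets in the sense of [negligible] (subsets of Borel sets of measure
   zero) are exactly the Lebesgue null sets. *)
Fixpoint lebesgue_measure_euclid n : set (euclid R n) -> \bar R :=
  match n with
  | 0 => \d_[tuple]
  | n'.+1 => pushforward
      (product_measure1 (@lebesgue_measure R) (@lebesgue_measure_euclid n'))
      (@euclid_cons n')
  end.

Lemma measurable_euclid_cons n : measurable_fun setT (@euclid_cons n).
Proof. exact: measurable_cons. Qed.

Lemma measurable_euclid_uncons n : measurable_fun setT (@euclid_uncons n).
Proof.
apply: measurable_fun_pair; first exact: measurable_tnth.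
exact: measurable_behead.
Qed.

Lemma euclid_consK n : cancel (@euclid_cons n) (@euclid_uncons n).
Proof. by move=> [a t]; congr pair; apply/val_inj. Qed.

Let sigma_finite_pack d (T : measurableType d) (m : {measure set T -> \bar R}) :
  sigma_finite setT m ->
  exists m' : {sigma_finite_measure set T -> \bar R},
    (m' : set T -> \bar R) = m.
Proof.
move=> msf.
pose H2 := isSFinite.Build _ _ _ _ (sfinite_measure_sigma_finite msf).
pose H3 := isSigmaFinite.Build _ _ _ _ msf.
pose m' := HB.pack_for (SigmaFiniteMeasure.type T R) (Measure.sort m) H2 H3.
by exists m'.
Qed.

Let lebesgue_measure_euclid_sfin n :
  exists m : {sigma_finite_measure set (euclid R n) -> \bar R},
    (m : set (euclid R n) -> \bar R) = @lebesgue_measure_euclid n.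
Proof.
elim: n => [|n [m mE]].
  by exists (\d_([tuple] : euclid R 0))%R.
pose P : {measure set (measurableTypeR R * euclid R n)%type -> \bar R} :=
  (@lebesgue_measure R \x m)%E.
pose mc := @measurable_euclid_cons n.
pose Q0 : {measure set (euclid R n.+1) -> \bar R} :=
  pushforward P (@euclid_cons n).
pose Q := Q0 mc.
have Qsf : sigma_finite setT Q.
  have /sigma_finiteP[F [FT ndF Ffin]] := sigma_finiteT (@lebesgue_measure R).
  have /sigma_finiteP[G [GT ndG Gfin]] := sigma_finiteT m.
  exists (fun k => @euclid_uncons n @^-1` (F k `*` G k)).
    apply/esym; rewrite -subTset => v _.
    have [i _ Fi] : (\bigcup_k F k) (thead v) by rewrite -FT.
    have [j _ Gj] : (\bigcup_k G k) [tuple of behead v] by rewrite -GT.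
    exists (maxn i j) => //; split => /=.
    - by move: Fi; exact/subsetPset/ndF/leq_maxl.
    - by move: Gj; exact/subsetPset/ndG/leq_maxr.
  move=> k; have [mF Fk] := Ffin k; have [mG Gk] := Gfin k; split.
    rewrite -[X in measurable X]setTI.
    by apply: measurable_euclid_uncons => //; exact: measurableX.
  rewrite (_ : Q _ = P (F k `*` G k)).
    by rewrite [P _]product_measure1E// lte_mul_pinfty// ge0_fin_numE.
  by congr (P _); apply/funext => p; rewrite -[in RHS](euclid_consK p).
have [m' m'E] := sigma_finite_pack Qsf.
by exists m'; rewrite m'E /= -mE.
Qed.

Section instances.
Variable n : nat.
Local Notation mu := (@lebesgue_measure_euclid n).

Let mu0 : mu set0 = 0%E.
Proof. by have [m <-] := lebesgue_measure_euclid_sfin n; rewrite measure0. Qed.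

Let mu_ge0 A : (0 <= mu A)%E.
Proof. by have [m <-] := lebesgue_measure_euclid_sfin n; exact: measure_ge0. Qed.

Let mu_sigma_additive : semi_sigma_additive mu.
Proof.
have [m <-] := lebesgue_measure_euclid_sfin n.
exact: measure_semi_sigma_additive.
Qed.

HB.instance Definition _ := isMeasure.Build _ _ _ mu
  mu0 mu_ge0 mu_sigma_additive.

Let mu_sigma_finite : sigma_finite setT mu.
Proof.
by have [m <-] := lebesgue_measure_euclid_sfin n; exact: sigma_finiteT.
Qed.

HB.instance Definition _ := Measure_isSigmaFinite.Build _ _ _ mu
  mu_sigma_finite.

End instances.
End euclidean_measure.

Lemma lebesgue_measure_euclidS (R : realType) n (A : set (measurableTypeR R))
    (B : set (euclid R n)) : measurable A -> measurable B ->
  @lebesgue_measure_euclid R n.+1 [set v | A (thead v) /\ B [tuple of behead v]]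
  = (@lebesgue_measure R A * @lebesgue_measure_euclid R n B)%E.
Proof.
move=> mA mB; rewrite -product_measure1E//= /pushforward.
congr (_ _); apply/funext => -[a t].
by rewrite /preimage/= /euclid_cons/=; congr (_ /\ B _); exact/val_inj.
Qed.

Section complex_functions.
Context d (T : measurableType d) (R : realType).
Variable mu : {measure set T -> \bar R}.

Definition cintegrable (D : set T) (f : T -> R[i]) : Prop :=
  mu.-integrable D (fun x => (complex.Re (f x))%:E) /\
  mu.-integrable D (fun x => (complex.Im (f x))%:E).

Definition cintegral (D : set T) (f : T -> R[i]) : R[i] :=
  (\int[mu]_(x in D) complex.Re (f x))%R +i*
  (\int[mu]_(x in D) complex.Im (f x))%R.

Definition cmeasurable (f : T -> R[i]) : Prop :=
  measurable_fun setT (fun x => complex.Re (f x) : measurableTypeR R) /\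
  measurable_fun setT (fun x => complex.Im (f x) : measurableTypeR R).

Definition L2norm_sq (f : T -> R[i]) : \bar R :=
  \int[mu]_x (Normc.normc (f x) ^+ 2)%:E.

Definition in_L2 (f : T -> R[i]) : Prop :=
  cmeasurable f /\ (L2norm_sq f < +oo)%E.

Definition cvg_L2 (h : nat -> T -> R[i]) (f : T -> R[i]) : Prop :=
  L2norm_sq (fun x => h k x - f x) @[k --> \oo] --> 0%E.

End complex_functions.

Section schrodinger.
Variables (R : realType) (n : nat).
Local Notation leb := (@lebesgue_measure_euclid R n).

Definition dotp (x y : euclid R n) : R :=
  \sum_(i < n) (tnth x i : R) * (tnth y i : R).

Definition enorm (x : euclid R n) : R := Num.sqrt (dotp x x).

Definition expi (theta : R) : R[i] := cos theta +i* sin theta.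

Definition fourier_L1 (f : euclid R n -> R[i]) (xi : euclid R n) : R[i] :=
  cintegral leb setT (fun x => f x * expi (- dotp x xi)).

(* [fhat] is (a representative of) the Fourier transform of [f] in L^2: the
   pair lies in the closure, in L^2 x L^2, of the graph of [fourier_L1] on
   L^1 /\ L^2. By Plancherel this closure is the graph of the continuous
   extension of the transform to L^2. *)
Definition is_fourier_L2 (f fhat : euclid R n -> R[i]) : Prop :=
  [/\ in_L2 leb f, in_L2 leb fhat &
    exists h : nat -> euclid R n -> R[i],
      [/\ forall k, cintegrable leb setT (h k) /\ in_L2 leb (h k),
          cvg_L2 leb h f &
          cvg_L2 leb (fun k => fourier_L1 (h k)) fhat]].

Definition sobolev (s : R) (f : euclid R n -> R[i]) : Prop :=
  in_L2 leb f /\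
  exists2 fhat, is_fourier_L2 f fhat &
    (\int[leb]_xi ((1 + enorm xi ^+ 2) `^ s * Normc.normc (fhat xi) ^+ 2)%:E
       < +oo)%E.

Definition schrodinger_integral (D : set (euclid R n))
    (fhat : euclid R n -> R[i]) (t : R) (x : euclid R n) : R[i] :=
  ((2 * pi) ^- n)%:C *
  cintegral leb D
    (fun xi => expi (dotp x xi + t * enorm xi ^+ 2) * fhat xi).

(* [schrodinger_value fhat t x v]: the pointwise value at x of the Schroedinger
   evolution at time t of the function with Fourier transform [fhat] exists and
   equals v. *)
Definition schrodinger_value (fhat : euclid R n -> R[i]) (t : R)
    (x : euclid R n) (v : R[i]) : Prop :=
  (cintegrable leb setT fhat /\ v = schrodinger_integral setT fhat t x) \/
  (~ cintegrable leb setT fhat /\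
   schrodinger_integral [set xi | enorm xi <= 2 ^+ k] fhat t x
     @[k --> \oo] --> v).

(* The values exist for all sufficiently small t <> 0, and tend to f(x) as
   t -> 0; values are unique, so the choice of u is immaterial. *)
Definition schrodinger_cvg_at (f fhat : euclid R n -> R[i]) (x : euclid R n) :
    Prop :=
  exists2 u : R -> R[i],
    (\forall t \near 0^', schrodinger_value fhat t x (u t)) &
    u t @[t --> 0^'] --> f x.

End schrodinger.

(* Main.v *)
(* The counterexample for small [s] is a sum of wave packets with a gliding hump.

   The packet of scale [q] is a tensor product over the coordinates [d < n] of
   [(1/q) * sum_(m < q) exp (- |x|) * exp (i c_m x)]; its Fourier transform is a
   nonnegative comb of [q] Lorentzians centred at [c_m = L (m + 1 + alpha_d / 2)],
   where [Q] is a multiple of [q], [L = Q^(n+1)] and [alpha_d = Q^-(d+1)]. At the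
   times [t = 2 pi k / L^2] the phase [t c_m^2] is, modulo [2 pi], affine in [m]
   with slope [2 pi k / Q^(d+1)]. The slopes [(k / Q^(d+1))_d], [1 <= k <= Q^n],
   are [1/Q]-dense in the torus, so for every [x] in a fixed cube some [k] cancels
   the slopes [L x_d] and all the frequencies add up. The evolved packet then has
   modulus at least a constant times the amplitude, whereas the squared [H^s] norm
   is [O((L q)^(2 s) q^-n) = O(q^(2 s (n + 2) - n))], which tends to 0 as soon as
   [s < n / (2 (n + 2))], in particular if [s < (n - 2) / (2 n)].

   With geometrically growing amplitudes and scales chosen one after the other,
   each packet is negligible at the times of the earlier ones (Riemann-Lebesgue)
   and on the low frequencies which carry them. The evolution is thus unbounded
   as [t] tends to 0 at every point of the cube. The transform of the sum is not
   integrable, so that the pointwise values are limits of truncated integrals,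
   which are estimated along the balls that almost exhaust the packets. *)

Require Import Defs.
From mathcomp Require Import all_boot all_order all_algebra.
From mathcomp Require Import complex.
From mathcomp Require Import all_classical all_reals all_analysis.
From mathcomp Require Import measurable_realfun ring lra.

Set Implicit Arguments.
Unset Strict Implicit.
Unset Printing Implicit Defensive.

Import Order.TTheory GRing.Theory Num.Theory.
Import numFieldNormedType.Exports.

Local Open Scope classical_set_scope.
Local Open Scope ring_scope.

(** * Integrals on the line *)

(** The obstacle is that one time has to synchronise [n] coordinates at once. A tensor product
    evolves as a product of one-dimensional factors, so a single integer [k] must cancel [n]
    prescribed slopes. With [q] frequencies per coordinate each slope may be wrong by a small
    multiple of [1/q] only, which asks for about [q^n] values of [k] and explains the denominators
    [Q^(d+1)]. The additional power in [L = Q^(n+1)] keeps the drift [2 t c_m], of size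
    [k q / L <= q / Q], small, so that a whole spike stays in phase with its centre; this is where
    frequencies of order [q^(n+2)] come from. The resulting exponent covers the claim because
    [(n-2)(n+2) < n^2]. The profile [exp (- |x|)] is chosen because it and its transform have
    explicit integrals; positivity of the transform rules out cancellation between packets on the
    frequency side, and its quadratic decay suffices for the weights, as only [s <= 1] occurs. *)

Section line.
Variable R : realType.
Local Notation leb := (@lebesgue_measure R).
Implicit Types (b c w : R) (G : R -> R).

Lemma continuous_measurableR (f : R -> R) :
  continuous f -> measurable_fun setT (f : measurableTypeR R -> R).
Proof. by move=> /continuous_measurable_fun. Qed.

Lemma ge0_integral_affine G b c : 0 < b -> continuous G ->
  (forall x, 0 <= G x) ->
  (\int[leb]_x (G x)%:E = \int[leb]_x (G ((x - c) / b) / b)%:E)%E.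
Proof.
move=> b0 cG G0.
pose F := fun x : R => (x - c) / b.
have dF (x : R) : is_derive x (1 : R) F (b^-1).
  rewrite /F; apply: is_derive_eq.
  by rewrite subr0 scaler0 add0r; exact: mulr1.
have F'E : derive1 F = cst b^-1.
  by apply/funext => x; rewrite derive1E; apply: derive_val.
rewrite (@increasing_ge0_integration_by_substitutionT _ F G) //.
- by apply: eq_integral => x _; rewrite F'E.
- by move=> x y xy; rewrite /F ltr_pM2r ?invr_gt0// ltrD2r.
- by rewrite F'E => ?; exact: cst_continuous.
- by rewrite F'E; exact: is_cvg_cst.
- by rewrite F'E; exact: is_cvg_cst.
- by apply: gt0_cvgMlNy; [rewrite invr_gt0|exact: cvg_addrr_Ny].
- by apply: gt0_cvgMly; [rewrite invr_gt0|exact: cvg_addrr].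
Qed.

Lemma continuous_cauchy : continuous (fun x : R => (1 + x ^+ 2)^-1).
Proof.
move=> x; apply: cvgV; first by rewrite gt_eqF// ltr_pwDl// sqr_ge0.
by apply: cvgD; [exact: cvg_cst|exact: exprn_continuous].
Qed.

Lemma integral_cauchy1 : (\int[leb]_x ((1 + x ^+ 2)^-1)%:E = pi%:E)%E.
Proof.
have f0 (x : R) : 0 <= (1 + x ^+ 2)^-1 by rewrite invr_ge0 addr_ge0// sqr_ge0.
rewrite ge0_symfun_integralT//; [|exact: continuous_cauchy|].
  rewrite -set_itvcy (@ge0_continuous_FTC2y _ _ (@atan R) _ (pi / 2)) //.
  - by rewrite atan0 sube0 -EFinM mulrC divfK.
  - exact/continuous_subspaceT/continuous_cauchy.
  - exact: cvgy_atan.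
  - by apply: cvg_at_right_filter; exact: continuous_atan.
  - by move=> x _; rewrite derive1_atan.
by move=> x /=; rewrite sqrrN.
Qed.

Lemma integral_cauchy b c : 0 < b ->
  (\int[leb]_x (b / (b ^+ 2 + (x - c) ^+ 2))%:E = pi%:E)%E.
Proof.
move=> b0; rewrite -integral_cauchy1 [RHS](@ge0_integral_affine _ b c)//.
- apply: eq_integral => x _; congr EFin.
  have h : b ^+ 2 + (x - c) ^+ 2 != 0.
    by rewrite gt_eqF// ltr_pwDl ?exprn_gt0// sqr_ge0.
  by field; rewrite (gt_eqF b0) h.
- exact: continuous_cauchy.
- by move=> x; rewrite invr_ge0 addr_ge0// sqr_ge0.
Qed.

Lemma continuous_laplace w :
  continuous (fun x : R => expR (- `|x|) * (1 + cos (w * x))).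
Proof.
move=> x; apply: cvgM.
  apply: continuous_comp; last exact: continuous_expR.
  by apply: cvgN; exact: norm_continuous.
apply: cvgD; first exact: cvg_cst.
apply: continuous_comp; last exact: continuous_cos.
by apply: cvgM; [exact: cvg_cst|exact: cvg_id].
Qed.

(** The summand 1 makes the integrand nonnegative, as the fundamental theorem on a half-line
    requires; the cosine integral alone is recovered afterwards by subtraction. By parity it
    suffices to integrate over [x >= 0], where [F] is an antiderivative. *)
Lemma integral_laplace1 w :
  (\int[leb]_x (expR (- `|x|) * (1 + cos (w * x)))%:E
   = (2 + 2 / (1 + w ^+ 2))%:E)%E.
Proof.
have w1 : 1 + w ^+ 2 != 0 by rewrite gt_eqF// ltr_pwDl// sqr_ge0.
have f0 (x : R) : 0 <= expR (- `|x|) * (1 + cos (w * x)).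
  by rewrite mulr_ge0 ?expR_ge0//; have := cos_geN1 (w * x); lra.
pose F := fun x : R =>
  expR (- x) * ((w * sin (w * x) - cos (w * x)) / (1 + w ^+ 2) - 1).
have dF (x : R) : is_derive x (1 : R) F (expR (- x) * (1 + cos (w * x))).
  have h1 : is_derive x (1 : R) (fun x : R => expR (- x)) (- expR (- x)).
    by apply: is_derive_eq; rewrite ?[_ *: _]/(_ * _) /=; ring.
  have h2 : is_derive x (1 : R) (fun x : R => w * x) w.
    rewrite -[X in is_derive _ _ _ X]mulr1.
    exact: (is_deriveZ (f := id) w (is_derive_id x 1)).
  have h3 : is_derive x (1 : R) (fun x : R => sin (w * x)) (w * cos (w * x)).
    by apply: is_derive_eq; rewrite ?[_ *: _]/(_ * _) /=; ring.
  have h4 : is_derive x (1 : R) (fun x : R => cos (w * x)) (w * - sin (w * x)).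
    by apply: is_derive_eq; rewrite ?[_ *: _]/(_ * _) /=; ring.
  rewrite /F; apply: is_derive_eq.
  transitivity (expR (- x) *
    ((w * sin (w * x) - cos (w * x)) * (- (1 + w ^+ 2) ^- 2 * 0) +
     (1 + w ^+ 2)^-1 * (w * (w * cos (w * x)) - w * - sin (w * x)) - 0) +
    ((w * sin (w * x) - cos (w * x)) / (1 + w ^+ 2) - 1) * - expR (- x)) => //.
  by field.
have F0 : F x @[x --> +oo] --> 0.
  pose C := `|w| + 1 + 1.
  have b x : - (C * expR (- x)) <= F x <= C * expR (- x).
    rewrite -ler_norml /F normrM (ger0_norm (expR_ge0 _)) mulrC.
    rewrite ler_wpM2r ?expR_ge0// (le_trans (ler_normB _ _))// normr1 lerD2r.
    rewrite normrM normfV [in X in _ / X]ger0_norm; last first.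
      by rewrite addr_ge0// sqr_ge0.
    rewrite ler_pdivrMr; last by rewrite ltr_pwDl// sqr_ge0.
    apply: (@le_trans _ _ (`|w| + 1)); last first.
      by rewrite ler_peMr ?addr_ge0// lerDl sqr_ge0.
    rewrite (le_trans (ler_normB _ _))// lerD//.
      by rewrite normrM ler_piMr// ler_norml sin_geN1 sin_le1.
    by rewrite ler_norml cos_geN1 cos_le1.
  apply: (@squeeze_cvgr _ _ _ _ (fun x => - (C * expR (- x)))
                        (fun x => C * expR (- x))).
  - by near=> x; exact: b.
  - rewrite -oppr0; apply: cvgN; rewrite -(mulr0 C).
    by apply: cvgM; [exact: cvg_cst|exact: cvgr_expR].
  - rewrite -(mulr0 C).
    by apply: cvgM; [exact: cvg_cst|exact: cvgr_expR].
rewrite ge0_symfun_integralT//; [|exact: continuous_laplace|].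
  rewrite -set_itvcy.
  under eq_integral => x do
    rewrite inE/= in_itv/= andbT => /ger0_norm ->.
  rewrite (@ge0_continuous_FTC2y _ _ F _ 0) //.
  - rewrite /F oppr0 expR0 mulr0 sin0 cos0 -EFinB -EFinM; congr EFin; field.
    exact: w1.
  - apply/continuous_subspaceT => x; apply: cvgM.
      by apply: continuous_comp; [exact: oppr_continuous|exact: continuous_expR].
    apply: cvgD; first exact: cvg_cst.
    apply: continuous_comp; last exact: continuous_cos.
    by apply: cvgM; [exact: cvg_cst|exact: cvg_id].
  - apply: cvg_at_right_filter; apply: differentiable_continuous.
    by apply/derivable1_diffP; case: (dF 0).
  - by move=> x _; rewrite derive1E; apply: derive_val.
by move=> x /=; rewrite normrN mulrN cosN.
Unshelve. all: by end_near. Qed.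

Lemma integrable_laplace : leb.-integrable setT (EFin \o (fun x => expR (- `|x|))).
Proof.
have ml : measurable_fun setT (fun x : R => expR (- `|x|)).
  apply: continuous_measurable_fun => x.
  apply: continuous_comp; last exact: continuous_expR.
  by apply: cvgN; exact: norm_continuous.
apply/integrableP; split; first exact/measurable_EFinP.
apply: (@le_lt_trans _ _ (2 + 2 / (1 + 0 ^+ 2))%:E); last exact: ltry.
rewrite -integral_laplace1; apply: ge0_le_integral => //.
- exact/measurable_EFinP/measurableT_comp.
- apply/measurable_EFinP.
  have := continuous_measurable_fun (@continuous_laplace 0).
  exact.
- move=> x _; rewrite /= lee_fin ger0_norm ?expR_ge0// mul0r cos0.
  by rewrite ler_peMr ?expR_ge0// lerDl.
Qed.

Lemma integrableM_le1 d (T : measurableType d) (mu : {measure set T -> \bar R})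
    (D : set T) (f g : T -> R) : measurable D ->
  mu.-integrable D (EFin \o f) -> measurable_fun D g ->
  (forall x, D x -> `|g x| <= 1) ->
  mu.-integrable D (EFin \o (fun x => f x * g x)).
Proof.
move=> mD fi mg g1; have /measurable_int/measurable_EFinP mf := fi.
apply: le_integrable fi => //; first exact/measurable_EFinP/measurable_funM.
by move=> x Dx /=; rewrite lee_fin normrM ler_piMr// g1.
Qed.

Lemma integrable_Rsum d (T : measurableType d) (mu : {measure set T -> \bar R})
    (D : set T) I (r : seq I) (F : I -> T -> R) : measurable D ->
  (forall i, mu.-integrable D (EFin \o F i)) ->
  mu.-integrable D (EFin \o (fun x => \sum_(i <- r) F i x)).
Proof.
move=> mD Fi; have := integrable_sum mD r (P := xpredT) (fun i _ => Fi i).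
by apply: eq_integrable => // x _ /=; rewrite sumEFin.
Qed.

Lemma Rintegral_sum d (T : measurableType d) (mu : {measure set T -> \bar R})
    (D : set T) I (r : seq I) (F : I -> T -> R) : measurable D ->
  (forall i, mu.-integrable D (EFin \o F i)) ->
  \int[mu]_(x in D) (\sum_(i <- r) F i x) = \sum_(i <- r) \int[mu]_(x in D) F i x.
Proof.
move=> mD Fi; elim: r => [|i r IH].
  by rewrite big_nil /Rintegral integral0_eq// => x _; rewrite big_nil.
rewrite big_cons -IH -RintegralD//; last exact: integrable_Rsum.
by apply: eq_Rintegral => x _; rewrite big_cons.
Qed.

Lemma integrable_laplaceM G : measurable_fun setT G -> (forall x, `|G x| <= 1) ->
  leb.-integrable setT (EFin \o (fun x => expR (- `|x|) * G x)).
Proof.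
move=> mG G1; by apply: integrableM_le1 integrable_laplace _ _.
Qed.

Lemma Rintegral_laplace_cos w :
  \int[leb]_x (expR (- `|x|) * cos (w * x)) = 2 / (1 + w ^+ 2).
Proof.
have mc v : measurable_fun setT (fun x : R => cos (v * x)).
  apply: continuous_measurable_fun => x.
  apply: continuous_comp; last exact: continuous_cos.
  by apply: cvgM; [exact: cvg_cst|exact: cvg_id].
have c1 v (x : R) : `|cos (v * x)| <= 1 by rewrite ler_norml cos_geN1 cos_le1.
have H v : \int[leb]_x expR (- `|x|) + \int[leb]_x (expR (- `|x|) * cos (v * x))
    = 2 + 2 / (1 + v ^+ 2).
  rewrite -RintegralD//; [|exact: integrable_laplace|exact: integrable_laplaceM].
  rewrite -[RHS]/(fine (2 + 2 / (1 + v ^+ 2))%:E) -integral_laplace1.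
  by congr fine; apply: eq_integral => x _; rewrite mulrDr mulr1.
(* At frequency 0 the identity says that twice the integral of the profile is 4, so the profile has
   mass 2. *)
have := H 0; under [X in _ + X]eq_Rintegral do rewrite mul0r cos0 mulr1.
rewrite expr0n/= addr0 divr1; have := H w.
by move: (2 / _) (\int[_]_x _) (\int[_]_x _) => a b c; lra.
Qed.

Lemma Rintegral_odd G : leb.-integrable setT (EFin \o G) ->
  (forall x, G (- x) = - G x) -> \int[leb]_x G x = 0.
Proof.
move=> iG oG.
suff : \int[leb]_x G x = - \int[leb]_x G x by lra.
rewrite -mulN1r -RintegralZl// /Rintegral; congr fine.
transitivity (\int[pushforward leb (-%R : _ -> measurableTypeR R)]_x (G x)%:E)%E.
  by apply: eq_measure_integral => //= A mA _; exact/esym/lebesgue_measureN.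
have /measurable_int mG := iG.
rewrite integral_pushforward//=.
  by apply: eq_integral => x _; rewrite oG mulN1r.
have /(integrableZl measurableT (-1)) := iG.
apply: eq_integrable => // x _ /=.
by rewrite oG -EFinM mulN1r.
Qed.

Lemma Rintegral_laplace_sin w :
  \int[leb]_x (expR (- `|x|) * sin (w * x)) = 0.
Proof.
apply: Rintegral_odd; last by move=> x; rewrite normrN mulrN sinN mulrN.
apply: integrable_laplaceM.
  apply: continuous_measurable_fun => x.
  apply: continuous_comp; last exact: continuous_sin.
  by apply: cvgM; [exact: cvg_cst|exact: cvg_id].
by move=> x; rewrite ler_norml sin_geN1 sin_le1.
Qed.

Lemma continuous_cauchy_shift b c : 0 < b ->
  continuous (fun x : R => b / (b ^+ 2 + (x - c) ^+ 2)).
Proof.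
move=> b0 x; apply: cvgM; first exact: cvg_cst.
apply: cvgV; first by rewrite gt_eqF// ltr_pwDl ?exprn_gt0// sqr_ge0.
apply: cvgD; first exact: cvg_cst.
apply: (@continuous_comp _ _ _ (fun x => x - c) (fun x => x ^+ 2)).
  by apply: cvgB; [exact: cvg_id|exact: cvg_cst].
exact: exprn_continuous.
Qed.

Lemma cauchy_ge0 b c (x : R) : 0 < b -> 0 <= b / (b ^+ 2 + (x - c) ^+ 2).
Proof. by move=> b0; rewrite divr_ge0 ?addr_ge0 ?sqr_ge0// ltW. Qed.

Lemma integrable_cauchy b c : 0 < b ->
  leb.-integrable setT (EFin \o (fun x : R => b / (b ^+ 2 + (x - c) ^+ 2))).
Proof.
move=> b0; apply/integrableP; split.
  apply/measurable_EFinP; apply: continuous_measurableR.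
  exact: continuous_cauchy_shift.
rewrite (eq_integral (fun x : measurableTypeR R => (b / (b ^+ 2 + (x - c) ^+ 2))%:E)).
  by rewrite integral_cauchy// ltry.
by move=> x _; rewrite /= ger0_norm ?cauchy_ge0.
Qed.

Lemma Rintegral_cauchy b c : 0 < b ->
  \int[leb]_x (b / (b ^+ 2 + (x - c) ^+ 2)) = pi.
Proof. by move=> b0; rewrite /Rintegral integral_cauchy. Qed.

(* The Fourier transform of [exp (- |x|)]. *)
Definition lorentz (x : R) : R := 2 / (1 + x ^+ 2).

Lemma lorentzE c (x : R) : lorentz (x - c) = 2 * (1 / (1 ^+ 2 + (x - c) ^+ 2)).
Proof. by rewrite /lorentz expr1n mul1r. Qed.

Lemma lorentz_gt0 (x : R) : 0 < lorentz x.
Proof. by rewrite divr_gt0// ltr_pwDl// sqr_ge0. Qed.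

Lemma lorentz_ge0 (x : R) : 0 <= lorentz x.
Proof. exact/ltW/lorentz_gt0. Qed.

Lemma continuous_lorentz c : continuous (fun x => lorentz (x - c)).
Proof.
under eq_fun do rewrite lorentzE.
by move=> x; apply: cvgM; [exact: cvg_cst|exact: continuous_cauchy_shift].
Qed.

Lemma integrable_lorentz c : leb.-integrable setT (EFin \o (fun x => lorentz (x - c))).
Proof.
have := integrableZl measurableT 2 (@integrable_cauchy 1 c ltr01).
by apply: eq_integrable => // x _ /=; rewrite lorentzE.
Qed.

Lemma Rintegral_lorentz c : \int[leb]_x lorentz (x - c) = 2 * pi.
Proof.
under eq_Rintegral do rewrite lorentzE.
by rewrite RintegralZl// ?Rintegral_cauchy//; exact: integrable_cauchy.
Qed.

Lemma sin_le_id (x : R) : 0 <= x -> sin x <= x.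
Proof.
rewrite le_eqVlt => /predU1P[<-|x0]; first by rewrite sin0.
have [|y _] := @MVT R sin cos 0 x x0 (fun y _ => is_derive_sin y).
  by apply: continuous_subspaceT => y; exact: continuous_sin.
by rewrite sin0 !subr0 => ->; rewrite ler_piMl ?cos_le1// ltW.
Qed.

Lemma normr_sin_le (x : R) : `|sin x| <= `|x|.
Proof.
wlog x0 : x / 0 <= x.
  move=> H; have [/H//|x0] := lerP 0 x.
  by rewrite -normrN -sinN -[X in _ <= X]normrN; apply: H; rewrite oppr_ge0 ltW.
rewrite (ger0_norm x0) ler_norml sin_le_id// andbT.
have [x1|x1] := lerP x 1; last by rewrite (le_trans _ (sin_geN1 x))// lerN2 ltW.
rewrite (le_trans (y := 0)) ?oppr_le0// sin_ge0_pi// x0/=.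
by rewrite (le_trans x1)// (le_trans _ (pi_ge2 R))// ler1n.
Qed.

Lemma cos_lipschitz (a b : R) : `|cos a - cos b| <= `|a - b|.
Proof.
have [ea eb] : a = (a + b) / 2 + (a - b) / 2 /\ b = (a + b) / 2 - (a - b) / 2.
  by split; field.
have -> : cos a - cos b =
    cos ((a + b) / 2 + (a - b) / 2) - cos ((a + b) / 2 - (a - b) / 2).
  by rewrite -ea -eb.
move: ((a + b) / 2) => u {ea eb}.
have -> : `|a - b| = 2 * `|(a - b) / 2|.
  by rewrite normrM [in `|2^-1|]ger0_norm// mulrC divfK.
move: ((a - b) / 2) => v.
have -> : cos (u + v) - cos (u - v) = - (2 * (sin u * sin v)).
  by rewrite cosB cosD; ring.
rewrite normrN normrM [`|2|]ger0_norm// ler_pM2l// normrM.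
rewrite (le_trans _ (normr_sin_le v))// ler_piMl// ler_norml.
by rewrite sin_geN1 sin_le1.
Qed.

Lemma cos_ge_half (z : R) : `|z| <= 1 -> 1 / 2 <= cos z.
Proof.
move=> z1; have -> : z = z / 2 *+ 2 by rewrite mulr2n -splitr.
rewrite cos_mulr2n; have := sin2cos2 (z / 2).
have : sin (z / 2) ^+ 2 <= (1 / 2) ^+ 2.
  rewrite -[leLHS]real_normK ?num_real// lerXn2r ?nnegrE//.
  rewrite (le_trans (normr_sin_le _))// normrM (@ger0_norm _ 2^-1)//.
  by rewrite ler_pM2r.
have -> : (1 / 2) ^+ 2 = 1 / 4 :> R by field.
move: (sin _ ^+ 2) (cos _ ^+ 2) => a b.
rewrite [b *+ 2]mulr2n => h1 h2.
by lra.
Qed.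

(** * Oscillatory integrals against a Lorentzian *)

Lemma Rintegral_affine_shift G c : leb.-integrable setT (EFin \o G) ->
  continuous G -> (forall x, 0 <= G x) ->
  \int[leb]_x G (x + c) = \int[leb]_x G x.
Proof.
move=> iG cG G0; rewrite /Rintegral [in RHS](@ge0_integral_affine _ 1 (- c))//.
by congr fine; apply: eq_integral => x _; rewrite opprK !divr1.
Qed.

Lemma integrable_shift G c : leb.-integrable setT (EFin \o G) ->
  continuous G -> (forall x, 0 <= G x) ->
  leb.-integrable setT (EFin \o (fun x => G (x + c))).
Proof.
move=> iG cG G0; apply/integrableP; split.
  apply/measurable_EFinP; apply: continuous_measurableR => x.
  apply: (@continuous_comp _ _ _ (fun x => x + c)); last exact: cG.
  by apply: cvgD; [exact: cvg_id|exact: cvg_cst].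
have /integrableP[_] := iG.
rewrite (eq_integral (fun x : measurableTypeR R => (G x)%:E)); last by move=> x _; rewrite /= ger0_norm.
rewrite (@ge0_integral_affine _ 1 (- c))//.
rewrite (eq_integral (fun x : measurableTypeR R => `|(EFin \o (fun x0 : R => G (x0 + c)%R)) x|%E))//.
by move=> x _; rewrite /= opprK !divr1 ger0_norm.
Qed.

(** The difference is [lorentz a] times an explicit factor, and [2 |u| <= 1 + u^2] bounds that
    factor. The error is thus relative to [lorentz a] and can be integrated over the whole line. *)
Lemma lorentz_lipschitz (a h : R) : 0 <= h <= 1 ->
  `|lorentz a - lorentz (a + h)| <= 2 * h * lorentz a.
Proof.
move=> /andP[h0 h1].
have a1 : 1 + a ^+ 2 != 0 by rewrite gt_eqF// ltr_pwDl// sqr_ge0.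
have b1 : 0 < 1 + (a + h) ^+ 2 by rewrite ltr_pwDl// sqr_ge0.
have -> : lorentz a - lorentz (a + h) =
    lorentz a * (h * (2 * (a + h) - h) / (1 + (a + h) ^+ 2)).
  by rewrite /lorentz; field; rewrite a1 (gt_eqF b1).
rewrite normrM (ger0_norm (lorentz_ge0 _)) mulrC ler_wpM2r ?lorentz_ge0//.
rewrite !normrM (ger0_norm h0) normfV (gtr0_norm b1) ler_pdivrMr//.
rewrite [2 * h]mulrC -mulrA ler_wpM2l// ler_norml.
have := sqr_ge0 (a + h - 1); have := sqr_ge0 (a + h + 1); rewrite !expr2 => ? ?.
by apply/andP; split; nra.
Qed.

(** The majorant is a Cauchy kernel of width [H], whose total mass is [pi]. Tails can thus be
    estimated by integrals over the whole line, without splitting the domain. *)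
Lemma lorentz_tail (H a : R) : 2 <= H -> H <= `|a| ->
  lorentz a <= 4 / H * (H / (H ^+ 2 + a ^+ 2)).
Proof.
move=> H2 Ha.
have H0 : 0 < H by lra.
have a2 : H ^+ 2 <= a ^+ 2 by rewrite -[leRHS]real_normK ?num_real// lerXn2r ?nnegrE// ltW.
have h4 : 4 <= H ^+ 2 by rewrite expr2; nra.
have -> : 4 / H * (H / (H ^+ 2 + a ^+ 2)) = 4 / (H ^+ 2 + a ^+ 2).
  by field; rewrite gt_eqF ?(gt_eqF H0)//; lra.
rewrite /lorentz ler_pdivrMr; last by lra.
rewrite mulrAC ler_pdivlMr; last by lra.
by lra.
Qed.

(* Averaging with the translate by [h = pi / (x + 2 t c)], which nearly flips
   the sign of the phase around [c]. *)
Lemma lorentz_oscillation (x t c w h H : R) : 0 <= t -> 0 < h <= 1 ->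
  2 <= H -> h * (x + 2 * t * c) = pi ->
  `|\int[leb]_k (lorentz (k - c) * cos (x * k + t * k ^+ 2 + w))| <=
  pi * (2 * h + 3 * t * h * (2 * H + 1) + 12 / H).
Proof.
move=> t0 /andP[h0 h1] H2 hpi.
have H0 : 0 < H by lra.
pose ph k := x * k + t * k ^+ 2 + w.
have cph : continuous (fun k => cos (ph k)).
  move=> k; apply: (@continuous_comp _ _ _ ph); last exact: continuous_cos.
  apply: cvgD; last exact: cvg_cst.
  apply: cvgD; apply: cvgM; [exact: cvg_cst|exact: cvg_id|exact: cvg_cst|].
  exact: exprn_continuous.
have cl := @continuous_lorentz c.
have ci (f : R -> R) (k : R) : `|cos (f k)| <= 1 by rewrite ler_norml cos_geN1 cos_le1.
pose g k := lorentz (k - c) * cos (ph k).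
have ig : leb.-integrable setT (EFin \o g).
  apply: integrableM_le1 => //; first exact: integrable_lorentz.
  exact: continuous_measurableR.
have il := @integrable_lorentz c.
(* [g] changes sign, whereas the translation lemmas ask for a nonnegative integrand; adding the
   envelope makes it nonnegative. *)
pose G k := lorentz (k - c) + g k.
have G0 k : 0 <= G k.
  rewrite /G /g -[X in X + _]mulr1 -mulrDr mulr_ge0 ?lorentz_ge0//.
have cG : continuous G.
  by move=> k; apply: cvgD; [exact: cl|apply: cvgM; [exact: cl|exact: cph]].
have iG : leb.-integrable setT (EFin \o G).
  have := integrableD measurableT il ig.
  by apply: eq_integrable.
have igh : leb.-integrable setT (EFin \o (fun k => g (k + h))).
  have := integrableB measurableT (integrable_shift h iG cG G0)
    (integrable_shift h il cl (fun k => lorentz_ge0 (k - c))).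
  apply: eq_integrable => // k _ /=; rewrite /G -EFinB; congr EFin.
  by rewrite addrC addKr.
have gh : \int[leb]_k g (k + h) = \int[leb]_k g k.
  have := Rintegral_affine_shift h iG cG G0.
  have ilh := integrable_shift h il cl (fun k => lorentz_ge0 (k - c)).
  have -> : \int[leb]_k G k = \int[leb]_k lorentz (k - c) + \int[leb]_k g k.
    exact: RintegralD.
  have -> : \int[leb]_k G (k + h) =
      \int[leb]_k lorentz (k + h - c) + \int[leb]_k g (k + h).
    exact: (RintegralD measurableT ilh igh).
  rewrite (Rintegral_affine_shift h il cl)//; first exact: addrI.
  by move=> k; exact: lorentz_ge0.
pose M := 2 * h + 3 * t * h * (2 * H + 1).
(* For [k] within [H] of [c], [M] collects the variation of the envelope ([2 * h]) and that of the
   phase ([3 * t * h * (2 * H + 1)]). Farther away the sum is at most 6 Lorentzians, and the factor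
   4 of [lorentz_tail] turns 6 into 24. *)
pose B k := M * lorentz (k - c) + 24 / H * (H / (H ^+ 2 + (k - c) ^+ 2)).
have iB : leb.-integrable setT (EFin \o B).
  have := integrableD measurableT
    (integrableZl measurableT M il)
    (integrableZl measurableT (24 / H) (integrable_cauchy c H0)).
  by apply: eq_integrable.
have iB' : \int[leb]_k B k = 2 * (pi * (M + 12 / H)).
  have c1 := integrable_cauchy c H0.
  have -> : \int[leb]_k B k = \int[leb]_k (M * lorentz (k - c)) +
      \int[leb]_k (24 / H * (H / (H ^+ 2 + (k - c) ^+ 2))).
    apply: RintegralD => //.
      exact: (integrableZl measurableT M il).
    exact: (integrableZl measurableT (24 / H) c1).
  have -> : \int[leb]_k (M * lorentz (k - c)) = M * (2 * pi).
    by rewrite -(Rintegral_lorentz c); exact: RintegralZl.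
  have -> : \int[leb]_k (24 / H * (H / (H ^+ 2 + (k - c) ^+ 2))) = 24 / H * pi.
    by rewrite -(Rintegral_cauchy c H0); exact: (RintegralZl _ measurableT c1).
  by field; rewrite gt_eqF.
have key k : `|g k + g (k + h)| <= B k.
  (* The translation by [h] changes the phase by [pi + e]: the choice of [h] yields exactly [pi] at
     [c], and [e] is the deviation away from [c]. *)
  pose e := 2 * t * (k - c) * h + t * h ^+ 2.
  have phE : ph (k + h) = ph k + e + pi by rewrite -hpi /ph /e; ring.
  have gE : g k + g (k + h) = (lorentz (k - c) - lorentz (k - c + h)) * cos (ph k)
      + lorentz (k - c + h) * (cos (ph k) - cos (ph k + e)).
    by rewrite /g phE cosDpi addrAC; ring.
  have L1 : `|lorentz (k - c) - lorentz (k - c + h)| <= 2 * h * lorentz (k - c).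
    by apply: lorentz_lipschitz; rewrite h1 ltW.
  have L2 : lorentz (k - c + h) <= 3 * lorentz (k - c).
    move: L1; rewrite ler_norml => /andP[L1 _].
    have := lorentz_ge0 (k - c); nra.
  have l0 := lorentz_ge0 (k - c + h).
  have C1 : `|cos (ph k) - cos (ph k + e)| <= `|e|.
    rewrite (le_trans (cos_lipschitz _ _))// opprD addrA subrr add0r.
    by rewrite normrN.
  have C2 : `|cos (ph k) - cos (ph k + e)| <= 2.
    have := cos_geN1 (ph k); have := cos_le1 (ph k).
    have := cos_geN1 (ph k + e); have := cos_le1 (ph k + e).
    by rewrite ler_norml => ? ? ? ?; apply/andP; split; lra.
  have l1 := lorentz_ge0 (k - c).
  rewrite gE; apply: (le_trans (ler_normD _ _)).
  rewrite [X in X + _]normrM [X in _ + X]normrM (ger0_norm l0).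
  have A1 : `|lorentz (k - c) - lorentz (k - c + h)| * `|cos (ph k)| <= 2 * h * lorentz (k - c).
    by rewrite (le_trans _ L1)// ler_piMr.
  apply: (@le_trans _ _ (2 * h * lorentz (k - c) +
      (3 * t * h * (2 * H + 1) * lorentz (k - c) +
       24 / H * (H / (H ^+ 2 + (k - c) ^+ 2))))); last first.
    by rewrite le_eqVlt; apply/orP; left; apply/eqP; rewrite /B /M; ring.
  apply: lerD => //.
  have tail0 := cauchy_ge0 c k H0.
  have [kH|kH] := lerP `|k - c| H.
    have eb : `|e| <= t * h * (2 * H + 1).
      rewrite /e (_ : _ + _ = t * h * (2 * (k - c) + h)); last by ring.
      rewrite normrM ger0_norm; last by rewrite mulr_ge0// ltW.
      rewrite ler_wpM2l//; first by rewrite mulr_ge0// ltW.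
      rewrite (le_trans (ler_normD _ _))// normrM (ger0_norm (ltW h0)).
      by rewrite [`|2|]ger0_norm// lerD// ler_pM2l.
    apply: (@le_trans _ _ (3 * t * h * (2 * H + 1) * lorentz (k - c))).
      have D1 := le_trans C1 eb.
      apply: (@le_trans _ _ (3 * lorentz (k - c) * (t * h * (2 * H + 1)))).
        exact: ler_pM.
      by rewrite le_eqVlt; apply/orP; left; apply/eqP; ring.
    by rewrite lerDl; apply: mulr_ge0 => //; rewrite divr_ge0// ltW.
  have lt := lorentz_tail H2 (ltW kH).
  apply: (@le_trans _ _ (6 * lorentz (k - c))).
    apply: (@le_trans _ _ (3 * lorentz (k - c) * 2)).
      exact: ler_pM.
    by rewrite le_eqVlt; apply/orP; left; apply/eqP; ring.
  apply: (@le_trans _ _ (6 * (4 / H * (H / (H ^+ 2 + (k - c) ^+ 2))))).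
    by rewrite ler_pM2l.
  rewrite -[leLHS]add0r lerD//.
    apply: mulr_ge0 => //; apply: mulr_ge0; last lra.
    by rewrite !mulr_ge0// ltW.
  by rewrite le_eqVlt; apply/orP; left; apply/eqP; ring.
have : `|\int[leb]_k (g k + g (k + h))| <= \int[leb]_k B k.
  have igg : leb.-integrable setT (EFin \o (fun k => g k + g (k + h))).
    have := integrableD measurableT ig igh.
    by apply: eq_integrable.
  apply: (le_trans (le_normr_Rintegral _ igg)) => //.
  apply: le_Rintegral => //.
  exact: integrable_norm.
rewrite RintegralD// gh iB' -mulr2n -[_ *+ 2]mulr_natl normrM ger0_norm//.
by rewrite ler_pM2l.
Qed.

End line.

(** * Complex-valued integrals and series *)

Section complex_facts.
Variable R : realType.
Implicit Types z w : R[i].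
Local Open Scope complex_scope.

Lemma normc_ge0 z : 0 <= Normc.normc z.
Proof. by case: z => a b; exact: sqrtr_ge0. Qed.

Lemma normc_sqr z : Normc.normc z ^+ 2 = complex.Re z ^+ 2 + complex.Im z ^+ 2.
Proof. by case: z => a b /=; rewrite sqr_sqrtr// addr_ge0// sqr_ge0. Qed.

Lemma normr_Re_le z : `|complex.Re z| <= Normc.normc z.
Proof.
case: z => a b /=; rewrite -sqrtr_sqr ler_wsqrtr// lerDl sqr_ge0//.
Qed.

Lemma normr_Im_le z : `|complex.Im z| <= Normc.normc z.
Proof.
case: z => a b /=; rewrite -sqrtr_sqr ler_wsqrtr// lerDr sqr_ge0//.
Qed.

Lemma normc_le_ReIm z :
  Normc.normc z <= `|complex.Re z| + `|complex.Im z|.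
Proof.
rewrite -(@ler_pXn2r _ 2)// ?nnegrE ?normc_ge0 ?addr_ge0//.
rewrite normc_sqr -(real_normK (num_real (complex.Re z))).
rewrite -(real_normK (num_real (complex.Im z))).
rewrite sqrrD lerD2r lerDl mulrn_wge0// mulr_ge0//.
Qed.

Lemma normc_real (a : R) : Normc.normc (a%:C) = `|a|.
Proof. by rewrite /= expr0n/= addr0 sqrtr_sqr. Qed.

Lemma normc_expi (a : R) : Normc.normc (expi a) = 1.
Proof. by rewrite /= cos2Dsin2 sqrtr1. Qed.

Lemma expiD (a b : R) : expi (a + b) = expi a * expi b.
Proof.
by rewrite /expi cosD sinD /GRing.mul/=; congr (_ +i* _); rewrite addrC.
Qed.

Lemma normc_sum I (r : seq I) (P : pred I) (F : I -> R[i]) :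
  Normc.normc (\sum_(i <- r | P i) F i) <= \sum_(i <- r | P i) Normc.normc (F i).
Proof.
apply: (big_ind2 (fun z a => Normc.normc z <= a)) => //.
- by rewrite Normc.normc0.
- by move=> z a w b za wb; rewrite (le_trans (le_normcD _ _))// lerD.
Qed.

Lemma normc_prod I (r : seq I) (P : pred I) (F : I -> R[i]) :
  Normc.normc (\prod_(i <- r | P i) F i) = \prod_(i <- r | P i) Normc.normc (F i).
Proof.
by apply: (big_morph _ (@Normc.normcM R)); exact: Normc.normc1.
Qed.

Lemma normc_E z : `|z| = (Normc.normc z)%:C.
Proof. by case: z. Qed.

Lemma cReD z w : complex.Re (z + w) = complex.Re z + complex.Re w.
Proof. by case: z w => [a b] [c d]. Qed.
Lemma cImD z w : complex.Im (z + w) = complex.Im z + complex.Im w.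
Proof. by case: z w => [a b] [c d]. Qed.
Lemma cReN z : complex.Re (- z) = - complex.Re z.
Proof. by case: z. Qed.
Lemma cImN z : complex.Im (- z) = - complex.Im z.
Proof. by case: z. Qed.
Lemma cReM z w : complex.Re (z * w) =
  complex.Re z * complex.Re w - complex.Im z * complex.Im w.
Proof. by case: z w => [a b] [c d]. Qed.
Lemma cImM z w : complex.Im (z * w) =
  complex.Re z * complex.Im w + complex.Im z * complex.Re w.
Proof. by case: z w => [a b] [c d]. Qed.
Lemma cRe_sum I (r : seq I) (P : pred I) (F : I -> R[i]) :
  complex.Re (\sum_(i <- r | P i) F i) = \sum_(i <- r | P i) complex.Re (F i).
Proof. exact: (big_morph _ cReD). Qed.
Lemma cIm_sum I (r : seq I) (P : pred I) (F : I -> R[i]) :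
  complex.Im (\sum_(i <- r | P i) F i) = \sum_(i <- r | P i) complex.Im (F i).
Proof. exact: (big_morph _ cImD). Qed.

Lemma eq_complexP z w :
  complex.Re z = complex.Re w -> complex.Im z = complex.Im w -> z = w.
Proof. by case: z w => [a b] [c d] /= -> ->. Qed.

End complex_facts.

Section complex_measurable.
Context d (T : measurableType d) (R : realType).
Implicit Types f g : T -> R[i].

Lemma cmeasurableB f g : cmeasurable f -> cmeasurable g ->
  cmeasurable (fun x => f x - g x).
Proof.
move=> [f1 f2] [g1 g2]; split.
  by under eq_fun do rewrite cReD cReN; exact: measurable_funB.
by under eq_fun do rewrite cImD cImN; exact: measurable_funB.
Qed.

Lemma cmeasurableM f g : cmeasurable f -> cmeasurable g ->
  cmeasurable (fun x => f x * g x).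
Proof.
move=> [f1 f2] [g1 g2]; split.
  by under eq_fun do rewrite cReM; apply: measurable_funB; exact: measurable_funM.
by under eq_fun do rewrite cImM; apply: measurable_funD; exact: measurable_funM.
Qed.

Lemma cmeasurable_sum I (r : seq I) (F : I -> T -> R[i]) :
  (forall i, cmeasurable (F i)) -> cmeasurable (fun x => \sum_(i <- r) F i x).
Proof.
move=> mF; split.
  under eq_fun do rewrite cRe_sum.
  by apply: measurable_sum => i; case: (mF i).
under eq_fun do rewrite cIm_sum.
by apply: measurable_sum => i; case: (mF i).
Qed.

Lemma cmeasurable_cst (a : R[i]) : cmeasurable (fun _ : T => a).
Proof. by split; exact: measurable_cst. Qed.

Lemma cmeasurable_real (f : T -> R) : measurable_fun setT f ->
  cmeasurable (fun x => Complex (f x) 0).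
Proof. by move=> mf; split => //=; exact: measurable_cst. Qed.

Lemma cmeasurable_expi (f : T -> R) : measurable_fun setT f ->
  cmeasurable (fun x => expi (f x)).
Proof.
move=> mf; split => /=; apply: measurableT_comp => //.
  by apply: continuous_measurable_fun; exact: continuous_cos.
by apply: continuous_measurable_fun; exact: continuous_sin.
Qed.

End complex_measurable.

Section complex_integral.
Context d (T : measurableType d) (R : realType).
Variables (mu : {measure set T -> \bar R}) (D : set T).
Hypothesis mD : measurable D.
Implicit Types (f g : T -> R[i]).
Local Open Scope complex_scope.

Lemma eq_cintegral f g : {in D, f =1 g} -> cintegral mu D f = cintegral mu D g.
Proof.
by move=> fg; congr (_ +i* _); apply: eq_Rintegral => x Dx; rewrite fg.
Qed.

Lemma eq_cintegrable f g : {in D, f =1 g} -> cintegrable mu D f -> cintegrable mu D g.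
Proof.
move=> fg [h1 h2]; split.
  by apply: eq_integrable h1 => // x Dx; rewrite fg.
by apply: eq_integrable h2 => // x Dx; rewrite fg.
Qed.

Lemma cintegrableD f g : cintegrable mu D f -> cintegrable mu D g ->
  cintegrable mu D (fun x => f x + g x).
Proof.
move=> [f1 f2] [g1 g2]; split.
  have := integrableD mD f1 g1; apply: eq_integrable => // x _ /=.
  by rewrite cReD EFinD.
have := integrableD mD f2 g2; apply: eq_integrable => // x _ /=.
by rewrite cImD EFinD.
Qed.

Lemma cintegralD f g : cintegrable mu D f -> cintegrable mu D g ->
  cintegral mu D (fun x => f x + g x) = cintegral mu D f + cintegral mu D g.
Proof.
move=> [f1 f2] [g1 g2]; rewrite /cintegral; apply: eq_complexP => /=.
  rewrite -RintegralD//; apply: eq_Rintegral => x _; exact: cReD.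
rewrite -RintegralD//; apply: eq_Rintegral => x _; exact: cImD.
Qed.

Lemma cintegrableZ (a : R[i]) f : cintegrable mu D f ->
  cintegrable mu D (fun x => a * f x).
Proof.
move=> [f1 f2]; split.
  have := integrableB mD (integrableZl mD (complex.Re a) f1)
    (integrableZl mD (complex.Im a) f2).
  apply: eq_integrable => // x _ /=.
  by rewrite cReM EFinB !EFinM.
have := integrableD mD (integrableZl mD (complex.Re a) f2)
  (integrableZl mD (complex.Im a) f1).
apply: eq_integrable => // x _ /=.
by rewrite cImM EFinD !EFinM.
Qed.

Lemma cintegralZ (a : R[i]) f : cintegrable mu D f ->
  cintegral mu D (fun x => a * f x) = a * cintegral mu D f.
Proof.
move=> [f1 f2]; apply: eq_complexP; rewrite ?cReM ?cImM/=.
  have h1 := integrableZl mD (complex.Re a) f1.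
  have h2 := integrableZl mD (complex.Im a) f2.
  rewrite -!RintegralZl// -RintegralB//.
  by apply: eq_Rintegral => x _; exact: cReM.
have h1 := integrableZl mD (complex.Re a) f2.
have h2 := integrableZl mD (complex.Im a) f1.
rewrite -!RintegralZl// -RintegralD//.
by apply: eq_Rintegral => x _; exact: cImM.
Qed.

Lemma cintegrable0 : cintegrable mu D (fun=> 0).
Proof. by split; exact: integrable0. Qed.

Lemma cintegral0 : cintegral mu D (fun=> 0) = 0.
Proof.
by apply: eq_complexP => /=; rewrite /Rintegral integral0.
Qed.

Lemma cintegrable_sum I (r : seq I) (F : I -> T -> R[i]) :
  (forall i, cintegrable mu D (F i)) ->
  cintegrable mu D (fun x => \sum_(i <- r) F i x).
Proof.
move=> Fi; elim: r => [|i r IH].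
  by apply: eq_cintegrable cintegrable0 => x _; rewrite big_nil.
apply: eq_cintegrable (cintegrableD (Fi i) IH) => x _.
by rewrite big_cons.
Qed.

Lemma cintegral_sum I (r : seq I) (F : I -> T -> R[i]) :
  (forall i, cintegrable mu D (F i)) ->
  cintegral mu D (fun x => \sum_(i <- r) F i x) =
  \sum_(i <- r) cintegral mu D (F i).
Proof.
move=> Fi; elim: r => [|i r IH].
  rewrite big_nil; transitivity (cintegral mu D (fun=> 0)).
    by apply: eq_cintegral => x _; rewrite big_nil.
  exact: cintegral0.
rewrite big_cons -IH -cintegralD//; last exact: cintegrable_sum.
by apply: eq_cintegral => x _; rewrite big_cons.
Qed.

Lemma cintegrable_le (g : T -> R) f : cmeasurable f ->
  mu.-integrable D (EFin \o g) -> (forall x, D x -> Normc.normc (f x) <= g x) ->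
  cintegrable mu D f.
Proof.
move=> [m1 m2] gi fg; split; apply: le_integrable gi => //.
- exact/measurable_EFinP/measurable_funTS.
- move=> x Dx /=; rewrite lee_fin (le_trans (normr_Re_le _))//.
  by rewrite (le_trans (fg _ Dx))// ler_norm.
- exact/measurable_EFinP/measurable_funTS.
- move=> x Dx /=; rewrite lee_fin (le_trans (normr_Im_le _))//.
  by rewrite (le_trans (fg _ Dx))// ler_norm.
Qed.

(* With [z] the integral, [|z|^2] is the integral of [Re (conj z * f)]. *)
Lemma normc_cintegral_le (g : T -> R) f : cmeasurable f ->
  mu.-integrable D (EFin \o g) -> (forall x, D x -> Normc.normc (f x) <= g x) ->
  Normc.normc (cintegral mu D f) <= \int[mu]_(x in D) g x.
Proof.
move=> mf gi fg; have fi := cintegrable_le mf gi fg.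
set z := cintegral mu D f; pose w : R[i] := Complex (complex.Re z) (- complex.Im z).
have [->|z0] := eqVneq (Normc.normc z) 0.
  by apply: Rintegral_ge0 => x Dx; rewrite (le_trans (normc_ge0 _) (fg x Dx)).
have zp : 0 < Normc.normc z by rewrite lt_neqAle eq_sym z0 normc_ge0.
have wz : Normc.normc w = Normc.normc z by rewrite /w /z/= sqrrN.
rewrite -(ler_pM2l zp) -expr2 normc_sqr.
have -> : complex.Re z ^+ 2 + complex.Im z ^+ 2 = complex.Re (w * z).
  by rewrite cReM/=; ring.
rewrite /z -cintegralZ// -RintegralZl//.
have [wf1 _] := cintegrableZ w fi.
apply: le_Rintegral => //.
  have := integrableZl mD (Normc.normc z) gi.
  by apply: eq_integrable.
move=> x Dx; rewrite (le_trans (ler_norm _))// (le_trans (normr_Re_le _))//.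
by rewrite Normc.normcM wz ler_pM2l// fg.
Qed.

End complex_integral.

(** * Weighted square-integrable series *)

Section L2_series.
Context d (T : measurableType d) (R : realType).
Variable mu : {measure set T -> \bar R}.

(** Cauchy-Schwarz against the weights [2 ^- i.+1], obtained by iterating
    [(a + b)^2 <= 2 a^2 + 2 b^2]. The growing factors are harmless because the squared norms of the
    packets decay like [4 ^- i]. *)
Lemma sqr_sum_le (c : nat -> R) k m :
  (\sum_(k <= i < k + m) c i) ^+ 2 <= \sum_(k <= i < k + m) 2 ^+ i.+1 * c i ^+ 2.
Proof.
have H l (e : nat -> R) : (\sum_(i < l) e i) ^+ 2 <= \sum_(i < l) 2 ^+ i.+1 * e i ^+ 2.
  elim: l e => [|l IH] e; first by rewrite !big_ord0 expr0n.
  have E1 : \sum_(i < l.+1) e i = e 0%N + \sum_(i < l) e i.+1 by rewrite big_ord_recl.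
  have E2 : \sum_(i < l.+1) 2 ^+ i.+1 * e i ^+ 2 =
      2 * e 0%N ^+ 2 + 2 * \sum_(i < l) 2 ^+ i.+1 * e i.+1 ^+ 2.
    rewrite big_ord_recl; congr (_ + _).
    by rewrite mulr_sumr; apply: eq_bigr => i _; rewrite mulrA -exprS.
  rewrite E1 E2.
  move: (IH (fun i => e i.+1)).
  set A := \sum_(i < l) _.
  set B := \sum_(i < l) _.
  move=> AB.
  apply: (@le_trans _ _ (2 * e 0%N ^+ 2 + 2 * A ^+ 2)).
    rewrite -subr_ge0 (_ : _ - _ = (e 0%N - A) ^+ 2) ?sqr_ge0//.
    by ring.
  by rewrite lerD2l ler_pM2l.
have E (e : nat -> R) : \sum_(k <= i < k + m) e i = \sum_(i < m) e (i + k)%N.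
  by rewrite -{1}[k]add0n big_addn addKn big_mkord.
rewrite (E c) (E (fun i => 2 ^+ i.+1 * c i ^+ 2)).
apply: (le_trans (H m (fun i => c (i + k)%N))); apply: ler_sum => i _.
apply: ler_wpM2r; first exact: sqr_ge0.
by apply: ler_weXn2l; [rewrite ler1n|rewrite ltnS leq_addr].
Qed.

(* A total sum, measurable in parameters; for a divergent series it is a junk
   value. *)
Definition series_sum (u : nat -> R) : R :=
  fine (limn_esup (fun k => (\sum_(i < k) u i)%:E)).

Lemma series_sum_cvg (u : nat -> R) (l : R) :
  (fun k => \sum_(i < k) u i) @ \oo --> l -> series_sum u = l.
Proof.
move=> ul; rewrite /series_sum.
have ul' : (fun k => (\sum_(i < k) u i)%:E) @ \oo --> l%:E by apply/fine_cvgP; split => //; near=> k.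
by rewrite is_cvg_limn_esupE ?(cvg_lim _ ul')//; apply/cvg_ex; exists l%:E.
Unshelve. all: by end_near. Qed.

(** Convergence is not assumed: if the right-hand side is infinite there is nothing to prove, and
    otherwise [sqr_sum_le] makes the partial sums Cauchy, so that [series_sum] is their limit. *)
Lemma series_sum_tail (u : nat -> R) k :
  (((series_sum u - \sum_(i < k) u i) ^+ 2)%:E <=
   \sum_(k <= i <oo) (2 ^+ i.+1 * u i ^+ 2)%:E)%E.
Proof.
have pos i : (0 <= (2 ^+ i.+1 * u i ^+ 2)%:E)%E by rewrite lee_fin mulr_ge0 ?sqr_ge0// exprn_ge0.
set S := (\sum_(k <= i <oo) _)%E.
have S0 : (0 <= S)%E by apply: nneseries_ge0 => i _ _; exact: pos.
have [SE|Sy] := eqVneq S +oo%E; first by rewrite SE leey.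
have Sfin : S \is a fin_num by rewrite ge0_fin_numE// lt_neqAle Sy leey.
have bnd m n : (k <= n)%N ->
    (((\sum_(n <= i < m) u i) ^+ 2)%:E <= \sum_(n <= i <oo) (2 ^+ i.+1 * u i ^+ 2)%:E)%E.
  move=> kn; have [mn|nm] := leqP m n.
    by rewrite big_geq// expr0n/=; apply: nneseries_ge0 => i _ _; exact: pos.
  rewrite -(subnKC (ltnW nm)).
  apply: (@le_trans _ _ (\sum_(n <= i < n + (m - n)) 2 ^+ i.+1 * u i ^+ 2)%:E).
    by rewrite lee_fin sqr_sum_le.
  rewrite -sumEFin; apply: nneseries_lim_ge => i _ _; exact: pos.
have kS0 : (\sum_(0 <= i <oo) (2 ^+ i.+1 * u i ^+ 2)%:E < +oo)%E.
  rewrite (nneseries_split 0 k)// add0n sumEFin.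
  by apply: lte_add_pinfty; [exact: ltry|rewrite -ge0_fin_numE].
have tail0 := nneseries_tail_cvg kS0 (fun i _ => pos i).
have cu : cvgn (series u).
  apply/cauchy_cvgP/cauchy_seriesP => e e0.
  have e20 : 0 < e ^+ 2 by rewrite exprn_gt0.
  have /fine_cvgP[[N1 _ fN1] /cvgr_lt/(_ _ e20)[N2 _ fN2]] := tail0.
  pose N := maxn N1 N2.
  have NP n : (N <= n)%N ->
      (\sum_(n <= i <oo) (2 ^+ i.+1 * u i ^+ 2)%:E < (e ^+ 2)%:E)%E.
    rewrite geq_max => /andP[n1 n2].
    by rewrite -[ltLHS]fineK ?fN1// lte_fin; exact: fN2.
  exists ([set n | (maxn N k <= n)%N], setT) => /=.
    by split; [exists (maxn N k)|exact: filterT].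
  move=> [n m] /= [nN _].
  rewrite -(@ltr_pXn2r _ 2)// ?nnegrE ?(ltW e0)// real_normK ?num_real//.
  rewrite -lte_fin (le_lt_trans (bnd m n _))//.
    by rewrite (leq_trans _ nN)// leq_maxr.
  by apply: NP; rewrite /= (leq_trans _ nN)// leq_maxl.
have [l ul] := (cvg_ex _).1 cu.
have ul' : (fun k => \sum_(i < k) u i) @ \oo --> l.
  move: ul; rewrite (_ : series u = (fun k => \sum_(i < k) u i))//.
  by apply/funext => i; rewrite /series/= big_mkord.
rewrite (series_sum_cvg ul') -(fineK Sfin) lee_fin.
have : (fun m => (\sum_(i < m) u i - \sum_(i < k) u i) ^+ 2) @ \oo --> (l - \sum_(i < k) u i) ^+ 2.
  rewrite expr2; under eq_fun do rewrite expr2.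
  by apply: cvgM; apply: cvgB => //; exact: cvg_cst.
move=> /cvgr_to_le; apply; exists k => // m /= km.
rewrite -lee_fin (fineK Sfin) (le_trans _ (bnd m k _))// lee_fin.
rewrite -!(big_mkord xpredT) (@big_cat_nat _ _ _ k 0 m)//=.
by rewrite addrAC subrr add0r.
Qed.

Definition cseries_sum (F : nat -> T -> R[i]) (x : T) : R[i] :=
  Complex (series_sum (fun i => complex.Re (F i x)))
          (series_sum (fun i => complex.Im (F i x))).

Lemma measurable_series_sum (u : nat -> T -> R) :
  (forall i, measurable_fun setT (u i)) ->
  measurable_fun setT (fun x => series_sum (fun i => u i x)).
Proof.
move=> mu_; apply: measurableT_comp => //.
apply: measurable_fun_limn_esup => k; apply/measurable_EFinP.
exact: measurable_sum.
Qed.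

Lemma cmeasurable_cseries_sum (F : nat -> T -> R[i]) :
  (forall i, cmeasurable (F i)) -> cmeasurable (cseries_sum F).
Proof.
by move=> mF; split; apply: measurable_series_sum => i; case: (mF i).
Qed.

Lemma cmeasurable_normc2 (f : T -> R[i]) : cmeasurable f ->
  measurable_fun setT (fun x => Normc.normc (f x) ^+ 2).
Proof.
move=> [m1 m2]; under eq_fun do rewrite normc_sqr.
by apply: measurable_funD; apply: measurable_funX.
Qed.

(** The pointwise bound [series_sum_tail] holds at every point, divergent ones included, so it can
    be integrated directly. The weight [W] serves twice: the constant 1 gives convergence in L2, the
    Sobolev weight gives finiteness of the [H^s] norm. *)
Lemma cseries_sum_tail (F : nat -> T -> R[i]) (W : T -> R) k :
  (forall i, cmeasurable (F i)) -> measurable_fun setT W ->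
  (forall x, 0 <= W x) ->
  (\int[mu]_x (W x * Normc.normc (cseries_sum F x - \sum_(i < k) F i x) ^+ 2)%:E
   <= \sum_(k <= i <oo)
        (2 ^+ i.+1)%:E * \int[mu]_x (W x * Normc.normc (F i x) ^+ 2)%:E)%E.
Proof.
move=> mF mW W0.
have g0 i x : (0 <= (2 ^+ i.+1 * (W x * Normc.normc (F i x) ^+ 2))%:E)%E.
  rewrite lee_fin; apply: mulr_ge0; first exact: exprn_ge0.
  by apply: mulr_ge0 => //; exact: sqr_ge0.
have mg i : measurable_fun setT (fun x => (W x * Normc.normc (F i x) ^+ 2)).
  by apply: measurable_funM => //; exact: cmeasurable_normc2.
have mg' i : measurable_fun setT (fun x => (2 ^+ i.+1 * (W x * Normc.normc (F i x) ^+ 2))%:E).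
  by apply/measurable_EFinP; apply: measurable_funM.
rewrite (eq_eseriesr (g := fun i => \int[mu]_x (2 ^+ i.+1 * (W x * Normc.normc (F i x) ^+ 2))%:E)%E); last first.
  move=> i _; rewrite -ge0_integralZl//; first exact/measurable_EFinP.
  by move=> x _; rewrite lee_fin mulr_ge0// sqr_ge0.
rewrite -(nneseries_addn (f := fun i => \int[mu]_x (2 ^+ i.+1 * (W x * Normc.normc (F i x) ^+ 2))%:E)%E); last first.
  by move=> i; exact: integral_ge0.
rewrite -integral_nneseries//.
apply: ge0_le_integral => //.
- by move=> x _; rewrite lee_fin mulr_ge0// sqr_ge0.
- apply/measurable_EFinP; apply: measurable_funM => //.
  apply: cmeasurable_normc2; apply: cmeasurableB.
    exact: cmeasurable_cseries_sum.
  exact: cmeasurable_sum.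
- apply: ge0_emeasurable_sum => //.
- move=> x _.
  rewrite normc_sqr !(cReD, cImD) cReN cImN/= cRe_sum cIm_sum.
  have r := series_sum_tail (fun i => complex.Re (F i x)) k.
  have i := series_sum_tail (fun i => complex.Im (F i x)) k.
  rewrite (nneseries_addn (f := fun i => (2 ^+ i.+1 * (W x * Normc.normc (F i x) ^+ 2))%:E))//.
  rewrite EFinM.
  apply: (@le_trans _ _ ((W x)%:E * (\sum_(k <= i <oo) (2 ^+ i.+1 * Normc.normc (F i x) ^+ 2)%:E))%E).
    apply: lee_wpmul2l; first by rewrite lee_fin.
    rewrite EFinD (le_trans (leeD r i))// -nneseriesD//.
    + apply: lee_nneseries => [j _ _|j _]; first by rewrite -EFinD lee_fin addr_ge0// mulr_ge0 ?sqr_ge0// exprn_ge0.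
      by rewrite -EFinD -mulrDr -normc_sqr.
    + by move=> j _; rewrite lee_fin mulr_ge0 ?sqr_ge0// exprn_ge0.
    + by move=> j _; rewrite lee_fin mulr_ge0 ?sqr_ge0// exprn_ge0.
  rewrite -nneseriesZl//; last by move=> j _; rewrite lee_fin mulr_ge0 ?sqr_ge0// exprn_ge0.
  apply: lee_nneseries => [j _ _|j _]; first by rewrite -EFinM mulrCA; exact: g0.
  by rewrite -EFinM mulrCA.
Qed.

Lemma cseries_sum_tail_le (F : nat -> T -> R[i]) (W : T -> R) k :
  (forall i, cmeasurable (F i)) -> measurable_fun setT W ->
  (forall x, 0 <= W x) ->
  (forall i, \int[mu]_x (W x * Normc.normc (F i x) ^+ 2)%:E <= (4 ^- i)%:E)%E ->
  (\int[mu]_x (W x * Normc.normc (cseries_sum F x - \sum_(i < k) F i x) ^+ 2)%:E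
   <= (4 / 2 ^+ k)%:E)%E.
Proof.
move=> mF mW W0 FW; apply: (le_trans (cseries_sum_tail k mF mW W0)).
rewrite -(nneseries_addn (f := fun i => (2 ^+ i.+1)%:E * \int[mu]_x (W x * Normc.normc (F i x) ^+ 2)%:E)%E); last first.
  move=> i; apply: mule_ge0; first by rewrite lee_fin exprn_ge0.
  by apply: integral_ge0 => x _; rewrite lee_fin mulr_ge0// sqr_ge0.
(* [2 ^+ i.+1 * 4 ^- i] equals [2 * 2 ^- i], and these terms sum to [4 / 2 ^+ k] from [k] on. *)
rewrite -(cvg_lim _ (@cvg_geometric_eseries_half R 4 k))//.
rewrite /eseries/=.
apply: lee_nneseries => [i _ _|i _].
  apply: mule_ge0; first by rewrite lee_fin exprn_ge0.
  by apply: integral_ge0 => x _; rewrite lee_fin mulr_ge0// sqr_ge0.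
apply: (@le_trans _ _ ((2 ^+ (i + k).+1)%:E * (4 ^- (i + k))%:E)%E).
  by apply: lee_wpmul2l; rewrite ?lee_fin ?exprn_ge0.
rewrite -EFinM lee_fin natrX (_ : 4 = 2 ^+ 2 :> R); last by ring.
rewrite -exprM le_eqVlt; apply/orP; left; apply/eqP.
rewrite addnS mulnC exprM !exprS expr0.
have : 2 ^+ (i + k) != 0 :> R by rewrite expf_neq0.
by move: (2 ^+ (i + k)) => p p0; field.
Qed.

End L2_series.

(** * Tensor products *)

Section product.
Context d1 d2 (T1 : measurableType d1) (T2 : measurableType d2) (R : realType).
Variable m1 : {sigma_finite_measure set T1 -> \bar R}.
Variable m2 : {sigma_finite_measure set T2 -> \bar R}.

Lemma integrable_tensor (f : T1 -> R) (g : T2 -> R) :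
  m1.-integrable setT (EFin \o f) -> m2.-integrable setT (EFin \o g) ->
  (m1 \x m2)%E.-integrable setT (fun z => (f z.1 * g z.2)%:E).
Proof.
move=> fi gi.
have /measurable_int/measurable_EFinP mf := fi.
have /measurable_int/measurable_EFinP mg := gi.
have m : measurable_fun setT (fun z : T1 * T2 => (f z.1 * g z.2)%:E).
  by apply/measurable_EFinP; apply: measurable_funM; apply: measurableT_comp.
apply/(integrable12ltyP m1 m2 m) => /=.
have gfin : (\int[m2]_x `|(g x)%:E| < +oo)%E by have /integrableP[] := gi.
have ffin : (\int[m1]_x `|(f x)%:E| < +oo)%E by have /integrableP[] := fi.
rewrite (eq_integral (fun x => `|(f x)%:E| * \int[m2]_y `|(g y)%:E|)%E); last first.
  move=> x _; rewrite -ge0_integralZl//; last exact/measurable_EFinP/measurableT_comp.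
  by apply: eq_integral => y _; rewrite /= normrM EFinM.
rewrite ge0_integralZr//; last 2 first.
- exact/measurable_EFinP/measurableT_comp.
- exact: integral_ge0.
by apply: lte_mul_pinfty => //; [exact: integral_ge0|rewrite ge0_fin_numE//; exact: integral_ge0].
Qed.

Lemma Rintegral_tensor (f : T1 -> R) (g : T2 -> R) :
  m1.-integrable setT (EFin \o f) -> m2.-integrable setT (EFin \o g) ->
  \int[(m1 \x m2)%E]_z (f z.1 * g z.2) = (\int[m1]_x f x) * (\int[m2]_y g y).
Proof.
move=> fi gi; rewrite {1}/Rintegral -(integral12_prod_meas1 (integrable_tensor fi gi)).
rewrite -[RHS]/(fine ((\int[m1]_x f x) * (\int[m2]_y g y))%:E); congr fine.
have gE : (\int[m2]_y (g y)%:E = (\int[m2]_y g y)%:E)%E.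
  by rewrite fineK//; exact: integrable_fin_num.
rewrite (eq_integral (fun x => (f x)%:E * (\int[m2]_y g y)%:E)%E).
  rewrite integralZr// EFinM; congr (_ * _)%E.
  by rewrite fineK//; exact: integrable_fin_num.
move=> x _; rewrite -gE -integralZl//.
Qed.

Lemma cintegrable_tensor (f : T1 -> R[i]) (g : T2 -> R[i]) :
  cintegrable m1 setT f -> cintegrable m2 setT g ->
  cintegrable (m1 \x m2)%E setT (fun z => f z.1 * g z.2).
Proof.
move=> [f1 f2] [g1 g2]; split.
  have := integrableB measurableT (integrable_tensor f1 g1) (integrable_tensor f2 g2).
  by apply: eq_integrable => // z _ /=; rewrite cReM EFinB.
have := integrableD measurableT (integrable_tensor f1 g2) (integrable_tensor f2 g1).
by apply: eq_integrable => // z _ /=; rewrite cImM EFinD.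
Qed.

Lemma cintegral_tensor (f : T1 -> R[i]) (g : T2 -> R[i]) :
  cintegrable m1 setT f -> cintegrable m2 setT g ->
  cintegral (m1 \x m2)%E setT (fun z => f z.1 * g z.2) =
  cintegral m1 setT f * cintegral m2 setT g.
Proof.
move=> [f1 f2] [g1 g2]; apply: eq_complexP; rewrite ?cReM ?cImM/=.
  rewrite -!Rintegral_tensor//.
  rewrite -(RintegralB measurableT (integrable_tensor f1 g1) (integrable_tensor f2 g2)).
  by apply: eq_Rintegral => z _; exact: cReM.
rewrite -!Rintegral_tensor//.
rewrite -(RintegralD measurableT (integrable_tensor f1 g2) (integrable_tensor f2 g1)).
by apply: eq_Rintegral => z _; exact: cImM.
Qed.

End product.

Section euclid_product.
Variable R : realType.
Local Notation leb := (@lebesgue_measure R).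
Local Notation lebn n := (@lebesgue_measure_euclid R n).

Lemma integrable_euclidS n (f : euclid R n.+1 -> \bar R) :
  measurable_fun setT f ->
  (leb \x lebn n)%E.-integrable setT (f \o @euclid_cons R n) ->
  (lebn n.+1).-integrable setT f.
Proof.
move=> mf fi.
exact: (integrable_pushforward (@measurable_euclid_cons R n) mf fi measurableT).
Qed.

Lemma integral_euclidS n (f : euclid R n.+1 -> \bar R) :
  measurable_fun setT f ->
  (leb \x lebn n)%E.-integrable setT (f \o @euclid_cons R n) ->
  (\int[lebn n.+1]_v f v = \int[(leb \x lebn n)%E]_z f (euclid_cons z))%E.
Proof.
move=> mf fi.
exact: (integral_pushforward (@measurable_euclid_cons R n) mf fi measurableT).
Qed.

Lemma measurable_euclid_prod n (h : 'I_n -> R -> R[i]) :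
  (forall i, cmeasurable (h i : measurableTypeR R -> R[i])) ->
  cmeasurable (fun v : euclid R n => \prod_(i < n) h i (tnth v i)).
Proof.
move=> mh.
have : forall r : seq 'I_n, cmeasurable (fun v : euclid R n => \prod_(i <- r) h i (tnth v i)).
  elim=> [|i r IH].
    by under eq_fun do rewrite big_nil; exact: cmeasurable_cst.
  under eq_fun do rewrite big_cons; apply: cmeasurableM => //.
  case: (mh i) => [m1 m2]; split.
    by apply: (measurableT_comp m1); exact: measurable_tnth.
  by apply: (measurableT_comp m2); exact: measurable_tnth.
by move=> /(_ (index_enum _)).
Qed.

Lemma cintegrable_measurable d (T : measurableType d) (mu : {measure set T -> \bar R})
  (f : T -> R[i]) : cintegrable mu setT f -> cmeasurable f.
Proof.
by move=> [/measurable_int/measurable_EFinP m1 /measurable_int/measurable_EFinP m2].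
Qed.

Lemma euclid_prod_cons n (h : 'I_n.+1 -> R -> R[i]) z :
  \prod_(i < n.+1) h i (tnth (euclid_cons z) i) =
  h ord0 z.1 * \prod_(i < n) h (lift ord0 i) (tnth z.2 i).
Proof.
rewrite big_ord_recl; congr (_ * _).
by apply: eq_bigr => i _; rewrite tnthS.
Qed.

(** Fubini, one coordinate at a time. Integrability and value are proved together because the
    induction step needs the integrability of the remaining product; in dimension 0 the measure is a
    unit Dirac mass. *)
Lemma cintegral_euclid_prod n (h : 'I_n -> R -> R[i]) :
  (forall i, cintegrable leb setT (h i)) ->
  cintegrable (lebn n) setT (fun v => \prod_(i < n) h i (tnth v i)) /\
  cintegral (lebn n) setT (fun v => \prod_(i < n) h i (tnth v i)) =
  \prod_(i < n) cintegral leb setT (h i).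
Proof.
elim: n h => [|n IH] h hi.
  have e1 : (fun v : euclid R 0 => \prod_(i < 0) h i (tnth v i)) = (fun=> 1).
    by apply/funext => v; rewrite big_ord0.
  have fin0 : (lebn 0 setT < +oo)%E.
    by change (\d_([tuple] : euclid R 0) setT < +oo :> \bar R)%E; rewrite diracT ltry.
  rewrite e1 big_ord0; split.
    split; apply: measurable_bounded_integrable => //; exact: bounded_cst.
  apply: eq_complexP; rewrite /= Rintegral_cst//.
    change (1 * fine (\d_([tuple] : euclid R 0) setT : \bar R) = 1).
    by rewrite diracT mulr1.
  by rewrite mul0r.
have [IH1 IH2] := IH (fun i => h (lift ord0 i)) (fun i => hi (lift ord0 i)).
have t1 := cintegrable_tensor (m1 := leb) (m2 := lebn n) (hi ord0) IH1.
have t2 := cintegral_tensor (m1 := leb) (m2 := lebn n) (hi ord0) IH1.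
have [mr mi] := measurable_euclid_prod (fun i => cintegrable_measurable (hi i)).
have mr' := (measurable_EFinP _ _).2 mr.
have mi' := (measurable_EFinP _ _).2 mi.
have [t11 t12] := t1.
have r1 : (leb \x lebn n)%E.-integrable setT
    ((fun v => (complex.Re (\prod_(i < n.+1) h i (tnth v i)))%:E) \o @euclid_cons R n).
  by apply: eq_integrable t11 => // z _ /=; rewrite euclid_prod_cons.
have i1 : (leb \x lebn n)%E.-integrable setT
    ((fun v => (complex.Im (\prod_(i < n.+1) h i (tnth v i)))%:E) \o @euclid_cons R n).
  by apply: eq_integrable t12 => // z _ /=; rewrite euclid_prod_cons.
split.
  by split; apply: integrable_euclidS.
rewrite big_ord_recl -IH2 -t2; apply: eq_complexP => /=; congr fine.
  rewrite integral_euclidS//; apply: eq_integral => z _; by rewrite euclid_prod_cons.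
rewrite integral_euclidS//; apply: eq_integral => z _; by rewrite euclid_prod_cons.
Qed.

Lemma cprod_real n (h : 'I_n -> R) :
  \prod_(i < n) (Complex (h i) 0 : R[i]) = Complex (\prod_(i < n) h i) 0.
Proof.
exact: (esym (rmorph_prod (real_complex R) _ _ _)).
Qed.

Lemma Rintegral_euclid_prod n (h : 'I_n -> R -> R) :
  (forall i, leb.-integrable setT (EFin \o h i)) ->
  (lebn n).-integrable setT (EFin \o (fun v => \prod_(i < n) h i (tnth v i))) /\
  \int[lebn n]_v (\prod_(i < n) h i (tnth v i)) = \prod_(i < n) \int[leb]_x h i x.
Proof.
move=> hi.
have hi' i : cintegrable leb setT (fun x => Complex (h i x) 0).
  by split; [exact: hi|exact: integrable0].
have [[i1 _] E] := cintegral_euclid_prod hi'.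
have pE v : complex.Re (\prod_(i < n) (Complex (h i (tnth v i)) 0 : R[i])) =
    \prod_(i < n) h i (tnth v i) by rewrite cprod_real.
split; first by apply: eq_integrable i1 => // v _ /=; rewrite pE.
have := congr1 (@complex.Re R) E; rewrite /=.
under eq_Rintegral do rewrite pE.
move=> ->; rewrite (eq_bigr (fun i => Complex (\int[leb]_x h i x) 0 : R[i])).
  by rewrite cprod_real.
by move=> i _; apply: eq_complexP => //=; rewrite /Rintegral integral0.
Qed.

End euclid_product.

(** * Combs of frequencies *)

Section comb.
Variable R : realType.
Local Notation leb := (@lebesgue_measure R).
Variables (q : nat) (c : nat -> R).

Lemma sumr_ord_const (a : R) : \sum_(m < q) a = q%:R * a.
Proof. by rewrite sumr_const card_ord mulr_natl. Qed.

Definition spikes (x : R) : R := \sum_(m < q) lorentz (x - c m).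

Definition comb (x : R) : R := q%:R^-1 * spikes x.

Definition wave (x : R) : R[i] :=
  \sum_(m < q) Complex (q%:R^-1 * expR (- `|x|)) 0 * expi (c m * x).

Lemma spikes_ge0 x : 0 <= spikes x.
Proof. by apply: sumr_ge0 => m _; exact: lorentz_ge0. Qed.

Lemma comb_ge0 x : 0 <= comb x.
Proof. by rewrite mulr_ge0 ?spikes_ge0// invr_ge0. Qed.

Lemma measurable_laplace : measurable_fun setT (fun x : measurableTypeR R => expR (- `|x|) : R).
Proof. by have /measurable_int/measurable_EFinP := @integrable_laplace R. Qed.

Lemma measurable_lin (b : R) : measurable_fun setT (fun x : measurableTypeR R => b * x).
Proof.
by apply: continuous_measurableR => x; apply: cvgM; [exact: cvg_cst|exact: cvg_id].
Qed.

Lemma cmeasurable_wave : cmeasurable (wave : measurableTypeR R -> R[i]).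
Proof.
apply: cmeasurable_sum => m; apply: cmeasurableM.
  apply: cmeasurable_real; apply: measurable_funM => //.
  exact: measurable_laplace.
by apply: cmeasurable_expi; exact: measurable_lin.
Qed.

Lemma integrable_comb : leb.-integrable setT (EFin \o comb).
Proof.
have : leb.-integrable setT (fun x => \sum_(m < q) (lorentz (x - c m))%:E)%E.
  by apply: integrable_sum => // m _; exact: integrable_lorentz.
move=> /(integrableZl measurableT q%:R^-1).
by apply: eq_integrable => // x _ /=; rewrite /comb EFinM sumEFin.
Qed.

Lemma Rintegral_spikes_sum (f : R -> R) : measurable_fun setT (f : measurableTypeR R -> R) ->
  (forall x, `|f x| <= 1) ->
  \int[leb]_x (comb x * f x) =
  q%:R^-1 * \sum_(m < q) \int[leb]_x (lorentz (x - c m) * f x).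
Proof.
move=> mf f1.
have it m : leb.-integrable setT (EFin \o (fun x => lorentz (x - c m) * f x)).
  by apply: integrableM_le1 => //; exact: integrable_lorentz.
rewrite -(Rintegral_sum _ measurableT)// -(RintegralZl _ measurableT); last first.
  exact: integrable_Rsum.
by apply: eq_Rintegral => x _; rewrite /comb -mulrA /spikes mulr_suml.
Qed.

Lemma Rintegral_comb : (0 < q)%N -> \int[leb]_x comb x = 2 * pi.
Proof.
move=> q0; have := @Rintegral_spikes_sum (cst 1) (measurable_cst _) _.
under eq_Rintegral do rewrite mulr1.
move=> ->; last by move=> x; rewrite normr1.
rewrite (eq_bigr (fun=> 2 * pi)); last first.
  move=> m _; rewrite -(Rintegral_lorentz (c m)).
  by apply: eq_Rintegral => x _; rewrite mulr1.
by rewrite sumr_ord_const mulKf// pnatr_eq0 -lt0n.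
Qed.

Lemma cintegrable_wave_expi (k : R) :
  cintegrable leb setT (fun x => wave x * expi (- (x * k))).
Proof.
apply: (cintegrable_le measurableT (g := fun x : measurableTypeR R => q%:R * (q%:R^-1 * expR (- `|x|)))).
- apply: cmeasurableM; first exact: cmeasurable_wave.
  apply: cmeasurable_expi; under eq_fun do rewrite mulrC -mulNr.
  exact: measurable_lin.
- have := integrableZl measurableT (q%:R * q%:R^-1) (@integrable_laplace R).
  by apply: eq_integrable => // x _ /=; rewrite mulrA.
- move=> x _; rewrite Normc.normcM normc_expi mulr1.
  rewrite (le_trans (normc_sum _ _ _))// -sumr_ord_const; apply: ler_sum => m _.
  by rewrite Normc.normcM normc_expi mulr1 normc_real ger0_norm// mulr_ge0 ?expR_ge0// invr_ge0.
Qed.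

(** Each term becomes a cosine and a sine integral at the frequency [c m - k]. The cosine gives a
    Lorentzian and the sine vanishes by parity, so the transform is real and nonnegative. *)
Lemma cintegral_wave (k : R) :
  cintegral leb setT (fun x => wave x * expi (- (x * k))) = Complex (comb k) 0.
Proof.
pose F m x : R[i] := Complex (q%:R^-1 * expR (- `|x|)) 0 * expi ((c m - k) * x).
have FE m x : F m x = Complex (q%:R^-1 * (expR (- `|x|) * cos ((c m - k) * x)))
    (q%:R^-1 * (expR (- `|x|) * sin ((c m - k) * x))).
  by apply: eq_complexP; rewrite ?cReM ?cImM/= mul0r ?subr0 ?addr0 mulrA.
have ic m : leb.-integrable setT (EFin \o (fun x => expR (- `|x|) * cos ((c m - k) * x))).
  apply: integrable_laplaceM; last by move=> x; rewrite ler_norml cos_geN1 cos_le1.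
  apply: measurableT_comp (measurable_lin _).
  by apply: continuous_measurable_fun; exact: continuous_cos.
have isn m : leb.-integrable setT (EFin \o (fun x => expR (- `|x|) * sin ((c m - k) * x))).
  apply: integrable_laplaceM; last by move=> x; rewrite ler_norml sin_geN1 sin_le1.
  apply: measurableT_comp (measurable_lin _).
  by apply: continuous_measurable_fun; exact: continuous_sin.
have Fi m : cintegrable leb setT (F m).
  split.
    by apply: eq_integrable (integrableZl measurableT q%:R^-1 (ic m)) => // x _; rewrite FE.
  by apply: eq_integrable (integrableZl measurableT q%:R^-1 (isn m)) => // x _; rewrite FE.
transitivity (cintegral leb setT (fun x => \sum_(m < q) F m x)).
  apply: eq_cintegral => x _; rewrite /wave mulr_suml; apply: eq_bigr => m _.
  rewrite /F -mulrA -expiD; congr (_ * expi _); ring.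
rewrite cintegral_sum//.
rewrite (eq_bigr (fun m : 'I_q => Complex (q%:R^-1 * lorentz (k - c m)) 0)); last first.
  move=> m _; apply: eq_complexP.
    transitivity (\int[leb]_x (q%:R^-1 * (expR (- `|x|) * cos ((c m - k) * x)))).
      by apply: eq_Rintegral => x _; rewrite FE.
    rewrite (RintegralZl _ measurableT (ic m)) Rintegral_laplace_cos.
    by rewrite /lorentz -sqrrN opprB.
  transitivity (\int[leb]_x (q%:R^-1 * (expR (- `|x|) * sin ((c m - k) * x)))).
    by apply: eq_Rintegral => x _; rewrite FE.
  by rewrite (RintegralZl _ measurableT (isn m)) Rintegral_laplace_sin mulr0.
rewrite /comb /spikes mulr_sumr; apply: eq_complexP.
  by rewrite cRe_sum.
by rewrite cIm_sum/= big1.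
Qed.

(** * Evolution of a one-dimensional comb *)

Definition phase (t x k : R) : R := x * k + t * k ^+ 2.

(** The factor [(2 pi)^-1] is left out here; the power [(2 pi)^-n] enters once, through
    [schrodinger_integral]. *)
Definition evolved (t x : R) : R[i] :=
  cintegral leb setT (fun k => expi (phase t x k) * Complex (comb k) 0).

Lemma continuous_phase t x w : continuous (fun k : R => phase t x k + w).
Proof.
move=> k; apply: cvgD; last exact: cvg_cst.
apply: cvgD; apply: cvgM; [exact: cvg_cst|exact: cvg_id|exact: cvg_cst|].
exact: exprn_continuous.
Qed.

Lemma measurable_cos_phase t x w :
  measurable_fun setT (fun k : measurableTypeR R => cos (phase t x k + w)).
Proof.
apply: continuous_measurableR => k.
apply: (@continuous_comp _ _ _ (fun k => phase t x k + w)); last exact: continuous_cos.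
exact: continuous_phase.
Qed.

Lemma cmeasurable_expi_phase t x :
  cmeasurable (fun k : measurableTypeR R => expi (phase t x k)).
Proof.
apply: cmeasurable_expi; apply: continuous_measurableR.
have := @continuous_phase t x 0.
by under eq_fun do rewrite addr0.
Qed.

Lemma cmeasurable_comb : cmeasurable (fun k : measurableTypeR R => Complex (comb k) 0).
Proof.
apply: cmeasurable_real.
by have /measurable_int/measurable_EFinP := integrable_comb.
Qed.

Lemma normc_phase_comb t x k :
  Normc.normc (expi (phase t x k) * Complex (comb k) 0) = comb k.
Proof. by rewrite Normc.normcM normc_expi mul1r normc_real ger0_norm ?comb_ge0. Qed.

Lemma cintegrable_evolved t x :
  cintegrable leb setT (fun k => expi (phase t x k) * Complex (comb k) 0).
Proof.
apply: (cintegrable_le measurableT (g := comb : measurableTypeR R -> R)).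
- by apply: cmeasurableM; [exact: cmeasurable_expi_phase|exact: cmeasurable_comb].
- exact: integrable_comb.
- by move=> k _; rewrite normc_phase_comb.
Qed.

Lemma normc_evolved_le t x : (0 < q)%N -> Normc.normc (evolved t x) <= 2 * pi.
Proof.
move=> q0; rewrite -Rintegral_comb//; apply: normc_cintegral_le => //.
- by apply: cmeasurableM; [exact: cmeasurable_expi_phase|exact: cmeasurable_comb].
- exact: integrable_comb.
- by move=> k _; rewrite normc_phase_comb.
Qed.

Lemma Re_evolved t x w : complex.Re (expi w * evolved t x) =
  \int[leb]_k (comb k * cos (phase t x k + w)).
Proof.
rewrite -cintegralZ//; last exact: cintegrable_evolved.
apply: eq_Rintegral => k _; rewrite mulrA -expiD addrC cReM/= mulr0 subr0.
exact: mulrC.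
Qed.

(** Written as a cosine with a shifted phase, so that estimates uniform in the shift [w] cover both
    parts of the integral. *)
Lemma Im_evolved t x : complex.Im (evolved t x) =
  \int[leb]_k (comb k * cos (phase t x k - pi / 2)).
Proof.
by apply: eq_Rintegral => k _; rewrite cImM/= mulr0 add0r cosBpihalf mulrC.
Qed.

(* On [|k - c m| <= 12] the phases agree up to an angle 1; the rest of the mass of
   each spike is too small to matter. *)
Lemma evolved_coherent t x w : (0 < q)%N ->
  (forall m k, (m < q)%N -> `|k - c m| <= 12 -> 1 / 2 <= cos (phase t x k + w)) ->
  pi / 2 <= Normc.normc (evolved t x).
Proof.
move=> q0 H; apply: (@le_trans _ _ (complex.Re (expi w * evolved t x))); last first.
  rewrite (le_trans (ler_norm _))// (le_trans (normr_Re_le _))//.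
  by rewrite Normc.normcM normc_expi mul1r.
rewrite Re_evolved Rintegral_spikes_sum; last 2 first.
- exact: measurable_cos_phase.
- by move=> k; rewrite ler_norml cos_geN1 cos_le1.
have qp : q%:R != 0 :> R by rewrite pnatr_eq0 -lt0n.
rewrite -[leLHS](mulKf qp) ler_pM2l; last by rewrite invr_gt0 ltr0n.
rewrite -sumr_ord_const; apply: ler_sum => m _.
(* A minorant of the integrand, of integral [pi - pi / 2]. Beyond the radius 12 it has to absorb the
   worst sign of the cosine; a radius [b] allows this when [12 b <= 1 + b^2], and 12 is the first
   integer above 1 for which that holds. *)
pose B k := 1 / 2 * lorentz (k - c m) -
  1 / 2 * (12 / (12 ^+ 2 + (k - c m) ^+ 2)).
have il := @integrable_lorentz R (c m).
have ic := @integrable_cauchy R 12 (c m) (ltr0Sn _ _).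
have iB1 := integrableZl measurableT (1 / 2) il.
have iB2 := integrableZl measurableT (1 / 2) ic.
have iB : leb.-integrable setT (EFin \o B).
  have := integrableB measurableT iB1 iB2.
  by apply: eq_integrable.
apply: (@le_trans _ _ (\int[leb]_k B k)).
  rewrite (RintegralB measurableT iB1 iB2) (RintegralZl _ measurableT il).
  rewrite (RintegralZl _ measurableT ic) Rintegral_lorentz Rintegral_cauchy//.
  by rewrite le_eqVlt; apply/orP; left; apply/eqP; field.
apply: le_Rintegral => //.
  apply: integrableM_le1 => //.
    exact: measurable_cos_phase.
  by move=> k _; rewrite ler_norml cos_geN1 cos_le1.
move=> k _; rewrite /B.
have l0 := lorentz_ge0 (k - c m).
have [kc|kc] := lerP (`|k - c m|) 12.
  have := H m k (ltn_ord m) kc; have := @cauchy_ge0 R 12 (c m) k (ltr0Sn _ _).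
  by nra.
have a2 : 12 ^+ 2 < (k - c m) ^+ 2.
  by rewrite -[ltRHS]real_normK ?num_real// ltrXn2r// nnegrE.
have := cos_geN1 (phase t x k + w).
suff : 3 / 2 * lorentz (k - c m) <= 1 / 2 * (12 / (12 ^+ 2 + (k - c m) ^+ 2)) by nra.
rewrite /lorentz; move: ((k - c m) ^+ 2) a2 => u u0.
rewrite mulrA ler_pdivrMr; last by lra.
have -> : 1 / 2 * (12 / (12 ^+ 2 + u)) = 6 / (144 + u).
  by field; rewrite !gt_eqF//; lra.
by rewrite [leRHS]mulrAC ler_pdivlMr; lra.
Qed.

(** Every centre gets its own half-period [h' = pi / (x + 2 t c_m)]. The hypothesis says that
    [h' <= h], and the bound of [lorentz_oscillation] increases with the half-period. The factor 2
    adds up real and imaginary parts. *)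
Lemma evolved_decay t x (h H : R) : (0 < q)%N -> 0 <= t -> 0 < h <= 1 -> 2 <= H ->
  (forall m, (m < q)%N -> pi <= h * (x + 2 * t * c m)) ->
  Normc.normc (evolved t x) <= 2 * (pi * (2 * h + 3 * t * h * (2 * H + 1) + 12 / H)).
Proof.
move=> q0 t0 /andP[h0 h1] H2 hc.
set B := pi * _.
have key w : `|\int[leb]_k (comb k * cos (phase t x k + w))| <= B.
  rewrite Rintegral_spikes_sum; last 2 first.
  - exact: measurable_cos_phase.
  - by move=> k; rewrite ler_norml cos_geN1 cos_le1.
  have qp : q%:R != 0 :> R by rewrite pnatr_eq0 -lt0n.
  rewrite normrM ger0_norm ?invr_ge0// -[leRHS](mulKf qp).
  rewrite ler_pM2l ?invr_gt0 ?ltr0n// -sumr_ord_const.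
  rewrite (le_trans (ler_norm_sum _ _ _))//; apply: ler_sum => m _.
  have y0 : 0 < x + 2 * t * c m.
    by rewrite -(pmulr_rgt0 _ h0) (lt_le_trans (pi_gt0 R)) ?hc.
  pose h' := pi / (x + 2 * t * c m).
  have h'h : h' <= h by rewrite ler_pdivrMr ?hc.
  have h'0 : 0 < h' by rewrite divr_gt0 ?pi_gt0.
  apply: (le_trans (@lorentz_oscillation R x t (c m) w h' H t0 _ H2 _)).
  - by rewrite h'0 (le_trans h'h).
  - by rewrite divfK ?gt_eqF.
  - rewrite ler_pM2l ?pi_gt0// lerD2r lerD// ?ler_pM2l//.
    rewrite ler_wpM2r//; first by lra.
    by rewrite ler_wpM2l// mulr_ge0.
rewrite (le_trans (normc_le_ReIm _))// mulr2n mulrDl mul1r lerD//.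
  have := key 0; rewrite -Re_evolved (_ : expi 0 = 1) ?mul1r//.
  by rewrite /expi cos0 sin0.
by rewrite Im_evolved; exact: key.
Qed.

(** At most one centre is closer than [L / 2] to [x], and its spike is at most 2. Each other spike
    is at most [8 / L^2], and there are at most [L^2] of them. *)
Lemma spikes_le10 (L x : R) : 2 <= L -> q%:R <= L ^+ 2 ->
  (forall m l, (m < q)%N -> (l < q)%N -> m != l -> L <= `|c m - c l|) ->
  spikes x <= 10.
Proof.
move=> L2 qL sep.
have L0 : 0 < L by lra.
have far u : L / 2 <= `|u| -> lorentz u <= 8 / L ^+ 2.
  move=> Lu; have u2 : (L / 2) ^+ 2 <= u ^+ 2.
    by rewrite -[leRHS]real_normK ?num_real// lerXn2r ?nnegrE// divr_ge0// ltW.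
  have L20 : 0 < L ^+ 2 by rewrite exprn_gt0.
  rewrite /lorentz ler_pdivrMr; last by rewrite ltr_pwDl// sqr_ge0.
  rewrite mulrAC ler_pdivlMr//.
  by move: u2; rewrite expr_div_n; lra.
have bound : q%:R * (8 / L ^+ 2) <= 8.
  rewrite mulrCA -[leRHS]mulr1 ler_pM2l// ler_pdivrMr ?exprn_gt0// mul1r//.
have [/existsP[m0 m0L]|] := boolP [exists m : 'I_q, `|x - c m| < L / 2]; last first.
  rewrite negb_exists => /forallP H.
  apply: (@le_trans _ _ 8); last by lra.
  apply: le_trans bound; rewrite -sumr_ord_const; apply: ler_sum => m _.
  by apply: far; rewrite leNgt.
rewrite /spikes (bigD1 m0)//= (_ : 10 = 2 + 8); last by ring.
apply: lerD.
  rewrite /lorentz ler_pdivrMr; last by rewrite ltr_pwDl// sqr_ge0.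
  by have := sqr_ge0 (x - c m0); lra.
apply: le_trans bound; rewrite -sumr_ord_const [leRHS](bigD1 m0)//=.
rewrite -[leLHS]add0r; apply: lerD; first by rewrite divr_ge0// exprn_ge0// ltW.
apply: ler_sum => m mm0; apply: far.
have := sep m m0 (ltn_ord m) (ltn_ord m0) mm0.
rewrite (_ : c m - c m0 = (x - c m0) - (x - c m)); last by ring.
move=> /le_trans/(_ (ler_normB _ _)); lra.
Qed.

(** Split [x^2 <= 2 (x - c)^2 + 2 c^2]. The first part is absorbed by the decay of each spike and
    gives [4 q]; the second gives [8 B^2] times the sum of the spikes, at most 10; whence 84. It
    handles the Sobolev weight of exponent 1. *)
Lemma sqr_spikes_le (L B x : R) : 2 <= L -> q%:R <= L ^+ 2 -> q%:R <= B ^+ 2 ->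
  (forall m l, (m < q)%N -> (l < q)%N -> m != l -> L <= `|c m - c l|) ->
  (forall m, (m < q)%N -> `|c m| <= 2 * B) ->
  x ^+ 2 * spikes x <= 84 * B ^+ 2.
Proof.
move=> L2 qL qB sep cB.
apply: (@le_trans _ _ (4 * q%:R + 8 * B ^+ 2 * spikes x)).
  rewrite mulrC -[X in _ <= X + _]mulrC -sumr_ord_const /spikes mulr_suml mulr_sumr -big_split/=.
  apply: ler_sum => m _.
  have l0 := lorentz_ge0 (x - c m).
  have l1 : (x - c m) ^+ 2 * lorentz (x - c m) <= 2.
    rewrite /lorentz mulrA ler_pdivrMr; last by rewrite ltr_pwDl// sqr_ge0.
    by lra.
  have c2 : c m ^+ 2 <= 4 * B ^+ 2.
    rewrite -[leLHS]real_normK ?num_real// (_ : 4 * B ^+ 2 = (2 * B) ^+ 2); last by ring.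
    rewrite lerXn2r ?nnegrE ?cB//.
    by rewrite (le_trans (normr_ge0 (c m)))// cB.
  have x2 : x ^+ 2 <= 2 * (x - c m) ^+ 2 + 2 * c m ^+ 2.
    rewrite -subr_ge0 (_ : _ - _ = (x - 2 * c m) ^+ 2) ?sqr_ge0//; by ring.
  apply: (@le_trans _ _ (lorentz (x - c m) * (2 * (x - c m) ^+ 2 + 8 * B ^+ 2))).
    by apply: ler_wpM2l => //; lra.
  rewrite (_ : _ * (_ + _) = 2 * ((x - c m) ^+ 2 * lorentz (x - c m)) + 8 * B ^+ 2 * lorentz (x - c m)); last by ring.
  by rewrite lerD2r; lra.
have S10 := @spikes_le10 L x L2 qL sep.
have := spikes_ge0 x; have := sqr_ge0 B; nra.
Qed.

Lemma normc2_sum_expi (x : R) :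
  Normc.normc (\sum_(m < q) expi (c m * x)) ^+ 2 =
  \sum_(m < q) \sum_(l < q) cos ((c m - c l) * x).
Proof.
rewrite normc_sqr cRe_sum cIm_sum/= !expr2 !mulr_suml -big_split/=.
apply: eq_bigr => m _; rewrite !mulr_sumr -big_split/=.
by apply: eq_bigr => l _; rewrite mulrBl cosB.
Qed.

Lemma normc2_wave x : Normc.normc (wave x) ^+ 2 =
  q%:R^-1 ^+ 2 * expR (- `|x|) *
    \sum_(m < q) \sum_(l < q) (expR (- `|x|) * cos ((c m - c l) * x)).
Proof.
rewrite /wave -mulr_sumr Normc.normcM exprMn normc2_sum_expi.
rewrite normc_real ger0_norm; last by rewrite mulr_ge0 ?expR_ge0// invr_ge0.
under [in RHS]eq_bigr do rewrite -mulr_sumr.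
by rewrite -mulr_sumr; ring.
Qed.

Lemma integrable_normc2_wave : (0 < q)%N ->
  leb.-integrable setT (EFin \o (fun x => Normc.normc (wave x) ^+ 2)).
Proof.
move=> q0; have iE := integrableZl measurableT 1 (@integrable_laplace R).
have mw := cmeasurable_normc2 cmeasurable_wave.
apply: le_integrable iE => //; first exact/measurable_EFinP.
move=> x _ /=; rewrite mul1r lee_fin (ger0_norm (sqr_ge0 _)) (ger0_norm (expR_ge0 _)).
have e1 : expR (- `|x|) <= 1 by rewrite -[leRHS]expR0 ler_expR oppr_le0.
have w1 : Normc.normc (wave x) <= expR (- `|x|).
  rewrite /wave (le_trans (normc_sum _ _ _))//.
  rewrite [leRHS](_ : _ = \sum_(m < q) q%:R^-1 * expR (- `|x|)); last first.
    by rewrite sumr_ord_const mulrA mulfV ?mul1r// pnatr_eq0 -lt0n.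
  apply: ler_sum => m _; rewrite Normc.normcM normc_expi mulr1 normc_real.
  by rewrite ger0_norm// mulr_ge0 ?expR_ge0// invr_ge0.
rewrite expr2 (le_trans (ler_pM _ _ w1 w1)) ?normc_ge0//.
by rewrite ler_piMr ?expR_ge0.
Qed.

(** After expanding the square, the entry [(m, l)] integrates to [lorentz (c m - c l)], so each of
    the [q] rows is a value of [spikes], at most 10. Near orthogonality thus follows from the
    separation of the frequencies alone. *)
Lemma Rintegral_normc2_wave (L : R) : (0 < q)%N -> 2 <= L -> q%:R <= L ^+ 2 ->
  (forall m l, (m < q)%N -> (l < q)%N -> m != l -> L <= `|c m - c l|) ->
  \int[leb]_x (Normc.normc (wave x) ^+ 2) <= 10 / q%:R.
Proof.
move=> q0 L2 qL sep.
pose G x := \sum_(m < q) \sum_(l < q) (expR (- `|x|) * cos ((c m - c l) * x)).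
have ic k : leb.-integrable setT (EFin \o (fun x => expR (- `|x|) * cos (k * x))).
  apply: integrable_laplaceM; last by move=> x; rewrite ler_norml cos_geN1 cos_le1.
  apply: measurableT_comp (measurable_lin _).
  by apply: continuous_measurable_fun; exact: continuous_cos.
have iGm m : leb.-integrable setT (EFin \o (fun x =>
    \sum_(l < q) expR (- `|x|) * cos ((c m - c l) * x))).
  by apply: integrable_Rsum.
have iG : leb.-integrable setT (EFin \o G) by apply: integrable_Rsum.
have EG : \int[leb]_x G x =
    \sum_(m < q) \sum_(l < q) \int[leb]_x (expR (- `|x|) * cos ((c m - c l) * x)).
  rewrite Rintegral_sum//; apply: eq_bigr => m _.
  by rewrite Rintegral_sum.
have iG' := integrableZl measurableT (q%:R^-1 ^+ 2) iG.
apply: (@le_trans _ _ (\int[leb]_x (q%:R^-1 ^+ 2 * G x))).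
  apply: le_Rintegral => //; first exact: integrable_normc2_wave.
  move=> x _; rewrite normc2_wave -mulrA ler_wpM2l ?sqr_ge0//.
  (* One of the two factors [exp (- |x|)] is bounded by 1. This is allowed because the double sum is
     a squared modulus times an exponential, hence nonnegative. *)
  rewrite ler_piMl//.
    rewrite /G; under eq_bigr do rewrite -mulr_sumr.
    by rewrite -mulr_sumr mulr_ge0 ?expR_ge0// -normc2_sum_expi sqr_ge0.
rewrite (RintegralZl _ measurableT iG) EG.
have qp : 0 < q%:R :> R by rewrite ltr0n.
rewrite (_ : 10 / q%:R = q%:R^-1 ^+ 2 * (q%:R * 10)); last by field; rewrite gt_eqF.
rewrite ler_pM2l ?exprn_gt0 ?invr_gt0// -sumr_ord_const; apply: ler_sum => m _.
apply: le_trans (@spikes_le10 L (c m) L2 qL sep).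
by apply: ler_sum => l _; rewrite Rintegral_laplace_cos.
Qed.

End comb.

(** * Frequencies and times *)

Section parameters.
Variable R : realType.
Implicit Types (n q d m k : nat) (x t : R).

(* The points [(k / Q, ..., k / Q ^ n)] with [1 <= k <= Q ^ n] meet every cube of
   side [1 / Q] of the torus: the base-[Q] digits of [k] are chosen one by one. *)
Lemma digits_dense (Q n : nat) (y : nat -> R) : (0 < Q)%N ->
  exists2 k, (0 < k <= Q ^ n)%N & forall d, (d < n)%N ->
    exists N : int, `|k%:R / Q%:R ^+ d.+1 + y d - N%:~R| <= Q%:R^-1.
Proof.
move=> Q0; have Qp : 0 < Q%:R :> R by rewrite ltr0n.
(* Starting from 1 instead of 0 keeps [k] positive, so that the corresponding time is not 0. *)
elim: n => [|n [k /andP[k0 kQ] IH]]; first by exists 1%N.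
pose z : R := y n + k%:R / Q%:R ^+ n.+1.
pose f := Num.floor (Q%:R * z).
(* The new digit is [- f] modulo [Q], so [b / Q] cancels [f / Q] up to an integer; there remains the
   fractional part of [Q z], divided by [Q]. *)
pose b := `|((- f) %% (Q%:Z))%Z|%N.
have Qz : (Q%:Z != 0) by rewrite -lt0n.
have bE : b%:Z = ((- f) %% (Q%:Z))%Z by rewrite /b gez0_abs// modz_ge0.
have bQ : (b < Q)%N.
  by rewrite -ltz_nat bE (lt_le_trans (ltz_mod _ Qz)).
exists (k + b * Q ^ n)%N.
  rewrite (leq_trans k0) ?leq_addr//=.
  rewrite (leq_trans (leq_add kQ (leqnn _)))// -mulSn expnS leq_mul2r bQ orbT//.
move=> d; rewrite ltnS leq_eqVlt => /predU1P[->|dn].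
  pose g := ((- f) %/ (Q%:Z))%Z; exists (- g).
  have bR : b%:R = - f%:~R - g%:~R * Q%:R :> R.
    have := divz_eq (- f) (Q%:Z); rewrite -bE -/g => /(congr1 (fun j : int => j%:~R : R)).
    by rewrite rmorphN/= rmorphD/= rmorphM/= -!pmulrn => ->; ring.
  have Qn0 : Q%:R ^+ n != 0 :> R by rewrite expf_neq0// gt_eqF.
  rewrite natrD natrM bR natrX rmorphN/= opprK.
  rewrite (_ : _ + _ = (Q%:R * z - f%:~R) / Q%:R); last first.
    by rewrite /z exprS; field; rewrite (gt_eqF Qp) Qn0.
  rewrite normrM normfV (gtr0_norm Qp) ler_piMl ?invr_ge0 ?(ltW Qp)//.
  rewrite ger0_norm ?subr_ge0 ?ge_floor// lerBlDl.
  by have := floorD1_gt (Q%:R * z); rewrite -/f rmorphD/= => /ltW.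
(* Adding a multiple of [Q ^ n] moves the earlier coordinates by integers only. *)
have [N HN] := IH d dn; exists (N + (b * Q ^ (n - d.+1))%N%:Z).
rewrite natrD natrM rmorphD/= -pmulrn natrM !natrX.
have -> : Q%:R ^+ n = Q%:R ^+ (n - d.+1) * Q%:R ^+ d.+1 :> R by rewrite -exprD subnK.
rewrite (_ : _ + _ - _ = k%:R / Q%:R ^+ d.+1 + y d - N%:~R)//.
have Qd0 : Q%:R ^+ d.+1 != 0 :> R by rewrite expf_neq0// gt_eqF.
by move: (Q%:R ^+ d.+1) (Q%:R ^+ (n - d.+1)) Qd0 => u v u0; field.
Qed.

Lemma cosD2piz x (N : int) : cos (x + 2 * pi * N%:~R) = cos x.
Proof.
have H (y : R) j : cos (y + 2 * pi * j%:R) = cos y.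
  by rewrite mulr_natr mulr_natl; apply: periodicn; exact: cosD2pi.
case: N => j; first by rewrite -pmulrn H.
by have := H (x + 2 * pi * (Negz j)%:~R) j.+1; rewrite NegzE rmorphN/= mulrN subrK.
Qed.

(* Locked, so that unification never meets the unary numeral. *)
Definition oversample : nat := locked (64 * 64)%N.

Lemma oversampleE : oversample%:R = 64 * 64 :> R.
Proof. by rewrite /oversample -lock natrM. Qed.

Lemma oversample_gt0 : (0 < oversample)%N.
Proof. by rewrite /oversample -lock. Qed.

Definition modulus q : nat := (oversample * q)%N.
Definition spacing n q : R := (modulus q)%:R ^+ n.+1.
Definition offset q d : R := ((modulus q)%:R ^+ d.+1)^-1.
Definition freq n q d m : R := spacing n q * (m.+1%:R + offset q d / 2).
(* As [k (m + 1)^2] is an integer, [times n q k * freq n q d m ^+ 2] is affine in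
   [m] modulo [2 pi], with slope [2 pi k * offset q d]. *)
Definition times n q k : R := 2 * pi * k%:R / spacing n q ^+ 2.

Lemma modulus_gt0 q : (0 < q)%N -> (0 < modulus q)%N.
Proof. by move=> q0; rewrite muln_gt0 q0 oversample_gt0. Qed.

Lemma modulus_ge q : (q <= modulus q)%N.
Proof. by rewrite /modulus leq_pmull// oversample_gt0. Qed.

Lemma modulusE q : (modulus q)%:R = 64 * 64 * q%:R :> R.
Proof. by rewrite natrM oversampleE. Qed.

Lemma spacing_ge n q : (0 < q)%N -> 64 * 64 * q%:R <= spacing n q.
Proof.
move=> q0; rewrite -modulusE /spacing exprS ler_peMr// exprn_ege1//.
by rewrite ler1n modulus_gt0.
Qed.

Lemma spacing_gt0 n q : (0 < q)%N -> 0 < spacing n q.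
Proof. by move=> q0; rewrite exprn_gt0// ltr0n modulus_gt0. Qed.

Lemma offset_bounds q d : (0 < q)%N -> 0 <= offset q d <= 1.
Proof.
move=> q0; rewrite /offset invr_ge0 exprn_ge0//= invf_le1.
  by rewrite exprn_ege1// ler1n modulus_gt0.
by rewrite exprn_gt0// ltr0n modulus_gt0.
Qed.

Lemma freq_sep n q d m l : (0 < q)%N -> m != l ->
  spacing n q <= `|freq n q d m - freq n q d l|.
Proof.
move=> q0 ml; have L0 : 0 < spacing n q.
  exact: spacing_gt0.
rewrite /freq -mulrBr normrM gtr0_norm// ler_peMr// ?(ltW L0)//.
rewrite opprD addrACA subrr addr0.
wlog ml' : m l {ml} / (m < l)%N => [H|].
  by move: ml; rewrite neq_ltn => /orP[|] ml; [|rewrite distrC]; exact: H.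
by rewrite distrC -natrB ?ltnS ?(ltnW ml')// ger0_norm// ler1n subSS subn_gt0.
Qed.

Lemma freq_ge n q d m : (0 < q)%N -> spacing n q <= freq n q d m.
Proof.
move=> q0; have L0 : 0 <= spacing n q.
  exact/ltW/spacing_gt0.
have /andP[a0 a1] := offset_bounds d q0.
rewrite /freq ler_peMr// -natr1 addrAC lerDr addr_ge0// divr_ge0//.
Qed.

Lemma freq_le n q d m : (0 < q)%N -> (m < q)%N ->
  freq n q d m <= 2 * (spacing n q * q%:R).
Proof.
move=> q0 mq; have L0 : 0 <= spacing n q.
  exact/ltW/spacing_gt0.
have /andP[a0 a1] := offset_bounds d q0.
rewrite /freq mulrCA ler_wpM2l//.
have : m.+1%:R <= q%:R :> R by rewrite ler_nat.
have : 1 <= q%:R :> R by rewrite ler1n.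
lra.
Qed.

Lemma times_gt0 n q k : (0 < q)%N -> (0 < k)%N -> 0 < times n q k.
Proof.
move=> q0 k0; rewrite /times divr_gt0//.
  by rewrite !mulr_gt0 ?pi_gt0// ltr0n.
by rewrite exprn_gt0// spacing_gt0.
Qed.

(** The exponent [n.+1] in [spacing] is one more than the [n] of the bound on [k], which leaves a
    factor [1 / Q]. Since the frequencies are at most [2 L q], the drift [t * freq] is then of order
    [q / Q]. *)
Lemma times_spacing_le n q k : (0 < q)%N -> (k <= modulus q ^ n)%N ->
  times n q k * spacing n q <= 2 * pi / (modulus q)%:R.
Proof.
move=> q0 kQ; rewrite /times /spacing.
have Q0 : 0 < (modulus q)%:R :> R by rewrite ltr0n modulus_gt0.
have k1 : k%:R <= (modulus q)%:R ^+ n :> R by rewrite -natrX ler_nat.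
have Qn : 0 < (modulus q)%:R ^+ n :> R by rewrite exprn_gt0.
rewrite [_ ^+ n.+1]exprS.
move: ((modulus q)%:R ^+ n) k1 Qn => P k1 P0.
move: ((modulus q)%:R) Q0 => Q Q0.
rewrite (_ : _ * (Q * P) = 2 * pi / Q * (k%:R / P)); last by field; rewrite !gt_eqF.
rewrite ler_piMr ?ler_pdivrMr ?mul1r//.
by rewrite divr_ge0 ?mulr_ge0 ?pi_ge0// ltW.
Qed.

Lemma times_le n q k : (0 < q)%N -> (k <= modulus q ^ n)%N ->
  times n q k <= 2 * pi / (modulus q)%:R.
Proof.
move=> q0 kQ; rewrite (le_trans _ (times_spacing_le q0 kQ))// ler_peMr//.
  by rewrite /times divr_ge0 ?sqr_ge0// !mulr_ge0// pi_ge0.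
rewrite (le_trans _ (spacing_ge n q0))//.
have : 1 <= q%:R :> R by rewrite ler1n.
lra.
Qed.

Lemma pi_le4 : pi <= 4 :> R.
Proof. by have := pihalf_lt2 R; lra. Qed.

(** Expansion of the phase around the centre [L (M + al / 2)]: a slope mismatch multiplied by [M], a
    linear and a quadratic term in the distance to the centre, and [2 p] times an integer when [k],
    [M], [N] are integers. The constant subtracted on the left is the phase common to all [M].
    Powers are replaced by free variables, so that [field] sees atoms. *)
Lemma phase_recentered (x L p X k al M N : R) : L != 0 -> p != 0 ->
  x * X + 2 * p * k / L ^+ 2 * X ^+ 2 -
  (L * al * x / 2 + 2 * p * k * al ^+ 2 / 4) =
  2 * p * M * (k * al + L * x / (2 * p) - N) +
  (x + 2 * (2 * p * k / L ^+ 2) * (L * (M + al / 2))) * (X - L * (M + al / 2)) +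
  2 * p * k / L ^+ 2 * (X - L * (M + al / 2)) ^+ 2 +
  2 * p * (M * N + k * M ^+ 2).
Proof. by move=> L0 p0; field; rewrite L0. Qed.

Lemma coherent_time n q (x : nat -> R) : (0 < q)%N ->
  (forall d, (d < n)%N -> `|x d| <= 24^-1) ->
  exists2 k, (0 < k <= modulus q ^ n)%N & forall d, (d < n)%N ->
    pi / 2 <= Normc.normc (evolved q (freq n q d) (times n q k) (x d)).
Proof.
move=> q0 x24.
have Q0 : 0 < (modulus q)%:R :> R by rewrite ltr0n modulus_gt0.
(* [spacing n q * x d / (2 pi)] is the slope in [m], counted in turns, of the term [x d * freq]; the
   digits make [k * offset q d] cancel it modulo 1, with the same [k] for all [d]. *)
have [k kQ H] := digits_dense n (fun d => spacing n q * x d / (2 * pi)) (modulus_gt0 q0).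
exists k => // d dn; have [N HN] := H d dn.
have /andP[k0 kQ'] := kQ.
have L0 : 0 < spacing n q.
  exact: spacing_gt0.
pose w := - (spacing n q * offset q d * x d / 2 + 2 * pi * k%:R * offset q d ^+ 2 / 4).
apply: (@evolved_coherent _ _ _ _ _ w) => // m xi mq xi12.
set t := times n q k; set c := freq n q d m.
pose v := k%:R * offset q d + spacing n q * x d / (2 * pi) - N%:~R.
pose e := xi - c.
pose z := 2 * pi * m.+1%:R * v + (x d + 2 * t * c) * e + t * e ^+ 2.
have -> : phase t (x d) xi + w = z + 2 * pi * (m.+1%:Z * N + (k * m.+1 ^ 2)%N%:Z)%:~R.
  rewrite rmorphD/= rmorphM/= -!pmulrn natrM natrX.
  rewrite /phase /z /e /v /w /t /c /freq /times.
  have pi0 : pi != 0 :> R by rewrite gt_eqF ?pi_gt0.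
  have L1 : spacing n q != 0 by rewrite gt_eqF.
  exact: phase_recentered.
rewrite cosD2piz; apply: cos_ge_half.
have p4 := pi_le4; have p0 := pi_gt0 R.
have vQ : `|v| <= (modulus q)%:R^-1 by [].
have q1 : 1 <= q%:R :> R by rewrite ler1n.
have Q4 : q%:R / (modulus q)%:R = (64 * 64)^-1 :> R.
  by rewrite modulusE; field; rewrite gt_eqF// ltr0n.
have t0 : 0 < t by exact: times_gt0.
have tL : t * spacing n q <= 2 * pi / (modulus q)%:R by exact: times_spacing_le.
have t1 : t <= 2 * pi / (modulus q)%:R by exact: times_le.
have Q1 : (modulus q)%:R^-1 <= (64 * 64)^-1 :> R.
  by rewrite -Q4 ler_peMl// invr_ge0 ltW.
have B1 : `|2 * pi * m.+1%:R * v| <= 8 * (64 * 64)^-1.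
  rewrite normrM ger0_norm; last by rewrite !mulr_ge0// pi_ge0.
  rewrite -Q4 (le_trans (ler_pM _ _ (lexx _) vQ))//.
    by rewrite !mulr_ge0// pi_ge0.
  rewrite mulrA ler_wpM2r ?invr_ge0 ?(ltW Q0)//.
  have : m.+1%:R <= q%:R :> R by rewrite ler_nat.
  have : 0 <= m.+1%:R :> R by [].
  nra.
have c0 : 0 <= c by rewrite (le_trans (ltW L0))// freq_ge.
have B2 : t * c <= 16 * (64 * 64)^-1.
  apply: (@le_trans _ _ (t * (2 * (spacing n q * q%:R)))).
    by rewrite ler_pM2l// freq_le.
  rewrite (_ : _ * _ = 2 * q%:R * (t * spacing n q)); last by ring.
  apply: (@le_trans _ _ (2 * q%:R * (2 * pi / (modulus q)%:R))).
    by rewrite ler_wpM2l// mulr_ge0.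
  rewrite -Q4 (_ : _ * _ = (4 * pi) * (q%:R / (modulus q)%:R)); last by ring.
  by rewrite ler_wpM2r//; lra.
have B3 : `|(x d + 2 * t * c) * e| <= (24^-1 + 32 * (64 * 64)^-1) * 12.
  rewrite normrM ler_pM// (le_trans (ler_normD _ _))// lerD ?x24//.
  rewrite ger0_norm; last by rewrite mulr_ge0// mulr_ge0// ltW.
  by rewrite -mulrA (_ : 32 = 2 * 16); [rewrite -mulrA ler_pM2l|ring].
have B4 : `|t * e ^+ 2| <= 8 * (64 * 64)^-1 * 144.
  have t8 : t <= 8 * (64 * 64)^-1.
    apply: (le_trans t1); apply: ler_pM => //; last by lra.
    by rewrite mulr_ge0// ltW.
  rewrite normrM normrX (gtr0_norm t0); apply: ler_pM => //; first exact: ltW.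
  rewrite (_ : 144 = 12 ^+ 2); last by ring.
  by rewrite lerXn2r// nnegrE.
(* The angle is below 1: the position contributes [12 / 24], and the other terms
   [(8 + 32 * 12 + 8 * 144) / 4096], which is less than one half. This accounts for the half-side
   [24^-1] and for the size of [oversample]. *)
rewrite /z (le_trans (ler_normD _ _))//.
have := ler_normD (2 * pi * m.+1%:R * v) ((x d + 2 * t * c) * e).
lra.
Qed.

Lemma powR_expr_cvg0 (s b C eps : R) (a : nat) : 0 <= b -> 0 <= C -> 0 < eps ->
  a%:R * s < b -> exists N, forall q, (N <= q)%N -> (0 < q)%N /\
    C * ((q%:R ^+ a) `^ s) <= eps * (q%:R `^ b).
Proof.
move=> b0 C0 e0 asb.
pose del := b - a%:R * s.
have d0 : 0 < del by rewrite subr_gt0.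
have C1 : 0 < C + 1 by rewrite ltr_wpDl.
(* Solves [q^del >= (C + 1) / eps]; [C + 1] replaces [C] so that the logarithm makes sense for
   [C = 0]. *)
pose N := (Num.truncn (expR (del^-1 * ln ((C + 1) / eps)))).+1.
exists N => q Nq; have q0 : (0 < q)%N by rewrite (leq_trans _ Nq).
split => //.
have qp : 0 < q%:R :> R by rewrite ltr0n.
rewrite -powR_mulrn// -powRrM.
have -> : b = a%:R * s + del by rewrite /del addrC subrK.
rewrite powRD; last by rewrite (gt_eqF qp) implybT.
rewrite mulrCA mulrC ler_wpM2l ?powR_ge0//.
apply: (@le_trans _ _ (C + 1)); first by rewrite lerDl.
rewrite mulrC -ler_pdivrMr// /powR (gt_eqF qp).
have Ce : 0 < (C + 1) / eps by rewrite divr_gt0.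
rewrite -[leLHS](lnK (Ce : _ \is Num.pos)) ler_expR -ler_pdivrMl//.
rewrite -[leLHS]expRK ler_ln ?posrE ?expR_gt0//.
apply: (le_trans (ltW (truncnS_gt _))).
by rewrite ler_nat.
Qed.

Lemma frequency_growth n s (C eps : R) : (0 < n)%N -> 0 <= s -> 0 <= C -> 0 < eps ->
  s < (n%:R - 2) / (2 * n%:R) ->
  exists N, forall q, (N <= q)%N -> (0 < q)%N /\
    C * (((spacing n q * q%:R) ^+ 2) `^ s) / q%:R ^+ n <= eps.
Proof.
move=> n0 s0 C0 e0 sn.
have np : 0 < n%:R :> R by rewrite ltr0n.
have K0 : 0 <= C * ((oversample%:R ^+ n.+1) ^+ 2) `^ s by rewrite mulr_ge0 ?powR_ge0.
(* [(spacing * q)^2] is a constant times [q^(2 n + 4)], to be beaten by [q^n]; the condition follows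
   from [(n + 2)(n - 2) < n^2]. *)
have h : (2 * n + 4)%:R * s < n%:R.
  have n24 : 0 < 2 * n%:R + 4 :> R by lra.
  rewrite natrD natrM.
  apply: (@lt_trans _ _ ((2 * n%:R + 4) * ((n%:R - 2) / (2 * n%:R)))).
    by rewrite ltr_pM2l.
  rewrite mulrA ltr_pdivrMr; last by lra.
  by nra.
have [N HN] := powR_expr_cvg0 (ltW np) K0 e0 h.
exists N => q /HN[q0 Hq]; split => //.
have qp : 0 < q%:R :> R by rewrite ltr0n.
rewrite ler_pdivrMr ?exprn_gt0// -[_ ^+ n]powR_mulrn ?(ltW qp)//.
apply: le_trans Hq; rewrite -mulrA -powRM ?exprn_ge0//.
rewrite le_eqVlt; apply/orP; left; apply/eqP; congr (_ * _ `^ s).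
rewrite /spacing /modulus natrM [(_ * _) ^+ n.+1]exprMn -mulrA -exprSr exprMn; congr (_ * _).
by rewrite -exprM; congr (_ ^+ _); rewrite -addn2 mulnDl mulnC.
Qed.

(** All centres are at least [L], hence [L / 2] away from the points considered. The constant bound
    is multiplied by [(1 + x^2) lorentz x / 2 = 1] to provide a majorant that is integrable over the
    whole space. *)
Lemma cauchy_box n q d (x : R) : (0 < q)%N -> 2 * `|x| <= spacing n q ->
  comb q (freq n q d) x <= 4 * (1 + x ^+ 2) / (64 * 64 * q%:R) ^+ 2 * lorentz x.
Proof.
move=> q0 xL; have qp : 0 < q%:R :> R by rewrite ltr0n.
have L0 := spacing_gt0 n q0.
have x1 : 0 < 1 + x ^+ 2 by rewrite ltr_pwDl// sqr_ge0.
rewrite /lorentz [leRHS](_ : _ = 8 / (64 * 64 * q%:R) ^+ 2); last first.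
  by field; rewrite !gt_eqF.
rewrite /comb -[leRHS](mulKf (lt0r_neq0 qp)) ler_pM2l ?invr_gt0//.
rewrite -sumr_ord_const; apply: ler_sum => m _.
have dm : spacing n q / 2 <= `|x - freq n q d m|.
  have := freq_ge n d m q0; have := ler_norm x; rewrite distrC.
  by move=> h1 h2; rewrite (le_trans _ (ler_norm _))//; lra.
have d2 : (64 * 64 * q%:R / 2) ^+ 2 <= (x - freq n q d m) ^+ 2.
  rewrite -[leRHS]real_normK ?num_real// lerXn2r ?nnegrE//.
  by rewrite (le_trans _ dm)// ler_pM2r// spacing_ge.
rewrite /lorentz ler_pdivrMr; last by rewrite ltr_pwDl// sqr_ge0.
rewrite mulrAC ler_pdivlMr; last by rewrite exprn_gt0// !mulr_gt0.
by move: d2; rewrite expr_div_n; lra.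
Qed.

(** At a fixed positive time the velocities [2 t c_m] tend to infinity with [q], and the phase is
    nowhere stationary near a centre. The parameters are chosen in order: [H] makes the tail at most
    [eps / 2], then [h] does the same for the main part, then [q] makes the half-periods smaller
    than [h]; the [+ 1] in [N] compensates a negative [x]. *)
Lemma evolved_escapes n (t eps : R) : 0 < t -> 0 < eps ->
  exists N, forall q, (N <= q)%N -> forall d x, `|x| <= 24^-1 ->
    Normc.normc (evolved q (freq n q d) t x) <= eps.
Proof.
move=> t0 e0; have p0 := pi_gt0 R; have p4 := pi_le4.
pose H := 2 + 48 * pi / eps.
have H2 : 2 <= H by rewrite lerDl divr_ge0// ?ltW// mulr_gt0.
have H0 : 0 < H by lra.
have [D DE] : exists D, D = 2 + 3 * t * (2 * H + 1) by eexists.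
have D0 : 2 <= D by rewrite DE lerDl !mulr_ge0// ?ltW//; lra.
pose h := (1 + 4 * pi * D / eps)^-1.
have pD : 0 < 4 * pi * D / eps by rewrite divr_gt0// !mulr_gt0//; lra.
have h01 : 0 < h <= 1.
  by rewrite invr_gt0 invf_le1 ?ltr_pwDl ?lerDl//= ?ltW// ltr_pwDl// ltW.
have /andP[h0 h1] := h01.
have hD : 4 * pi * D * h <= eps.
  rewrite ler_pdivrMr; last by rewrite ltr_pwDl// ltW.
  by rewrite [eps * _]mulrDr mulr1 [eps * _]mulrC divfK ?gt_eqF// lerDr ltW.
pose N := (Num.truncn (t^-1 * (pi / h + 1))).+1.
exists N => q Nq d x x24.
have q0 : (0 < q)%N by rewrite (leq_trans _ Nq).
have qN : pi / h + 1 <= t * q%:R.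
  rewrite -ler_pdivrMl//; apply: (le_trans (ltW (truncnS_gt _))).
  by rewrite ler_nat.
have tH : pi * (3 * t * h * (2 * H + 1) + 2 * h) = pi * D * h by rewrite DE; ring.
apply: (le_trans (@evolved_decay R q (freq n q d) t x h H q0 (ltW t0) h01 H2 _)).
  move=> m mq; rewrite -ler_pdivrMl// mulrC.
  have c1 : q%:R <= freq n q d m.
    rewrite (le_trans _ (freq_ge n d m q0))// (le_trans _ (spacing_ge n q0))//.
    by rewrite ler_peMl//; lra.
  have : t * q%:R <= t * freq n q d m by rewrite ler_pM2l.
  have := x24; rewrite ler_norml => /andP[x1 _].
  have : 0 <= t * q%:R by rewrite mulr_ge0// ltW.
  by lra.
have Hh : 24 * pi / H <= eps / 2.
  rewrite ler_pdivrMr// (_ : eps / 2 * H = eps + 24 * pi); first by rewrite lerDr ltW.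
  by rewrite /H; field; rewrite gt_eqF.
rewrite (_ : 2 * _ = 2 * (pi * D * h) + 24 * pi / H); last first.
  by rewrite -tH; field; rewrite gt_eqF.
by lra.
Qed.

End parameters.

(** * Packets in R^n *)

Section packet.
Variables (R : realType) (n : nat).
Local Notation mu := (@lebesgue_measure_euclid R n).
Local Notation leb := (@lebesgue_measure R).
Implicit Types (a : R) (q : nat) (x xi : euclid R n).

Definition packet a q x : R[i] :=
  Complex a 0 * \prod_(d < n) wave q (freq R n q d) (tnth x d).

Definition packet_hat a q xi : R :=
  a * \prod_(d < n) comb q (freq R n q d) (tnth xi d).

(** An integrable majorant that does not depend on the scale: on the balls of earlier packets, later
    ones are compared with it. *)
Definition lorentz_prod xi : R := \prod_(d < n) lorentz (tnth xi d).

Definition packet_evolved a q (t : R) x : R[i] :=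
  Complex a 0 * \prod_(d < n) evolved q (freq R n q d) t (tnth x d).

Lemma expi0 : expi 0 = 1 :> R[i].
Proof. by rewrite /expi cos0 sin0. Qed.

Lemma expi_sum I (r : seq I) (f : I -> R) :
  expi (\sum_(i <- r) f i) = \prod_(i <- r) expi (f i).
Proof. exact: (big_morph _ (@expiD R) expi0). Qed.

Lemma creal_mul (a b : R) : Complex a 0 * Complex b 0 = Complex (a * b) 0 :> R[i].
Proof. by apply: eq_complexP; rewrite ?cReM ?cImM/=; ring. Qed.

Lemma sqr_enorm xi : enorm xi ^+ 2 = dotp xi xi.
Proof. by rewrite sqr_sqrtr// sumr_ge0// => i _; exact: sqr_ge0. Qed.

Lemma cintegrable_wave q c : cintegrable leb setT (@wave R q c).
Proof.
have := @cintegrable_wave_expi R q c 0; apply: eq_cintegrable => // x _.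
by rewrite mulr0 oppr0 expi0 mulr1.
Qed.

Lemma cmeasurable_packet a q : cmeasurable (packet a q).
Proof.
apply: cmeasurableM; first exact: cmeasurable_cst.
apply: (measurable_euclid_prod (h := fun d => wave q (freq R n q d))) => d.
exact: cmeasurable_wave.
Qed.

Lemma packet_fourier_integrand a q xi x :
  packet a q x * expi (- dotp x xi) = Complex a 0 *
    \prod_(d < n) (wave q (freq R n q d) (tnth x d) * expi (- (tnth x d * tnth xi d))).
Proof.
by rewrite /packet -mulrA -sumrN expi_sum big_split.
Qed.

Lemma cintegrable_packet a q : cintegrable mu setT (packet a q).
Proof.
apply: cintegrableZ => //.
have [] := @cintegral_euclid_prod R n (fun d => wave q (freq R n q d)) => //.
by move=> d; exact: cintegrable_wave.
Qed.

Lemma cintegrable_packet_fourier a q xi :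
  cintegrable mu setT (fun x => packet a q x * expi (- dotp x xi)).
Proof.
pose h (d : 'I_n) (x : R) := wave q (freq R n q d) x * expi (- (x * tnth xi d)).
have [h1 _] := @cintegral_euclid_prod R n h (fun d => cintegrable_wave_expi _ _ _).
have := cintegrableZ measurableT (Complex a 0) h1.
by apply: eq_cintegrable => // x _; rewrite packet_fourier_integrand.
Qed.

Lemma fourier_packet a q xi :
  fourier_L1 (packet a q) xi = Complex (packet_hat a q xi) 0.
Proof.
pose h (d : 'I_n) (x : R) := wave q (freq R n q d) x * expi (- (x * tnth xi d)).
have [h1 h2] := @cintegral_euclid_prod R n h (fun d => cintegrable_wave_expi _ _ _).
transitivity (cintegral mu setT (fun x => Complex a 0 * \prod_(d < n) h d (tnth x d))).
  by apply: eq_cintegral => x _; rewrite packet_fourier_integrand.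
rewrite cintegralZ// h2 (eq_bigr (fun d : 'I_n => Complex (comb q (freq R n q d) (tnth xi d)) 0)); last first.
  by move=> d _; exact: cintegral_wave.
by rewrite cprod_real creal_mul.
Qed.

Lemma L2norm_packet a q : (0 < q)%N ->
  (L2norm_sq mu (packet a q) <= (a ^+ 2 * (10 / q%:R) ^+ n)%:E)%E.
Proof.
move=> q0.
pose h (d : 'I_n) (x : R) := Normc.normc (wave q (freq R n q d) x) ^+ 2.
have hi d : leb.-integrable setT (EFin \o h d) by exact: integrable_normc2_wave.
have [i1 i2] := Rintegral_euclid_prod hi.
have E x : Normc.normc (packet a q x) ^+ 2 = a ^+ 2 * \prod_(d < n) h d (tnth x d).
  rewrite /packet Normc.normcM exprMn normc_real real_normK ?num_real//.
  by rewrite normc_prod -prodrXl.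
rewrite /L2norm_sq; under eq_integral do rewrite E.
rewrite -(fineK (integrable_fin_num _ (integrableZl measurableT (a ^+ 2) i1)))//.
rewrite lee_fin.
rewrite -[leLHS]/(\int[mu]_v (a ^+ 2 * \prod_(d < n) h d (tnth v d))).
rewrite (RintegralZl _ measurableT i1) i2 ler_wpM2l ?sqr_ge0//.
rewrite -[in leRHS](card_ord n) -prodr_const.
apply: ler_prod => d _; apply/andP; split.
  by apply: Rintegral_ge0 => x _; exact: sqr_ge0.
have q1 : 1 <= q%:R :> R by rewrite ler1n.
have qL := spacing_ge R n q0.
apply: (@Rintegral_normc2_wave _ _ _ (spacing R n q)) => //.
- by lra.
- by rewrite expr2; nra.
- by move=> m l _ _; exact: freq_sep.
Qed.

Lemma packet_hat_ge0 a q xi : 0 <= a -> 0 <= packet_hat a q xi.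
Proof. by move=> a0; rewrite mulr_ge0// prodr_ge0// => d _; exact: comb_ge0. Qed.

Lemma integrable_packet_hat a q : mu.-integrable setT (EFin \o packet_hat a q).
Proof.
have [h1 _] := Rintegral_euclid_prod (fun d : 'I_n => integrable_comb q (freq R n q d)).
by have := integrableZl measurableT a h1; apply: eq_integrable.
Qed.

Lemma measurable_packet_hat a q : measurable_fun setT (packet_hat a q).
Proof. by have /measurable_int/measurable_EFinP := integrable_packet_hat a q. Qed.

Lemma Rintegral_packet_hat a q : (0 < q)%N ->
  \int[mu]_xi packet_hat a q xi = a * (2 * pi) ^+ n.
Proof.
move=> q0.
have [h1 h2] := Rintegral_euclid_prod (fun d : 'I_n => integrable_comb q (freq R n q d)).
rewrite (RintegralZl _ measurableT h1) h2; congr (_ * _).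
rewrite -[in RHS](card_ord n) -prodr_const.
by apply: eq_bigr => d _; exact: Rintegral_comb.
Qed.

Lemma lorentz_prod_ge0 xi : 0 <= lorentz_prod xi.
Proof. by apply: prodr_ge0 => d _; exact: lorentz_ge0. Qed.

Lemma integrable_lorentz_prod : mu.-integrable setT (EFin \o lorentz_prod).
Proof.
have li : leb.-integrable setT (EFin \o @lorentz R).
  by apply: eq_integrable (@integrable_lorentz R 0) => // x _ /=; rewrite subr0.
by have [h1 _] := @Rintegral_euclid_prod R n (fun=> @lorentz R) (fun=> li).
Qed.

Lemma Rintegral_lorentz_prod : \int[mu]_xi lorentz_prod xi = (2 * pi) ^+ n.
Proof.
have li : leb.-integrable setT (EFin \o @lorentz R).
  by apply: eq_integrable (@integrable_lorentz R 0) => // x _ /=; rewrite subr0.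
have [_ ->] := @Rintegral_euclid_prod R n (fun=> @lorentz R) (fun=> li).
rewrite prodr_const card_ord; congr (_ ^+ _).
by rewrite -(Rintegral_lorentz 0); apply: eq_Rintegral => x _; rewrite subr0.
Qed.

(** Both the scalar product and the squared norm are sums over coordinates, so the propagator
    factorises and packets evolve coordinate by coordinate. *)
Lemma schrodinger_phase_prod a q t x xi :
  expi (dotp x xi + t * enorm xi ^+ 2) * Complex (packet_hat a q xi) 0 =
  Complex a 0 * \prod_(d < n) (expi (phase t (tnth x d) (tnth xi d)) *
     Complex (comb q (freq R n q d) (tnth xi d)) 0).
Proof.
rewrite sqr_enorm mulr_sumr -big_split expi_sum big_split cprod_real/=.
rewrite /packet_hat -creal_mul mulrCA; congr (_ * (_ * _)).
Qed.

Lemma cintegral_packet_evolved a q t x :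
  cintegral mu setT (fun xi => expi (dotp x xi + t * enorm xi ^+ 2) *
    Complex (packet_hat a q xi) 0) = packet_evolved a q t x.
Proof.
pose h (d : 'I_n) (k : R) := expi (phase t (tnth x d) k) *
     Complex (comb q (freq R n q d) k) 0.
have [h1 h2] := @cintegral_euclid_prod R n h (fun d => cintegrable_evolved _ _ _ _).
transitivity (cintegral mu setT (fun xi => Complex a 0 * \prod_(d < n) h d (tnth xi d))).
  by apply: eq_cintegral => xi _; rewrite schrodinger_phase_prod.
by rewrite cintegralZ// h2.
Qed.

Lemma normc_packet_evolved_le a q t x : (0 < q)%N -> 0 <= a ->
  Normc.normc (packet_evolved a q t x) <= a * (2 * pi) ^+ n.
Proof.
move=> q0 a0; rewrite Normc.normcM normc_real ger0_norm// ler_wpM2l//.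
rewrite normc_prod -[in leRHS](card_ord n) -prodr_const.
by apply: ler_prod => d _; rewrite normc_ge0 normc_evolved_le.
Qed.

Lemma packet_evolved_coherent a q x : (0 < q)%N -> 0 <= a ->
  (forall d, `|tnth x d| <= 24^-1) ->
  exists2 k, (0 < k <= modulus q ^ n)%N &
    a * (pi / 2) ^+ n <= Normc.normc (packet_evolved a q (times R n q k) x).
Proof.
move=> q0 a0 x24.
have [|k kQ Hk] := @coherent_time R n q (nth 0 x) q0.
  by move=> d dn; have := x24 (Ordinal dn); rewrite (tnth_nth 0).
exists k => //; rewrite Normc.normcM normc_real ger0_norm// ler_wpM2l//.
rewrite normc_prod -[in leLHS](card_ord n) -prodr_const.
apply: ler_prod => d _; rewrite divr_ge0 ?pi_ge0//=.
by have := Hk d (ltn_ord d); rewrite (tnth_nth 0).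
Qed.

Lemma packet_evolved_escapes a t eps : (0 < n)%N -> 0 < t -> 0 < eps -> 0 <= a ->
  exists N, forall q, (N <= q)%N -> forall x, (forall d, `|tnth x d| <= 24^-1) ->
    Normc.normc (packet_evolved a q t x) <= eps.
Proof.
move=> n0 t0 e0 a0.
(* The minimum with 1 gives [del ^+ n <= del], and [a + 1] avoids a division by 0. *)
pose del := Num.min 1 (eps / (a + 1)).
have a1 : 0 < a + 1 by rewrite ltr_wpDl.
have d0 : 0 < del by rewrite lt_min ltr01 divr_gt0.
have [N HN] := evolved_escapes n t0 d0.
exists N => q Nq x x24; rewrite Normc.normcM normc_real ger0_norm//.
apply: (@le_trans _ _ (a * del)).
  rewrite ler_wpM2l// normc_prod.
  apply: (@le_trans _ _ (\prod_(d < n) del)).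
    by apply: ler_prod => d _; rewrite normc_ge0 HN.
  rewrite prodr_const card_ord -[leRHS]expr1 ler_wiXn2l//.
    exact: ltW.
  by rewrite /del ge_min lexx.
apply: (@le_trans _ _ (a * (eps / (a + 1)))).
  by rewrite ler_wpM2l// /del ge_min lexx orbT.
by rewrite mulrCA ler_piMr ?(ltW e0)// ler_pdivrMr// mul1r lerDl.
Qed.

Lemma packet_hat_small a rho eps : (0 < n)%N -> 0 < eps -> 0 <= a -> 0 <= rho ->
  exists N, forall q, (N <= q)%N -> forall xi, (forall d, `|tnth xi d| <= rho) ->
    packet_hat a q xi <= eps * lorentz_prod xi.
Proof.
move=> n0 e0 a0 r0.
pose B := 4 * (1 + rho ^+ 2) * (a / eps + 1).
have ae : 0 <= a / eps by rewrite divr_ge0// ltW.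
have B0 : 0 <= B by rewrite !mulr_ge0// ?addr_ge0// sqr_ge0.
exists (Num.truncn (B + rho)).+1 => q Nq xi xir.
have q0 : (0 < q)%N by rewrite (leq_trans _ Nq).
have qB : B + rho <= q%:R.
  by apply: (le_trans (ltW (truncnS_gt _))); rewrite ler_nat.
have q1 : 1 <= q%:R :> R by rewrite ler1n.
have qL := spacing_ge R n q0.
(* The gain per coordinate. From [g * (a / eps + 1) <= 1] follow both [g <= 1], hence [g ^+ n <= g],
   and [a * g <= eps]. *)
pose g := 4 * (1 + rho ^+ 2) / (64 * 64 * q%:R) ^+ 2.
have g0 : 0 <= g by rewrite divr_ge0 ?sqr_ge0// mulr_ge0// addr_ge0// sqr_ge0.
have gB : g * (a / eps + 1) <= 1.
  rewrite /g mulrAC -/B ler_pdivrMr ?exprn_gt0//; last by lra.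
  by rewrite mul1r expr2; nra.
have g1 : g <= 1 by rewrite (le_trans _ gB)// ler_peMr// lerDr.
apply: (@le_trans _ _ (a * \prod_(d < n) (g * lorentz (tnth xi d)))).
  rewrite ler_wpM2l//; apply: ler_prod => d _; rewrite comb_ge0/=.
  apply: (le_trans (@cauchy_box R n q d _ q0 _)).
    by have := xir d; lra.
  rewrite ler_wpM2r ?lorentz_ge0// ler_wpM2r ?invr_ge0 ?sqr_ge0//.
  rewrite ler_pM2l// lerD2l -[leLHS]real_normK ?num_real//.
  by rewrite lerXn2r ?nnegrE.
rewrite big_split/= prodr_const card_ord mulrA ler_wpM2r ?lorentz_prod_ge0//.
apply: (@le_trans _ _ (a * g)).
  by rewrite ler_wpM2l// -[leRHS]expr1 ler_wiXn2l.
move: gB; rewrite mulrDr mulr1 => gB.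
have : g * (a / eps) <= 1 by lra.
by rewrite mulrA ler_pdivrMr// mul1r mulrC.
Qed.

Lemma dotp_ge_coord xi (d : 'I_n) : tnth xi d ^+ 2 <= dotp xi xi.
Proof.
by rewrite /dotp (bigD1 d)//= -expr2 lerDl sumr_ge0// => e _; exact: sqr_ge0.
Qed.

Lemma coord_le_enorm xi (d : 'I_n) : `|tnth xi d| <= enorm xi.
Proof.
by rewrite /enorm -sqrtr_sqr ler_wsqrtr// dotp_ge_coord.
Qed.

Lemma measurable_dotp : measurable_fun setT (fun xi : euclid R n => dotp xi xi).
Proof.
by apply: measurable_sum => d; apply: measurable_funM; exact: measurable_tnth.
Qed.

Lemma measurable_enorm : measurable_fun setT (@enorm R n).
Proof.
apply: measurableT_comp measurable_dotp.
by apply: continuous_measurable_fun; exact: sqrt_continuous.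
Qed.

Lemma measurable_ball_euclid (r : R) : measurable [set xi : euclid R n | enorm xi <= r].
Proof.
have := measurable_enorm measurableT (measurable_itv `]-oo, r]).
by rewrite setTI; congr (measurable _); apply/seteqP; split => xi /=; rewrite in_itv.
Qed.

Lemma sobolev_weight_measurable (s : R) :
  measurable_fun setT (fun xi : euclid R n => (1 + enorm xi ^+ 2) `^ s).
Proof.
apply: (measurableT_comp (measurable_powR _)).
under eq_fun do rewrite sqr_enorm.
by apply: measurable_funD => //; exact: measurable_dotp.
Qed.

(* Interpolates the Sobolev weight between the exponents 0 and 1. *)
Lemma powR_le_affine (s y l : R) : 0 <= s <= 1 -> 0 < l -> 0 < y ->
  y `^ s <= l `^ s * (1 + y / l).
Proof.
move=> /andP[s0 s1] l0 y0.
have yl : 0 < y / l by rewrite divr_gt0.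
have {1}-> : y = l * (y / l) by rewrite mulrC divfK// gt_eqF.
rewrite powRM ?(ltW l0) ?(ltW yl)// ler_pM2l ?powR_gt0//.
have [h|h] := lerP (y / l) 1.
  rewrite (@le_trans _ _ 1)// ?lerDl ?(ltW yl)//.
  have -> : 1 = 1 `^ s :> R by rewrite powR1.
  by rewrite ge0_ler_powR ?nnegrE// ltW.
rewrite (@le_trans _ _ (y / l))// ?lerDr//.
by rewrite -[leRHS]powRr1 ?(ltW yl)// ler_powR// ltW.
Qed.

(** Of the two factors in the square, one is bounded uniformly together with the weight, which
    yields [q^-n], and the other is integrated, which yields [(2 pi)^n]. Interpolation reduces the
    weight to the exponents 0 and 1; for the latter, the coordinate carrying the square uses
    [comb84] and all others [comb10]. *)
Lemma sobolev_packet_hat (s a : R) q : (0 < q)%N -> 0 <= s <= 1 ->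
  (\int[mu]_xi ((1 + enorm xi ^+ 2) `^ s * packet_hat a q xi ^+ 2)%:E <=
   (a ^+ 2 * (2 + 84 * n%:R) * (20 * pi) ^+ n *
     ((spacing R n q * q%:R) ^+ 2) `^ s / q%:R ^+ n)%:E)%E.
Proof.
move=> q0 s01; set l := (_ * _) ^+ 2.
have q1 : 1 <= q%:R :> R by rewrite ler1n.
have qL := spacing_ge R n q0.
have L1 : 2 <= spacing R n q by lra.
have l1 : 1 <= l by rewrite exprn_ege1//; nra.
have qL2 : q%:R <= spacing R n q ^+ 2 by rewrite expr2; nra.
have ql : q%:R <= l by rewrite /l expr2; nra.
have qp : 0 < q%:R :> R by rewrite ltr0n.
pose M : R := l `^ s * ((2 + 84 * n%:R) * (10 / q%:R) ^+ n).
have comb10 d (x : R) : comb q (freq R n q d) x <= 10 / q%:R.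
  rewrite mulrC /comb ler_pM2l ?invr_gt0//.
  by apply: (@spikes_le10 _ _ _ (spacing R n q)) => // m k _ _; exact: freq_sep.
have comb84 d (x : R) : x ^+ 2 * comb q (freq R n q d) x <= 84 * l / q%:R.
  rewrite [leRHS]mulrC /comb mulrCA ler_pM2l ?invr_gt0//.
  apply: (@sqr_spikes_le _ _ _ (spacing R n q) (spacing R n q * q%:R)) => //.
    by move=> m k _ _; exact: freq_sep.
  move=> m mq; rewrite ger0_norm ?freq_le//.
  by rewrite (le_trans _ (freq_ge R n d m q0))//; lra.
have c0 (d : 'I_n) (xi : euclid R n) := @comb_ge0 R q (freq R n q d) (tnth xi d).
have key xi : (1 + enorm xi ^+ 2) `^ s * packet_hat a q xi ^+ 2 <=
    a ^+ 2 * M * packet_hat 1 q xi.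
  rewrite /packet_hat mul1r; set P := \prod_(d < n) _.
  have P0 : 0 <= P by apply: prodr_ge0.
  have P10 : P <= (10 / q%:R) ^+ n.
    rewrite -[in leRHS](card_ord n) -prodr_const.
    by apply: ler_prod => d _; rewrite c0 comb10.
  have D84 : dotp xi xi * P <= n%:R * (84 * l * (10 / q%:R) ^+ n).
    rewrite /dotp mulr_suml -sumr_ord_const; apply: ler_sum => d _.
    have e10 : (10 / q%:R) ^+ n = 10 / q%:R * \prod_(e < n | e != d) (10 / q%:R) :> R.
      by rewrite -[in LHS](card_ord n) -prodr_const (bigD1 d).
    rewrite e10 mulrA /P (bigD1 d)//=.
    set C := comb _ _ _; set P' := \prod_(e < n | _) _.
    rewrite (_ : _ * _ = (tnth xi d ^+ 2 * C) * P'); last by rewrite expr2; ring.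
    apply: ler_pM.
    - by apply: mulr_ge0; [exact: sqr_ge0|exact: c0].
    - by apply: prodr_ge0.
    - apply: (le_trans (comb84 d _)); apply: ler_wpM2l; first by lra.
      by rewrite ler_peMl ?invr_ge0// ler1n.
    - by apply: ler_prod => e _; rewrite c0 comb10.
  have W : (1 + enorm xi ^+ 2) `^ s * P <= M.
    have D0 : 0 <= dotp xi xi by rewrite -sqr_enorm sqr_ge0.
    apply: (@le_trans _ _ (l `^ s * (1 + (1 + enorm xi ^+ 2) / l) * P)).
      apply: ler_wpM2r => //; apply: powR_le_affine => //; first by lra.
      by rewrite ltr_pwDl// sqr_ge0.
    rewrite /M -mulrA ler_wpM2l ?powR_ge0// sqr_enorm.
    have l0 : 0 < l by lra.
    apply: (@le_trans _ _ (2 * P + dotp xi xi * P / l)).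
      rewrite -subr_ge0 (_ : _ - _ = P * (1 - l^-1)); last by ring.
      by rewrite mulr_ge0// subr_ge0 invf_le1.
    rewrite [leRHS]mulrDl; apply: lerD; first by rewrite ler_pM2l.
    rewrite ler_pdivrMr//; apply: (le_trans D84); rewrite le_eqVlt; apply/orP; left; apply/eqP; ring.
  rewrite exprMn expr2 (_ : _ * _ = a ^+ 2 * ((1 + enorm xi ^+ 2) `^ s * P) * P); last first.
    by rewrite expr2; ring.
  by rewrite ler_wpM2r// ler_wpM2l// sqr_ge0.
have i1 := integrableZl measurableT (a ^+ 2 * M) (integrable_packet_hat 1 q).
apply: (@le_trans _ _ (\int[mu]_xi (a ^+ 2 * M * packet_hat 1 q xi)%:E)%E).
  apply: ge0_le_integral => //.
  - by move=> xi _; rewrite lee_fin mulr_ge0 ?powR_ge0 ?sqr_ge0.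
  - apply/measurable_EFinP; apply: measurable_funM.
      exact: sobolev_weight_measurable.
    by apply: measurable_funX; exact: measurable_packet_hat.
  - by apply/measurable_EFinP; apply: measurable_funM => //; exact: measurable_packet_hat.
  - by move=> xi _; rewrite lee_fin.
rewrite -(fineK (integrable_fin_num _ i1))// lee_fin.
rewrite -[leLHS]/(\int[mu]_v (a ^+ 2 * M * packet_hat 1 q v)).
rewrite (RintegralZl _ measurableT (integrable_packet_hat 1 q)) Rintegral_packet_hat// mul1r.
rewrite le_eqVlt; apply/orP; left; apply/eqP.
rewrite /M (_ : 20 * pi = 10 * (2 * pi)); last by ring.
by rewrite !exprMn exprVn; ring.
Qed.

End packet.

(** * Sums of packets *)

Section series_facts.
Variable R : realType.

Lemma sum_pow_half k m : \sum_(k <= i < m) (2 ^- i.+1 : R) <= 2 ^- k.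
Proof.
have [mk|km] := leqP m k; first by rewrite big_geq// invr_ge0 exprn_ge0.
suff H : \sum_(k <= i < m) (2 ^- i.+1 : R) = 2 ^- k - 2 ^- m.
  by rewrite H lerBlDr lerDl invr_ge0 exprn_ge0.
rewrite -(subnKC (ltnW km)); elim: (m - k)%N => [|j IH].
  by rewrite addn0 big_geq// subrr.
rewrite addnS big_nat_recr ?leq_addr//= IH exprS invfM.
have : 2 ^+ (k + j) != 0 :> R by rewrite expf_neq0.
by move: (2 ^+ (k + j)) (2 ^- k) => p r p0; field.
Qed.

Lemma series_sum_small (c : nat -> R) (M : R) k :
  (forall i, 0 <= c i) -> (forall i, (k <= i)%N -> c i <= 2 ^- i.+1 * M) ->
  (forall i, c i <= series_sum c) /\
  0 <= series_sum c - \sum_(i < k) c i <= M.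
Proof.
move=> c0 cM.
have M0 : 0 <= M.
  have := le_trans (c0 k) (cM k (leqnn k)).
  by rewrite pmulr_rge0 ?invr_gt0 ?exprn_gt0.
pose S m := \sum_(i < m) c i.
have ndS : nondecreasing_seq S.
  move=> m1 m2 m12; rewrite /S -!(big_mkord xpredT) (big_cat_nat _ m12)//=.
  by rewrite lerDl sumr_ge0.
have SM m : S m <= S k + M.
  have [mk|km] := leqP m k; first by rewrite (le_trans (ndS _ _ mk))// lerDl.
  rewrite /S -(big_mkord xpredT) (big_cat_nat _ (ltnW km))//= big_mkord lerD2l.
  apply: (@le_trans _ _ (\sum_(k <= i < m) 2 ^- i.+1 * M)).
    by rewrite big_nat_cond [leRHS]big_nat_cond; apply: ler_sum => i /andP[/andP[ki _] _]; exact: cM.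
  rewrite -mulr_suml ler_piMl//; apply: (le_trans (sum_pow_half k m)).
  by rewrite invf_le1 ?exprn_gt0// exprn_ege1// ler1n.
have cS : cvgn S.
  by apply: nondecreasing_is_cvgn => //; exists (S k + M) => _ [m _ <-].
have SE : series_sum c = limn S by apply: series_sum_cvg; exact: cS.
have leS m : S m <= series_sum c by rewrite SE; exact: nondecreasing_cvgn_le.
split.
  move=> i; apply: le_trans (leS i.+1).
  by rewrite /S big_ord_recr/= lerDr sumr_ge0.
rewrite subr_ge0 leS/= lerBlDl SE.
by apply: limr_le => //; near=> m; exact: SM.
Unshelve. all: by end_near. Qed.

End series_facts.

Section L2_facts.
Context d (T : measurableType d) (R : realType).
Variable mu : {measure set T -> \bar R}.

Lemma in_L2D (f g : T -> R[i]) : in_L2 mu f -> in_L2 mu g ->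
  in_L2 mu (fun x => f x + g x).
Proof.
move=> [mf fL] [mg gL].
have mfg : cmeasurable (fun x => f x + g x).
  move: mf mg => [f1 f2] [g1 g2]; split.
    by under eq_fun do rewrite cReD; exact: measurable_funD.
  by under eq_fun do rewrite cImD; exact: measurable_funD.
split => //.
have m2 (h : T -> R[i]) : cmeasurable h ->
    measurable_fun setT (fun x => (2 * Normc.normc (h x) ^+ 2)%:E).
  by move=> mh; apply/measurable_EFinP; apply: measurable_funM => //; exact: cmeasurable_normc2.
apply: (@le_lt_trans _ _ (\int[mu]_x ((2 * Normc.normc (f x) ^+ 2)%:E + (2 * Normc.normc (g x) ^+ 2)%:E))%E).
  apply: ge0_le_integral => //.
  - by move=> x _; rewrite lee_fin sqr_ge0.
  - by apply/measurable_EFinP; exact: cmeasurable_normc2.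
  - by apply: emeasurable_funD; exact: m2.
  - move=> x _; rewrite -EFinD lee_fin.
    apply: (@le_trans _ _ ((Normc.normc (f x) + Normc.normc (g x)) ^+ 2)).
      by rewrite lerXn2r ?nnegrE ?addr_ge0 ?normc_ge0// le_normcD.
    rewrite -subr_ge0 (_ : _ - _ = (Normc.normc (f x) - Normc.normc (g x)) ^+ 2) ?sqr_ge0//.
    by ring.
have fin (h : T -> R[i]) : cmeasurable h -> (L2norm_sq mu h < +oo)%E ->
    (\int[mu]_x (2 * Normc.normc (h x) ^+ 2)%:E < +oo)%E.
  move=> mh hL; under eq_integral do rewrite EFinM.
  rewrite ge0_integralZl//.
  - by apply: lte_mul_pinfty.
  - by apply/measurable_EFinP; exact: cmeasurable_normc2.
  - by move=> x _; rewrite lee_fin sqr_ge0.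
rewrite ge0_integralD//; try exact: m2.
- by apply: lte_add_pinfty; exact: fin.
- by move=> x _; rewrite lee_fin mulr_ge0// sqr_ge0.
- by move=> x _; rewrite lee_fin mulr_ge0// sqr_ge0.
Qed.

Lemma in_L2_sum (F : nat -> T -> R[i]) k : (forall i, in_L2 mu (F i)) ->
  in_L2 mu (fun x => \sum_(i < k) F i x).
Proof.
move=> FL; elim: k => [|k IH].
  split.
    by under eq_fun do rewrite big_ord0; exact: cmeasurable_cst.
  rewrite /L2norm_sq integral0_eq ?ltry// => x _.
  by rewrite big_ord0 Normc.normc0 expr0n.
by under eq_fun do rewrite big_ord_recr; exact: in_L2D.
Qed.

Lemma cseries_sum_L2 (F : nat -> T -> R[i]) : (forall i, cmeasurable (F i)) ->
  (forall i, L2norm_sq mu (F i) <= (4 ^- i)%:E)%E ->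
  in_L2 mu (cseries_sum F) /\
  cvg_L2 mu (fun k x => \sum_(i < k) F i x) (cseries_sum F).
Proof.
move=> mF FL.
have H k := @cseries_sum_tail_le _ _ _ mu F (cst 1) k mF (measurable_cst _) (fun=> ler01).
have {}H k : (\int[mu]_x (Normc.normc (cseries_sum F x - \sum_(i < k) F i x) ^+ 2)%:E
   <= (4 / 2 ^+ k)%:E)%E.
  have := H k; under eq_integral do rewrite mul1r; apply.
  by move=> i; have := FL i; rewrite /L2norm_sq; congr (_ <= _)%E; apply: eq_integral => x _; rewrite mul1r.
split.
  split; first exact: cmeasurable_cseries_sum.
  apply: (@le_lt_trans _ _ (4 / 2 ^+ 0)%:E); last exact: ltry.
  have := H 0%N; rewrite /L2norm_sq.
  by under eq_integral do rewrite big_ord0 subr0.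
rewrite /cvg_L2.
apply: (@squeeze_cvge _ _ _ _ (cst 0%E) _ (fun k => (4 / 2 ^+ k)%:E)).
- near=> k; apply/andP; split.
    by apply: integral_ge0 => x _; rewrite lee_fin sqr_ge0.
  apply: le_trans (H k); rewrite /L2norm_sq.
  rewrite (eq_integral (fun x => (Normc.normc (cseries_sum F x - \sum_(i < k) F i x) ^+ 2)%:E))//.
  by move=> x _; rewrite -normcN opprB.
- exact: cvg_cst.
- apply/cvg_EFin; first by near=> k.
  have := @cvg_geometric R 4 2^-1; rewrite ger0_norm// invf_lt1// ltr1n.
  move=> /(_ isT); rewrite (_ : geometric 4 2^-1 = fine \o (fun k => (4 / 2 ^+ k)%:E))//.
  by apply/funext => k; rewrite /= exprVn.
Unshelve. all: by end_near. Qed.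

Lemma cintegral_setC (D : set T) (f : T -> R[i]) : measurable D ->
  cintegrable mu setT f ->
  cintegral mu setT f = cintegral mu D f + cintegral mu (~` D) f.
Proof.
move=> mD [f1 f2]; apply: eq_complexP; rewrite ?cReD ?cImD/= -(setUv D) Rintegral_setU//.
- exact: measurableC.
- by rewrite setUv.
- exact/disj_setPCl.
- exact: measurableC.
- by rewrite setUv.
- exact/disj_setPCl.
Qed.

Lemma cintegrableS (D : set T) (f : T -> R[i]) : measurable D ->
  cintegrable mu setT f -> cintegrable mu D f.
Proof. by move=> mD [f1 f2]; split; apply: integrableS (@subsetT _ D) _. Qed.

Lemma integral_tail (g : T -> R) (B : nat -> set T) eps :
  (forall K, measurable (B K)) -> {homo B : K L / (K <= L)%N >-> K `<=` L} ->
  (forall x, exists K, B K x) -> mu.-integrable setT (EFin \o g) ->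
  (forall x, 0 <= g x) -> 0 < eps ->
  exists K0, forall K, (K0 <= K)%N -> \int[mu]_(x in ~` B K) g x <= eps.
Proof.
move=> mB ndB covB gi g0 e0.
have BT : \bigcup_K B K = setT.
  by apply/seteqP; split => // x _; have [K BK] := covB x; exists K.
have mg : measurable_fun setT (EFin \o g) by have /measurable_int := gi.
have giB K : mu.-integrable (B K) (EFin \o g) by apply: integrableS gi.
have cvgI : (fun K => \int[mu]_(x in B K) (g x)%:E)%E @ \oo --> (\int[mu]_x (g x)%:E)%E.
  rewrite -BT; apply: ge0_nondecreasing_set_cvg_integral => //.
  - by move=> K L KL; rewrite subsetEset; exact: ndB.
  - by move=> K; exact: measurable_funS mg.
  - by move=> K x _; rewrite lee_fin.
have cvgR : (fun K => \int[mu]_(x in B K) g x) @ \oo --> \int[mu]_x g x.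
  have fI : (\int[mu]_x (g x)%:E)%E \is a fin_num by exact: integrable_fin_num.
  rewrite -(fineK fI) in cvgI.
  by have /fine_cvgP[_] := cvgI.
have lt : \int[mu]_x g x - eps < \int[mu]_x g x by rewrite gtrBl.
have [K0 _ HK] := cvgr_ge _ cvgR _ lt.
exists K0 => K K0K; have := HK K K0K; rewrite /= -{1}(setUv (B K)) Rintegral_setU//.
- by move=> h; lra.
- exact: measurableC.
- by rewrite setUv.
- exact/disj_setPCl.
Qed.

End L2_facts.

(** * Truncated integrals and the transform of a series *)

Section assembly.
Variables (R : realType) (n : nat).
Local Notation mu := (@lebesgue_measure_euclid R n).

Definition cube : set (euclid R n) := [set x | forall d, `|tnth x d| <= 24^-1].

Definition ball2 (K : nat) : set (euclid R n) := [set xi | enorm xi <= 2 ^+ K].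

Lemma measurable_ball2 K : measurable (ball2 K).
Proof. exact: measurable_ball_euclid. Qed.

Lemma ball2S K L : (K <= L)%N -> ball2 K `<=` ball2 L.
Proof.
move=> KL xi /=; move=> /le_trans; apply; rewrite ler_weXn2l// ler1n//.
Qed.

Lemma ball2_cover xi : exists K, ball2 K xi.
Proof.
exists (Num.truncn (enorm xi)).+1 => /=.
apply: (le_trans (ltW (truncnS_gt _))); rewrite -natrX ler_nat ltnW//.
exact: ltn_expl.
Qed.

(** The partial sums are the approximating sequence required by [is_fourier_L2]: they are
    integrable, and their transforms add up by linearity. *)
Lemma series_is_fourier_L2 (F Fh : nat -> euclid R n -> R[i]) :
  (forall i, cmeasurable (F i)) -> (forall i, cmeasurable (Fh i)) ->
  (forall i, cintegrable mu setT (F i)) ->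
  (forall i xi, cintegrable mu setT (fun x => F i x * expi (- dotp x xi))) ->
  (forall i xi, fourier_L1 (F i) xi = Fh i xi) ->
  (forall i, L2norm_sq mu (F i) <= (4 ^- i)%:E)%E ->
  (forall i, L2norm_sq mu (Fh i) <= (4 ^- i)%:E)%E ->
  is_fourier_L2 (cseries_sum F) (cseries_sum Fh).
Proof.
move=> mF mFh iF iFe FE LF LFh.
have [F1 F2] := cseries_sum_L2 mF LF.
have [G1 G2] := cseries_sum_L2 mFh LFh.
split; [exact: F1|exact: G1|].
exists (fun k x => \sum_(i < k) F i x); split; [|exact: F2|].
- move=> k; split; first exact: cintegrable_sum.
  apply: in_L2_sum => i; split => //.
  by rewrite (le_lt_trans (LF i))// ltry.
- rewrite (_ : (fun k => fourier_L1 _) = (fun k xi => \sum_(i < k) Fh i xi)); first exact: G2.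
  apply/funext => k; apply/funext => xi.
  transitivity (cintegral mu setT (fun x => \sum_(i < k) (F i x * expi (- dotp x xi)))).
    by apply: eq_cintegral => x _; rewrite mulr_suml.
  rewrite cintegral_sum//; apply: eq_bigr => i _; exact: FE.
Qed.

(** Non-integrability excludes the first alternative of [schrodinger_value]. A large truncated
    integral, even along a subsequence of balls, then forces a large value. *)
Lemma schrodinger_value_truncated (fhat : euclid R n -> R[i]) t x v :
  ~ cintegrable mu setT fhat -> schrodinger_value fhat t x v ->
  forall e, 0 < e -> exists K0, forall K, (K0 <= K)%N ->
    Normc.normc (schrodinger_integral (ball2 K) fhat t x) <= Normc.normc v + e.
Proof.
move=> nf [[//]|[_ cv]] e e0.
have e0' : (0 : R[i]) < Complex e 0 by rewrite ltcE/= eqxx.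
have /cvgrPdist_lt/(_ _ e0')[K0 _ HK] := cv.
exists K0 => K K0K; have vw := HK K K0K.
have {}vw : Normc.normc (v - schrodinger_integral (ball2 K) fhat t x) < e.
  by move: vw; rewrite /mkset normc_E ltcE => /andP[].
rewrite -[X in Normc.normc X <= _](subKr v) (le_trans (le_normcD _ _))// lerD2l normcN.
exact: ltW.
Qed.

End assembly.

Lemma cube_measurable_measure (R : realType) (n : nat) :
  measurable (@cube R n) /\
  @lebesgue_measure_euclid R n (@cube R n) = (12^-1 ^+ n)%:E.
Proof.
elim: n => [|n [IH1 IH2]].
  have -> : @cube R 0 = setT by apply/seteqP; split => // x _ [].
  split => //.
  by change (\d_([tuple] : euclid R 0) setT = (1 : R)%:E :> \bar R); rewrite diracT.
have cE : @cube R n.+1 = [set v | `[(- 24^-1 : R), 24^-1]%classic (thead v) /\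
    @cube R n [tuple of behead v]].
  apply/seteqP; split => v /=.
    move=> H; rewrite in_itv/= -ler_norml; split; first exact: H.
    by move=> d; have := H (lift ord0 d); rewrite [in tnth v _](tuple_eta v) tnthS.
  rewrite in_itv/= -ler_norml => -[h0 hS] d.
  case: (unliftP ord0 d) => [e ->|->]; last exact: h0.
  by have := hS e; rewrite [in tnth v _](tuple_eta v) tnthS.
have mI : measurable (`[(- 24^-1 : R), 24^-1]%classic : set (measurableTypeR R)).
  exact: measurable_itv.
split.
  rewrite cE (_ : [set v | _] = @euclid_uncons R n @^-1` (`[(- 24^-1 : R), 24^-1]%classic `*` @cube R n))//.
  rewrite -[X in measurable X]setTI.
  by apply: measurable_euclid_uncons => //; exact: measurableX.
rewrite cE lebesgue_measure_euclidS// IH2 lebesgue_measure_itv/= lte_fin.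
rewrite ifT; last by rewrite ltrNl; lra.
rewrite -EFinB -EFinM exprS; congr ((_ * _)%:E); by field.
Qed.

(** * The gliding hump *)

(** Strong recursion: a scale has to satisfy its own condition and finitely many conditions relative
    to earlier scales, each of which holds from some threshold on. *)
Lemma gliding_sequence (own : nat -> nat -> Prop)
    (pair : nat -> nat -> nat -> nat -> Prop) :
  (forall i, exists N, forall q, (N <= q)%N -> own i q) ->
  (forall j p i, exists N, forall q, (N <= q)%N -> pair j p i q) ->
  exists Q : nat -> nat,
    forall i, own i (Q i) /\ forall j, (j < i)%N -> pair j (Q j) i (Q i).
Proof.
move=> /choice[N1 H1] H2.
have /choice[N2 {}H2] : forall x : nat * nat * nat, exists N, forall q,
    (N <= q)%N -> pair x.1.1 x.1.2 x.2 q.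
  by move=> [[j p] i]; exact: H2.
(* [s] lists the scales already chosen; the sum of the thresholds is a common upper bound for
   them. *)
pose next (s : seq nat) := (N1 (size s) +
  \sum_(j < size s) N2 (j : nat, nth 0%N s j, size s))%N.
pose pre := fix pre n := if n is n'.+1 then rcons (pre n') (next (pre n')) else [::].
have spre n : size (pre n) = n by elim: n => //= n IH; rewrite size_rcons IH.
pose Q n := next (pre n).
have npre n j : (j < n)%N -> nth 0%N (pre n) j = Q j.
  elim: n => // n IH; rewrite ltnS leq_eqVlt => /predU1P[->|jn] /=.
    by rewrite nth_rcons spre ltnn eqxx.
  by rewrite nth_rcons spre jn IH.
exists Q => i; split.
  by apply: H1; rewrite /Q /next spre leq_addr.
move=> j ji; apply: (H2 (j, Q j, i)); rewrite /Q {2}/next.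
have ji' : (j < size (pre i))%N by rewrite spre.
rewrite (bigD1 (Ordinal ji'))//= npre//.
by rewrite {2}spre addnCA leq_addr.
Qed.

Section gliding_hump.
Variables (R : realType) (n : nat).
Local Notation mu := (@lebesgue_measure_euclid R n).

(** An earlier packet may reach its amplitude times [(2 pi)^n], which is [4^n] times the guaranteed
    factor [(pi / 2)^n] of the current one. The ratio [4 ^+ n.+1] leaves the earlier packets at most
    a third of the main term. *)
Definition amplitude (i : nat) : R := (4 ^+ n.+1) ^+ i.

Lemma amplitude_gt0 i : 0 < amplitude i.
Proof. by rewrite !exprn_gt0. Qed.

Lemma amplitude_ge i : i%:R <= amplitude i.
Proof.
apply: (@le_trans _ _ (2 ^+ i)).
  by rewrite -natrX ler_nat ltnW// ltn_expl.
rewrite /amplitude lerXn2r ?nnegrE ?exprn_ge0//.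
rewrite exprS (@le_trans _ _ (4 * 1))// ?ler_pM2l ?exprn_ege1//; lra.
Qed.

Lemma sum_amplitude j : 4 ^+ n * \sum_(i < j) amplitude i <= amplitude j / 3.
Proof.
elim: j => [|j IH]; first by rewrite big_ord0 mulr0 divr_ge0// ltW// amplitude_gt0.
rewrite big_ord_recr/= mulrDr.
have -> : amplitude j.+1 = 4 * (4 ^+ n * amplitude j) by rewrite /amplitude !exprS mulrA.
have : amplitude j <= 4 ^+ n * amplitude j.
  by rewrite ler_peMl ?exprn_ege1 ?ler1n// ltW// amplitude_gt0.
by lra.
Qed.

Lemma packet_norms_small s a eps : (0 < n)%N -> 0 <= s ->
  s < (n%:R - 2) / (2 * n%:R) -> 0 < eps ->
  exists N, forall q, (N <= q)%N ->
    (L2norm_sq mu (packet a q) <= eps%:E)%E /\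
    (\int[mu]_xi ((1 + enorm xi ^+ 2) `^ s * packet_hat a q xi ^+ 2)%:E <= eps%:E)%E.
Proof.
move=> n0 s0 sn e0.
have s1 : 0 <= s <= 1.
  rewrite s0 (le_trans (ltW sn))// ler_pdivrMr ?mulr_gt0 ?ltr0n// mul1r.
  have np : 0 < n%:R :> R by rewrite ltr0n.
  by lra.
have C1 : 0 <= a ^+ 2 * 10 ^+ n by rewrite mulr_ge0 ?sqr_ge0 ?exprn_ge0.
have C2 : 0 <= a ^+ 2 * (2 + 84 * n%:R) * (20 * pi) ^+ n.
  apply: mulr_ge0; last by rewrite exprn_ge0// mulr_ge0// pi_ge0.
  by rewrite mulr_ge0 ?sqr_ge0// addr_ge0// mulr_ge0.
(* With exponent 0 the weight is 1, so the same growth estimate also handles the L2 norm. *)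
have [N1 H1] := frequency_growth n0 (lexx 0) C1 e0 (le_lt_trans s0 sn).
have [N2 H2] := frequency_growth n0 s0 C2 e0 sn.
exists (maxn N1 N2) => q; rewrite geq_max => /andP[/H1[q0 h1] /H2[_ h2]]; split.
  apply: (le_trans (L2norm_packet _ _ q0)); rewrite lee_fin.
  by move: h1; rewrite powRr0 mulr1 expr_div_n mulrA.
by apply: (le_trans (sobolev_packet_hat _ _ q0 s1)); rewrite lee_fin.
Qed.

(** A packet of scale [p] uses finitely many times, all positive, so the largest of their thresholds
    serves for all of them. *)
Lemma packet_evolved_small p a eps : (0 < n)%N -> 0 < eps -> 0 <= a ->
  exists N, forall q, (N <= q)%N -> forall k, (0 < k <= modulus p ^ n)%N ->
    forall x, @cube R n x ->
    Normc.normc (packet_evolved a q (times R n p k) x) <= eps.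
Proof.
move=> n0 e0 a0.
have [->|p0] := posnP p.
  exists 0%N => q _ k; rewrite /modulus muln0 exp0n// leqn0 => /andP[k0 /eqP k0'].
  by rewrite k0' in k0.
have /choice[N HN] : forall k, exists N, (0 < k)%N -> forall q, (N <= q)%N ->
    forall x, @cube R n x -> Normc.normc (packet_evolved a q (times R n p k) x) <= eps.
  move=> k; have [->|k0] := posnP k; first by exists 0%N.
  have [N HN] := packet_evolved_escapes n0 (times_gt0 R n p0 k0) e0 a0.
  by exists N.
exists (\max_(k < (modulus p ^ n).+1) N k) => q Nq k /andP[k0 kM].
apply: HN => //; apply: leq_trans Nq.
by rewrite (leq_bigmax (Ordinal (kM : (k < (modulus p ^ n).+1)%N))).
Qed.

(* [Q i] is the scale of the [i]-th packet, and the ball of radius [2 ^+ K i]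
   carries almost all of its Fourier transform. *)
Definition gliding_packets (s : R) (Q K : nat -> nat) := forall i,
  [/\ (i < Q i)%N /\ (Q i <= K i)%N,
      (L2norm_sq mu (@packet R n (amplitude i) (Q i)) <= (4 ^- i)%:E)%E,
      (\int[mu]_xi ((1 + @enorm R n xi ^+ 2) `^ s *
         packet_hat (amplitude i) (Q i) xi ^+ 2)%:E <= (4 ^- i)%:E)%E,
      forall L, (K i <= L)%N ->
        \int[mu]_(xi in ~` @ball2 R n L) packet_hat (amplitude i) (Q i) xi <= 2 ^- i &
      forall j, (j < i)%N ->
        [/\ (K j <= Q i)%N,
            forall xi, @ball2 R n (K j) xi ->
              packet_hat (amplitude i) (Q i) xi <= 2 ^- i.+1 * lorentz_prod xi &
            forall k, (0 < k <= modulus (Q j) ^ n)%N -> forall x, @cube R n x ->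
              Normc.normc (packet_evolved (amplitude i) (Q i) (times R n (Q j) k) x)
                <= 2 ^- i]].

(** The ball of a packet must be known before the next scale is chosen. [K] is therefore fixed
    first, as a function of the number and the scale of a packet, so that the pair conditions can
    mention [K (j, p)]. *)
Lemma gliding_packets_exist s : (0 < n)%N -> 0 <= s ->
  s < (n%:R - 2) / (2 * n%:R) -> exists Q K, gliding_packets s Q K.
Proof.
move=> n0 s0 sn.
have two0 i : 0 < 2 ^- i :> R by rewrite invr_gt0 exprn_gt0.
have amp0 i := ltW (amplitude_gt0 i).
have /choice[K HK] : forall z : nat * nat, exists K, (z.2 <= K)%N /\
    forall L, (K <= L)%N ->
      \int[mu]_(xi in ~` @ball2 R n L) packet_hat (amplitude z.1) z.2 xi <= 2 ^- z.1.
  move=> [i q] /=.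
  have [K HK] := @integral_tail _ _ _ mu _ (@ball2 R n) (2 ^- i)
    (@measurable_ball2 R n) (@ball2S R n) (@ball2_cover R n)
    (integrable_packet_hat _ (amplitude i) q)
    (fun xi => packet_hat_ge0 _ xi (amp0 i)) (two0 i).
  by exists (maxn q K); split => [|L]; rewrite ?leq_maxl// geq_max => /andP[_ /HK].
pose own i q := (i < q)%N /\
  (L2norm_sq mu (packet (amplitude i) q) <= (4 ^- i)%:E)%E /\
  (\int[mu]_xi ((1 + @enorm R n xi ^+ 2) `^ s *
         packet_hat (amplitude i) q xi ^+ 2)%:E <= (4 ^- i)%:E)%E.
pose pair j p i q := [/\ (K (j, p) <= q)%N,
            forall xi, @ball2 R n (K (j, p)) xi ->
              packet_hat (amplitude i) q xi <= 2 ^- i.+1 * lorentz_prod xi &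
            forall k, (0 < k <= modulus p ^ n)%N -> forall x, @cube R n x ->
              Normc.normc (packet_evolved (amplitude i) q (times R n p k) x)
                <= 2 ^- i].
have [||Q HQ] := @gliding_sequence own pair.
- move=> i; have e0 : 0 < 4 ^- i :> R by rewrite invr_gt0 exprn_gt0.
  have [N HN] := packet_norms_small (amplitude i) n0 s0 sn e0.
  exists (maxn i.+1 N) => q; rewrite geq_max => /andP[iq /HN[h1 h2]].
  by split.
- move=> j p i.
  have r0 : 0 <= 2 ^+ K (j, p) :> R by rewrite exprn_ge0.
  have [N1 H1] := packet_hat_small n0 (two0 i.+1) (amp0 i) r0.
  have [N2 H2] := packet_evolved_small p n0 (two0 i) (amp0 i).
  exists (maxn (K (j, p)) (maxn N1 N2)) => q.
  rewrite !geq_max => /and3P[Kq /H1 h1 /H2 h2]; split=> // xi xiB; apply: h1 => d.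
  exact: le_trans (coord_le_enorm _ _) xiB.
exists Q, (fun i => K (i, Q i)) => i.
have [[q1 [q2 q3]] q4] := HQ i; have [k1 k2] := HK (i, Q i).
by split.
Qed.

End gliding_hump.

(** * Divergence of the evolution on the cube *)

Section divergence.
Variables (R : realType) (n : nat) (s : R) (Q K : nat -> nat).
Hypotheses (s_ge0 : 0 <= s)
  (QK : @gliding_packets R n s Q K).
Local Notation mu := (@lebesgue_measure_euclid R n).

Let G (i : nat) (xi : euclid R n) : R := packet_hat (amplitude R n i) (Q i) xi.

Definition hump_sum : euclid R n -> R[i] :=
  cseries_sum (fun i => packet (amplitude R n i) (Q i)).

Definition hump_hat : euclid R n -> R[i] :=
  cseries_sum (fun i xi => Complex (G i xi) 0).

Let amp_ge0 i : 0 <= amplitude R n i.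
Proof. exact: ltW (amplitude_gt0 R n i). Qed.

Let Q_gt0 i : (0 < Q i)%N.
Proof. by have [[iQ _] _ _ _ _] := QK i; rewrite (leq_ltn_trans _ iQ). Qed.

Let K_gt i : (i < K i)%N.
Proof. by have [[iQ QKi] _ _ _ _] := QK i; exact: leq_trans iQ QKi. Qed.

Let K_le : {homo K : i j / (i <= j)%N}.
Proof.
move=> i j; rewrite leq_eqVlt => /predU1P[->//|ij].
have [[_ QKj] _ _ _ /(_ _ ij)[KQ _ _]] := QK j; exact: leq_trans KQ QKj.
Qed.

Let G_ge0 i xi : 0 <= G i xi.
Proof. exact: packet_hat_ge0. Qed.

Let cmG i : cmeasurable (fun xi => Complex (G i xi) 0).
Proof. by split; [exact: measurable_packet_hat|exact: measurable_cst]. Qed.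

Lemma hump_hatE xi : hump_hat xi = Complex (series_sum (G^~ xi)) 0.
Proof.
apply: eq_complexP => //=; apply: series_sum_cvg.
under eq_fun do rewrite big1//.
exact: cvg_cst.
Qed.

(** On this ball the packets after [l] are bounded by a geometric series times [lorentz_prod]. As
    these balls exhaust the space, the series of transforms converges at every point. *)
Lemma hump_hat_tail l xi : @ball2 R n (K l) xi ->
  (forall i, G i xi <= series_sum (G^~ xi)) /\
  0 <= series_sum (G^~ xi) - \sum_(i < l.+1) G i xi <= lorentz_prod xi.
Proof.
move=> xiK; apply: series_sum_small => // i li.
by have [_ _ _ _ /(_ _ li)[_ + _]] := QK i; apply.
Qed.

Lemma hump_hat_ge i xi : G i xi <= series_sum (G^~ xi).
Proof.
have [L xiL] := ball2_cover xi.
by have [] := @hump_hat_tail L xi (ball2S (ltnW (K_gt L)) xiL).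
Qed.

Lemma normc_hump_hat_sqr i xi : Normc.normc (Complex (G i xi) 0) ^+ 2 = G i xi ^+ 2.
Proof. by rewrite normc_real real_normK ?num_real. Qed.

Lemma hump_fourier : is_fourier_L2 hump_sum hump_hat.
Proof.
apply: series_is_fourier_L2.
- by move=> i; exact: cmeasurable_packet.
- exact: cmG.
- by move=> i; exact: cintegrable_packet.
- by move=> i xi; exact: cintegrable_packet_fourier.
- by move=> i xi; exact: fourier_packet.
- by move=> i; have [] := QK i.
move=> i; have [_ _ h _ _] := QK i; apply: le_trans h.
rewrite /L2norm_sq; apply: ge0_le_integral => //.
- by move=> xi _; rewrite lee_fin sqr_ge0.
- by apply/measurable_EFinP; exact: cmeasurable_normc2.
- apply/measurable_EFinP; apply: measurable_funM.
    exact: sobolev_weight_measurable.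
  by apply: measurable_funX; exact: measurable_packet_hat.
move=> xi _; rewrite lee_fin normc_hump_hat_sqr ler_peMl ?sqr_ge0//.
by rewrite -[leLHS](powRr0 (1 + enorm xi ^+ 2)) ler_powR// lerDl sqr_ge0.
Qed.

Lemma hump_sobolev : sobolev s hump_sum.
Proof.
have [fL2 _ _] := hump_fourier; split; first exact: fL2.
exists hump_hat; first exact: hump_fourier.
have W0 (xi : euclid R n) : 0 <= (1 + enorm xi ^+ 2) `^ s by exact: powR_ge0.
have mW := @sobolev_weight_measurable R n s.
have := @cseries_sum_tail_le _ _ _ mu (fun i xi => Complex (G i xi) 0)
  (fun xi => (1 + enorm xi ^+ 2) `^ s) 0 cmG mW W0.
have GW i : (\int[mu]_xi ((1 + enorm xi ^+ 2) `^ s *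
    Normc.normc (Complex (G i xi) 0) ^+ 2)%:E <= (4 ^- i)%:E)%E.
  under eq_integral do rewrite normc_hump_hat_sqr.
  by have [] := QK i.
move=> /(_ GW) h; apply: le_lt_trans (ltry (4 / 2 ^+ 0)); apply: le_trans h.
by under [leRHS]eq_integral do rewrite big_ord0 subr0.
Qed.

(** The terms are nonnegative, so the integral would dominate that of every packet, which is at
    least its amplitude; the amplitudes are unbounded. *)
Lemma hump_hat_not_integrable : ~ cintegrable mu setT hump_hat.
Proof.
move=> [gi _].
have {}gi : mu.-integrable setT (EFin \o (fun xi => series_sum (G^~ xi))).
  by apply: eq_integrable gi => // xi _; rewrite hump_hatE.
set I := \int[mu]_xi series_sum (G^~ xi).
have GI i : amplitude R n i <= I.
  apply: (@le_trans _ _ (\int[mu]_xi G i xi)).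
    rewrite Rintegral_packet_hat// ler_peMr// exprn_ege1//.
    by have := @pi_ge2 R; lra.
  apply: le_Rintegral => //; first exact: integrable_packet_hat.
  by move=> xi _; exact: hump_hat_ge.
have := le_trans (amplitude_ge R n (Num.truncn I).+1) (GI _).
by rewrite leNgt truncnS_gt.
Qed.

Let propagator (t : R) (x xi : euclid R n) : R[i] :=
  expi (dotp x xi + t * enorm xi ^+ 2).

Let cm_propagator t x : cmeasurable (propagator t x).
Proof.
apply: cmeasurable_expi; apply: measurable_funD.
  apply: measurable_sum => d; apply: measurable_funM => //.
  exact: measurable_tnth.
apply: measurable_funM => //; apply: measurable_funX; exact: measurable_enorm.
Qed.

Let cm_propagator_packet t x i :
  cmeasurable (fun xi => propagator t x xi * Complex (G i xi) 0).
Proof. by apply: cmeasurableM. Qed.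

Let normc_propagator t x xi z : Normc.normc (propagator t x xi * z) = Normc.normc z.
Proof. by rewrite Normc.normcM normc_expi mul1r. Qed.

Let propagator_packet_integrable t x i :
  cintegrable mu setT (fun xi => propagator t x xi * Complex (G i xi) 0).
Proof.
apply: (cintegrable_le measurableT (cm_propagator_packet t x i)
  (integrable_packet_hat _ (amplitude R n i) (Q i))).
by move=> xi _; rewrite normc_propagator normc_real ger0_norm.
Qed.

Let truncated_packet t x i L : (K i <= L)%N ->
  Normc.normc (cintegral mu (@ball2 R n L)
      (fun xi => propagator t x xi * Complex (G i xi) 0)
    - packet_evolved (amplitude R n i) (Q i) t x) <= 2 ^- i.
Proof.
move=> KL; have [_ _ _ /(_ _ KL) GL _] := QK i; apply: le_trans GL.
rewrite -cintegral_packet_evolved (cintegral_setC (measurable_ball2 (n := n) L)); last first.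
  exact: propagator_packet_integrable.
rewrite opprD addNKr normcN.
have mB := measurableC (@measurable_ball2 R n L).
apply: normc_cintegral_le.
- exact: mB.
- exact: cm_propagator_packet.
- by apply: (integrableS measurableT mB) (integrable_packet_hat _ _ _).
- move=> xi _; rewrite normc_propagator normc_real ger0_norm//.
  exact: packet_hat_ge0.
Qed.

Lemma sum_half_le2 m : \sum_(i < m) (2 ^- i : R) <= 2.
Proof.
have := sum_pow_half R 0 m; rewrite expr0 invr1 big_mkord => h.
have -> : \sum_(i < m) (2 ^- i : R) = 2 * \sum_(i < m) 2 ^- i.+1.
  rewrite mulr_sumr; apply: eq_bigr => i _.
  by rewrite exprS invfM mulrA divff// mul1r.
by lra.
Qed.

(** The balance at a time favourable to packet [j]: its own share is [amplitude j * (pi / 2)^n], the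
    earlier packets take at most a third of it, the later ones up to [l] at most 2, the truncation
    of all packets up to [l] at most 2, and those beyond [l] at most [(2 pi)^n]. Finally
    [(pi / 2)^n >= 1]. *)
Lemma truncated_hump_large x j l k : @cube R n x -> (j <= l)%N ->
  (0 < k <= modulus (Q j) ^ n)%N ->
  amplitude R n j * (pi / 2) ^+ n <=
    Normc.normc (packet_evolved (amplitude R n j) (Q j) (times R n (Q j) k) x) ->
  amplitude R n j * (2 / 3) - 4 - (2 * pi) ^+ n <=
    Normc.normc (cintegral mu (@ball2 R n (K l))
      (fun xi => expi (dotp x xi + times R n (Q j) k * enorm xi ^+ 2) * hump_hat xi)).
Proof.
move=> xc jl kM; set t := times _ _ _ _ => Pj.
pose P i := packet_evolved (amplitude R n i) (Q i) t x.
pose D := @ball2 R n (K l).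
have mD : measurable D by exact: measurable_ball2.
pose H i := cintegral mu D (fun xi => propagator t x xi * Complex (G i xi) 0).
pose rest xi := hump_hat xi - \sum_(i < l.+1) Complex (G i xi) 0.
have restE xi : rest xi = Complex (series_sum (G^~ xi) - \sum_(i < l.+1) G i xi) 0.
  by rewrite /rest hump_hatE; apply: eq_complexP;
    rewrite ?cReD ?cImD ?cReN ?cImN ?cRe_sum ?cIm_sum//= big1// subr0.
have cmr : cmeasurable (fun xi => propagator t x xi * rest xi).
  apply: cmeasurableM; first exact: cm_propagator.
  apply: cmeasurableB; first exact: cmeasurable_cseries_sum.
  exact: cmeasurable_sum.
have nr xi : D xi -> Normc.normc (propagator t x xi * rest xi) <= lorentz_prod xi.
  move=> Dxi; rewrite normc_propagator restE normc_real.
  by have [_ /andP[h0 h1]] := hump_hat_tail Dxi; rewrite ger0_norm.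
have iL : mu.-integrable D (EFin \o @lorentz_prod R n).
  by apply: integrableS (integrable_lorentz_prod R n).
have ri : cintegrable mu D (fun xi => propagator t x xi * rest xi).
  exact: (cintegrable_le mD cmr iL nr).
have rle : Normc.normc (cintegral mu D (fun xi => propagator t x xi * rest xi))
    <= (2 * pi) ^+ n.
  apply: (le_trans (normc_cintegral_le mD cmr iL nr)).
  rewrite -Rintegral_lorentz_prod -[in leRHS](setUv D) Rintegral_setU//; last first.
  - exact/disj_setPCl.
  - by rewrite setUv; exact: integrable_lorentz_prod.
  - exact: measurableC.
  by rewrite lerDl; apply: Rintegral_ge0 => xi _; exact: lorentz_prod_ge0.
set J := cintegral _ _ _.
have Hi i : cintegrable mu D (fun xi => propagator t x xi * Complex (G i xi) 0).
  exact: (cintegrableS mD (propagator_packet_integrable t x i)).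
have JE : J = \sum_(i < l.+1) H i + cintegral mu D (fun xi => propagator t x xi * rest xi).
  have := cintegral_sum mD (index_enum 'I_l.+1) (fun i : 'I_l.+1 => Hi i) => <-.
  rewrite -cintegralD//; last exact: cintegrable_sum.
  apply: eq_cintegral => xi _.
  by rewrite -mulr_sumr -mulrDr /rest [X in _ = _ * X]addrC subrK.
have {}JE : P j = J - \sum_(i < l.+1) (H i - P i) -
    cintegral mu D (fun xi => propagator t x xi * rest xi) -
    \sum_(i < l.+1 | i != inord j) P i.
  rewrite JE sumrB (bigD1 (inord j : 'I_l.+1))//= inordK//.
  by rewrite [in RHS](bigD1 (inord j : 'I_l.+1) (F := fun i : 'I_l.+1 => P i))//= inordK//; ring.
have HP : \sum_(i < l.+1) Normc.normc (H i - P i) <= 2.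
  apply: le_trans (sum_half_le2 l.+1); apply: ler_sum => i _.
  by apply: truncated_packet; apply: K_le; rewrite -ltnS.
have PP : \sum_(i < l.+1 | i != inord j) Normc.normc (P i) <=
    amplitude R n j / 3 * (pi / 2) ^+ n + 2.
  apply: (@le_trans _ _ (\sum_(i < l.+1) ((if (i < j)%N then amplitude R n i * (2 * pi) ^+ n else 0) + 2 ^- i))).
    rewrite big_mkcond; apply: ler_sum => i _.
    have i2 : 0 <= 2 ^- i :> R by rewrite invr_ge0 exprn_ge0.
    case: ifPn => [ij|_]; last first.
      rewrite addr_ge0//; case: ifP => // _.
      by rewrite mulr_ge0// exprn_ge0// mulr_ge0// pi_ge0.
    have [ilj|jli|ji] := ltngtP i j.
    - by rewrite (le_trans (normc_packet_evolved_le _ _ _ _))// lerDl.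
    - rewrite add0r; have [_ _ _ _ /(_ _ jli)[_ _]] := QK i; exact.
    - by move: ij; rewrite -val_eqE/= inordK ?ltnS// ji eqxx.
  rewrite big_split lerD ?sum_half_le2//=.
  rewrite -big_mkcond/= -(big_ord_widen l.+1 (fun i => amplitude R n i * (2 * pi) ^+ n)); last exact: ltnW.
  rewrite -mulr_suml (_ : 2 * pi = 4 * (pi / 2)); last by field.
  rewrite exprMn mulrA ler_wpM2r ?exprn_ge0 ?divr_ge0 ?pi_ge0//.
  by rewrite mulrC sum_amplitude.
have pi1 : 1 <= (pi / 2) ^+ n :> R by apply: exprn_ege1; have := pi_ge2 R; lra.
have := le_trans Pj (le_refl _); rewrite -/(P j) JE => {}Pj.
have {Pj} : amplitude R n j * (pi / 2) ^+ n <=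
    Normc.normc J + 2 + (2 * pi) ^+ n + (amplitude R n j / 3 * (pi / 2) ^+ n + 2).
  apply: (le_trans Pj).
  apply: (le_trans (le_normcD _ _)); rewrite normcN; apply: lerD; last first.
    exact: le_trans (normc_sum _ _ _) PP.
  apply: (le_trans (le_normcD _ _)); rewrite normcN; apply: lerD => //.
  apply: (le_trans (le_normcD _ _)); rewrite normcN; apply: lerD => //.
  exact: le_trans (normc_sum _ _ _) HP.
have : amplitude R n j <= amplitude R n j * (pi / 2) ^+ n by rewrite ler_peMr.
by move: (amplitude R n j) (Normc.normc J) ((2 * pi) ^+ n) ((pi / 2) ^+ n) => *; nra.
Qed.

Lemma hump_value_large x j : @cube R n x -> exists t,
  [/\ 0 < t, t <= 8 / (Q j)%:R & forall v, schrodinger_value hump_hat t x v ->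
    (2 * pi) ^- n * (amplitude R n j * (2 / 3) - 4 - (2 * pi) ^+ n) <=
      Normc.normc v + 1].
Proof.
move=> xc.
have [k kM Pk] := packet_evolved_coherent (Q_gt0 j) (amp_ge0 j) xc.
have /andP[k0 kM'] := kM.
exists (times R n (Q j) k); split.
- exact: times_gt0.
- apply: (le_trans (times_le _ (Q_gt0 j) kM')).
  have Qp : 0 < (Q j)%:R :> R by rewrite ltr0n.
  have : (Q j)%:R <= (modulus (Q j))%:R :> R by rewrite ler_nat modulus_ge.
  move=> QM; apply: ler_pM => //.
  + by rewrite mulr_ge0// pi_ge0.
  + by have := @pi_le4 R; lra.
  + by rewrite lef_pV2 ?posrE// (lt_le_trans Qp).
move=> v vv.
have [K0 HK] := schrodinger_value_truncated hump_hat_not_integrable vv ltr01.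
(* The ball of index [K l] has to hold most of packet [j], whence [j <= l], and to lie beyond the
   threshold [K0], which holds since [K l > l >= K0]. *)
pose l := maxn j K0.
have lK : (K0 <= K l)%N by rewrite (leq_trans (leq_maxr j K0))// ltnW.
apply: le_trans (HK _ lK); rewrite /schrodinger_integral Normc.normcM normc_real.
rewrite ger0_norm; last by rewrite invr_ge0 exprn_ge0// mulr_ge0// pi_ge0.
rewrite ler_wpM2l ?invr_ge0 ?exprn_ge0 ?mulr_ge0 ?pi_ge0//.
by apply: truncated_hump_large => //; exact: leq_maxl.
Qed.

Lemma hump_diverges x : @cube R n x -> ~ schrodinger_cvg_at hump_sum hump_hat x.
Proof.
move=> xc [u uval ucvg].
have e1 : (0 : R[i]) < Complex 1 0 by rewrite ltcE/= eqxx/=.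
have /cvgrPdist_lt/(_ _ e1) unear := ucvg.
pose F0 : R := Normc.normc (hump_sum x).
have [d /= d0 Hd] : \forall t \near (0 : R)^', schrodinger_value hump_hat t x (u t) /\
    Normc.normc (u t) <= F0 + 1.
  near=> t; split; first by near: t.
  have : `|hump_sum x - u t| < Complex 1 0 by near: t.
  rewrite normc_E ltcE => /andP[_ /= h].
  rewrite -[X in Normc.normc X <= _](subKr (hump_sum x)) (le_trans (le_normcD _ _))//.
  by rewrite lerD2l normcN ltW.
(* The values are bounded by [F0 + 1] near time 0, and truncation costs another 1. *)
pose C : R := F0 + 2.
pose p : R := (2 * pi) ^+ n.
have p0 : 0 < p by rewrite exprn_gt0// mulr_gt0// pi_gt0.
(* The first summand forces [t <= 8 / Q j < d], because [Q j > j]. The second makes the amplitude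
   exceed [3 / 2 * (C * p + 4 + p)], which contradicts the bound [C]. *)
pose B : R := 8 / d + (C * p + 4 + p) * 2.
pose j := (Num.truncn B).+1.
have jB : B < j%:R by exact: truncnS_gt.
have C0 : 0 <= C by rewrite addr_ge0//; exact: normc_ge0.
have Cp : 0 <= C * p by rewrite mulr_ge0// ltW.
have d8 : 0 < 8 / d by rewrite divr_gt0.
have [t [t0 tQ Ht]] := hump_value_large j xc.
have td : t < d.
  apply: (le_lt_trans tQ).
  have jQ : j%:R <= (Q j)%:R :> R.
    by rewrite ler_nat; have [[jQ _] _ _ _ _] := QK j; exact: ltnW.
  rewrite ltr_pdivrMr ?ltr0n// mulrC -ltr_pdivrMr//.
  by move: jB; rewrite /B; lra.
have [|vt ut] := Hd t _ (lt0r_neq0 t0).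
  by rewrite /ball/= sub0r normrN gtr0_norm.
have := Ht _ vt; rewrite -/p => h.
have {h} : p^-1 * (amplitude R n j * (2 / 3) - 4 - p) <= C by rewrite /C; lra.
rewrite mulrC ler_pdivrMr//.
have := amplitude_ge R n j.
by move: jB; rewrite /B; lra.
Unshelve. all: by end_near. Qed.

End divergence.

Theorem theorem2 (R : realType) (n : nat) (hn : (4 < n)%N) (s : R)
    (hs : 0 <= s)
    (hconv : forall f fhat : euclid R n -> complex R,
      sobolev s f -> is_fourier_L2 f fhat ->
      {ae @lebesgue_measure_euclid R n,
        forall x : euclid R n, schrodinger_cvg_at f fhat x}) :
  (n%:R - 2) / (2 * n%:R) <= s.
Proof.
rewrite leNgt; apply/negP => sn.
have n0 : (0 < n)%N by exact: leq_trans hn.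
have [Q [K QK]] := gliding_packets_exist n0 hs sn.
have [N [mN N0 HN]] := hconv _ _ (hump_sobolev hs QK) (hump_fourier hs QK).
have [mcube cubeE] := cube_measurable_measure R n.
(* The null set supplied by the hypothesis would contain the whole cube, whose measure [12^-1 ^+ n]
   is positive. *)
have : (@lebesgue_measure_euclid R n (@cube R n) <= 0)%E.
  rewrite -N0; apply: le_measure; rewrite ?inE//.
  by move=> x xc; apply: HN => /= h; exact: (hump_diverges QK xc h).
by rewrite cubeE lee_fin leNgt exprn_gt0.
Qed.
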